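(* Let $(M^{2n},g,J)$ be a compact complex manifold with static metric $g$, with static constant $\lambda$ and Kähler form $\omega$. If $\lambda\neq0$, then $M$ is a Hermitian-symplectic manifold, and specifically $\omega$ is the $(1,1)$-part of a Hermitian-symplectic form $\tilde\omega$. Furthermore, one has $$\int_M\tilde\omega^{\wedge n}>0.$$
   Context: A Hermitian-symplectic structure (form) on a complex manifold $(M^{2n},J)$ is a real two-form $\eta$ with $d\eta=0$ whose $(1,1)$-part (with respect to $J$) is positive definite; $M$ is Hermitian-symplectic if it admits such a structure. For a Hermitian metric $g$ the Kähler form is $\omega=\frac{\sqrt{-1}}{2}g_{i\bar j}\,dz^i\wedge d\bar z^j$, and $g$ is pluriclosed if $\partial\bar\partial\omega=0$. $\partial^*,\bar\partial^*$ are the $L^2(g)$-adjoints of $\partial,\bar\partial$, normalized so that $(\partial^*\omega)_{\bar k}=\frac{\sqrt{-1}}{2}g^{p\bar q}(\partial_{\bar q}g_{p\bar k}-\partial_{\bar k}g_{p\bar q})$ and $(\bar\partial^*\omega)_j=\frac{\sqrt{-1}}{2}g^{p\bar q}(\partial_j g_{p\bar q}-\partial_p g_{j\bar q})$. A pluriclosed metric $g$ is static with constant $\lambda\in\mathbb{R}$ if $-\partial\partial^*\omega-\bar\partial\bar\partial^*\omega-\frac{\sqrt{-1}}{2}\partial\bar\partial\log\det g=\lambda\omega$ and $\mathrm{Vol}(g)=1$. *)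

(* Defs.v *)
From HB Require Import structures.
From mathcomp Require Import all_boot all_order all_fingroup all_algebra.
From mathcomp Require Import all_classical all_reals all_analysis.
From mathcomp Require Import complex.

Set Implicit Arguments.
Unset Strict Implicit.
Unset Printing Implicit Defensive.

Import Order.TTheory GRing.Theory Num.Theory.
Import numFieldNormedType.Exports.

Local Open Scope classical_set_scope.
Local Open Scope ring_scope.
Local Open Scope complex_scope.

(* C^n is the real normed space R^n x R^n; (x, y) stands for x + i y. *)
Definition Cn (R : realType) (n : nat) : normedModType R :=
  ('rV[R]_n * 'rV[R]_n)%type.

(* u : TC R n is the complexified tangent vector
   \sum_j u.1_j d/dz_j + u.2_j d/d\bar z_j. *)
Definition TC (R : realType) (n : nat) : lmodType R[i] :=
  ('rV[R[i]]_n * 'rV[R[i]]_n)%type.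

Section Calculus.
Context {R : realType} {n : nat}.
Implicit Types (U : set (Cn R n)) (z : Cn R n) (u : TC R n).

Fixpoint Ck (k : nat) U (f : Cn R n -> R) : Prop :=
  (forall z, U z -> {for z, continuous f}) /\
  if k is k'.+1 then
    forall v : Cn R n,
      (forall z, U z -> derivable f z v) /\ Ck k' U (fun z => 'D_v f z)
  else True.

Definition smooth U (f : Cn R n -> R) := forall k, Ck k U f.

Definition smoothC U (f : Cn R n -> R[i]) :=
  smooth U (fun z => complex.Re (f z)) /\ smooth U (fun z => complex.Im (f z)).

Definition Cderive (f : Cn R n -> R[i]) z (v : Cn R n) : R[i] :=
  'D_v (fun w => complex.Re (f w)) z +i* 'D_v (fun w => complex.Im (f w)) z.

Definition dirx (j : 'I_n) : Cn R n := (delta_mx 0 j, 0).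
Definition diry (j : 'I_n) : Cn R n := (0, delta_mx 0 j).

Definition dz (j : 'I_n) (f : Cn R n -> R[i]) z : R[i] :=
  (Cderive f z (dirx j) - 'i * Cderive f z (diry j)) / 2%:R.
Definition dzbar (j : 'I_n) (f : Cn R n -> R[i]) z : R[i] :=
  (Cderive f z (dirx j) + 'i * Cderive f z (diry j)) / 2%:R.

Definition cdiff (f : Cn R n -> R[i]) z u : R[i] :=
  \sum_(j < n) (u.1 0 j * dz j f z + u.2 0 j * dzbar j f z).

Definition coord (j : 'I_n) z : R[i] := z.1 0 j +i* z.2 0 j.

Definition holomorphic U (F : Cn R n -> Cn R n) :=
  forall k : 'I_n, smoothC U (coord k \o F) /\
    forall (j : 'I_n) z, U z -> dzbar j (coord k \o F) z = 0.

Definition holo_jacobian (F : Cn R n -> Cn R n) z : 'M[R[i]]_n :=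
  \matrix_(k, j) dz j (coord k \o F) z.

Definition pushforward (F : Cn R n -> Cn R n) z u : TC R n :=
  (\row_k cdiff (coord k \o F) z u,
   \row_k cdiff (fun w => (coord k (F w))^*) z u).

End Calculus.

Definition mform (R : realType) (n k : nat) := ('I_k -> TC R n) -> R[i].

Section Exterior.
Context {R : realType} {n : nat}.
Implicit Types (z : Cn R n) (u : TC R n).

Definition multilinear k (a : mform R n k) :=
  forall (v : 'I_k -> TC R n) (i : 'I_k) (c : R[i]) (u w : TC R n),
    a [eta v with i |-> c *: u + w] =
    c * a [eta v with i |-> u] + a [eta v with i |-> w].

Definition alternating k (a : mform R n k) :=
  forall (v : 'I_k -> TC R n) (i j : 'I_k), i != j -> v i = v j -> a v = 0.

(* Normalized so that (a /\ b)(u, v) = a(u) b(v) - a(v) b(u) for 1-forms. *)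
Definition wedge k l (a : mform R n k) (b : mform R n l) : mform R n (k + l) :=
  fun v => ((k`! * l`!)%N%:R)^-1 *
    \sum_(s : 'S_(k + l)) (-1) ^+ s *
      a (fun i => v (s (lshift l i))) * b (fun j => v (s (rshift k j))).

Fixpoint wedge_pow (a : mform R n 2) (m : nat) : mform R n (m * 2) :=
  match m with
  | 0 => fun=> 1
  | m'.+1 => wedge a (@wedge_pow a m')
  end.
Arguments wedge_pow a m : clear implicits.

Definition hol_part u : TC R n := (u.1, 0).
Definition antihol_part u : TC R n := (0, u.2).

(* The component of type (p, k - p) of a k-form. *)
Definition bidegree k (p : nat) (a : mform R n k) : mform R n k :=
  fun v => \sum_(S : {set 'I_k} | #|S| == p)
    a (fun i => if i \in S then hol_part (v i) else antihol_part (v i)).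

(* Cartan's formula on constant vector fields, whose brackets vanish. *)
Definition ext_d k (a : Cn R n -> mform R n k) : Cn R n -> mform R n k.+1 :=
  fun z v => \sum_(i < k.+1)
    (-1) ^+ i * cdiff (fun w => a w (fun j => v (lift i j))) z (v i).

Definition del k (a : Cn R n -> mform R n k) : Cn R n -> mform R n k.+1 :=
  fun z v => \sum_(p < k.+1)
    bidegree p.+1 (ext_d (fun w => bidegree p (a w)) z) v.

Definition delbar k (a : Cn R n -> mform R n k) : Cn R n -> mform R n k.+1 :=
  fun z v => \sum_(p < k.+1)
    bidegree p (ext_d (fun w => bidegree p (a w)) z) v.

Definition form_dz (j : 'I_n) : mform R n 1 := fun v => (v 0).1 0 j.
Definition form_dzbar (j : 'I_n) : mform R n 1 := fun v => (v 0).2 0 j.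

Definition conj_vec u : TC R n := (map_mx conjc u.2, map_mx conjc u.1).

Definition real_mform k (a : mform R n k) :=
  forall v, a (fun i => conj_vec (v i)) = (a v)^*.

Definition real_vec (u : 'rV[R[i]]_n) : TC R n := (u, map_mx conjc u).
Definition cplx_J u : TC R n := ('i *: u.1, - 'i *: u.2).

(* a(X, JX) > 0 for every nonzero real tangent vector X. *)
Definition positive_mform (a : mform R n 2) :=
  forall u : 'rV[R[i]]_n, u != 0 ->
    0 < a (fun i : 'I_2 => if i == 0 then real_vec u else cplx_J (real_vec u)).

(* The positively oriented real frame d/dx_1, d/dy_1, ..., d/dx_n, d/dy_n. *)
Definition real_frame (m : 'I_(n * 2)) : TC R n :=
  let e : 'rV[R[i]]_n := \row_(j < n) ((j : nat) == m./2)%:R in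
  if odd m then cplx_J (real_vec e) else real_vec e.

(* a = top_coef a * dx_1 /\ dy_1 /\ ... /\ dx_n /\ dy_n. *)
Definition top_coef (a : mform R n (n * 2)) : R[i] := a real_frame.

End Exterior.
Arguments wedge_pow {R n} a m _.

Section Integration.
Context {R : realType}.

(* By Fubini, the integral against Lebesgue measure on R^m when f is continuous
   with compact support, the only case in which it is used. *)
Fixpoint integral_rV (m : nat) : ('rV[R]_m -> R) -> R :=
  match m with
  | 0 => fun f => f 0
  | m'.+1 => fun f => \int[@lebesgue_measure R]_x
      integral_rV (fun v : 'rV[R]_m' => f (row_mx (x%:M : 'rV[R]_1) v))
  end.

Definition integral_Cn n (f : Cn R n -> R[i]) : R[i] :=
  let I (h : Cn R n -> R) := integral_rV (fun x => integral_rV (fun y => h (x, y)))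
  in I (fun z => complex.Re (f z)) +i* I (fun z => complex.Im (f z)).

End Integration.

(* [cm_inv c] is only meaningful on the image of the chart [c]. *)
Record complexManifold (R : realType) (n : nat) := ComplexManifold {
  cm_space :> topologicalType ;
  cm_hausdorff : hausdorff_space cm_space ;
  cm_countable : @second_countable cm_space ;
  cm_index : Type ;
  cm_dom : cm_index -> set cm_space ;
  cm_map : cm_index -> cm_space -> Cn R n ;
  cm_inv : cm_index -> Cn R n -> cm_space ;
  cm_dom_open : forall c, open (cm_dom c) ;
  cm_cover : forall x, exists c, cm_dom c x ;
  cm_image_open : forall c, open (cm_map c @` cm_dom c) ;
  cm_mapK : forall c x, cm_dom c x -> cm_inv c (cm_map c x) = x ;
  cm_map_continuous : forall c x, cm_dom c x -> {for x, continuous (cm_map c)} ;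
  cm_inv_continuous : forall c z, (cm_map c @` cm_dom c) z ->
    {for z, continuous (cm_inv c)} ;
  cm_holomorphic : forall c c',
    holomorphic (cm_map c @` (cm_dom c `&` cm_dom c'))
                (cm_map c' \o cm_inv c)
}.

Section Manifold.
Context {R : realType} {n : nat}.
Variable M : complexManifold R n.

Definition chart_image (c : cm_index M) : set (Cn R n) :=
  cm_map c @` cm_dom c.
Definition chart_overlap (c c' : cm_index M) : set (Cn R n) :=
  cm_map c @` (cm_dom c `&` cm_dom c').
Definition transition (c c' : cm_index M) : Cn R n -> Cn R n :=
  cm_map c' \o cm_inv c.

(* A differential form on M is given by its expressions in the charts; only
   their values on the chart images matter. *)
Definition local_forms (k : nat) := cm_index M -> Cn R n -> mform R n k.

Record is_form k (a : local_forms k) : Prop := IsForm {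
  form_multilinear : forall c z, chart_image c z -> multilinear (a c z) ;
  form_alternating : forall c z, chart_image c z -> alternating (a c z) ;
  form_smooth : forall c v, smoothC (chart_image c) (fun z => a c z v) ;
  form_compat : forall c c' z, chart_overlap c c' z -> forall v,
    a c z v = a c' (transition c c' z)
                (fun l => pushforward (transition c c') z (v l))
}.

Definition real_form k (a : local_forms k) :=
  forall c z, chart_image c z -> real_mform (a c z).

Definition closed_form k (a : local_forms k) :=
  forall c z, chart_image c z -> forall v, ext_d (a c) z v = 0.

Definition form_pow (a : local_forms 2) (m : nat) : local_forms (m * 2) :=
  fun c z => wedge_pow (a c z) m.
Arguments form_pow a m : clear implicits.

Record partition_of_unity (N : nat) (c : 'I_N -> cm_index M)
    (rho : 'I_N -> M -> R) : Prop := PartitionOfUnity {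
  pou_ge0 : forall a x, 0 <= rho a x ;
  pou_sum : forall x, \sum_(a < N) rho a x = 1 ;
  pou_support : forall a,
    closure [set x | rho a x != 0] `<=` cm_dom (c a) ;
  pou_smooth : forall a c', smooth (chart_image c') (rho a \o cm_inv c')
}.

(* Integral over a compact M of a 2n-form, for the orientation given by the
   complex structure; the value does not depend on the partition of unity. *)
Definition integral_form (a : local_forms (n * 2)) : R[i] :=
  xget 0 [set I : R[i] | exists N (c : 'I_N -> cm_index M) rho,
    partition_of_unity c rho /\
    I = \sum_(b < N) integral_Cn
          (patch (fun=> 0) (chart_image (c b))
            (fun z => (rho b (cm_inv (c b) z))%:C * top_coef (a (c b) z)))].

Record hermitian_symplectic (eta : local_forms 2) : Prop := HermitianSymplectic {
  hs_form : is_form eta ;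
  hs_real : real_form eta ;
  hs_closed : closed_form eta ;
  hs_positive : forall c z, chart_image c z ->
    positive_mform (bidegree 1 (eta c z))
}.

Definition hermitian_symplectic_manifold :=
  exists eta, hermitian_symplectic eta.

(* [hm_val g c z j k] is the component g_{j \bar k} at z in the chart c. *)
Record hermitian_metric := HermitianMetric {
  hm_val :> cm_index M -> Cn R n -> 'M[R[i]]_n ;
  hm_hermitian : forall c z, chart_image c z ->
    (hm_val c z)^T = map_mx conjc (hm_val c z) ;
  hm_positive : forall c z, chart_image c z -> forall u : 'rV[R[i]]_n,
    u != 0 -> 0 < (u *m hm_val c z *m (map_mx conjc u)^T) 0 0 ;
  hm_smooth : forall c j k, smoothC (chart_image c) (fun z => hm_val c z j k) ;
  hm_compat : forall c c' z, chart_overlap c c' z ->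
    let J := holo_jacobian (transition c c') z in
    hm_val c z = J^T *m hm_val c' (transition c c' z) *m map_mx conjc J
}.

Variable g : hermitian_metric.

Definition kahler_form : local_forms 2 := fun c z v =>
  \sum_(j < n) \sum_(k < n)
    'i / 2%:R * g c z j k * wedge (form_dz j) (form_dzbar k) v.

(* g^{p \bar q}, with \sum_q g^{p \bar q} g_{r \bar q} = delta_{pr}. *)
Definition metric_inv c z (p q : 'I_n) : R[i] := invmx (g c z) q p.

(* The L^2-adjoints of del and delbar applied to the Kahler form, in local
   coordinates: a (0,1)-form and a (1,0)-form. *)
Definition del_adj_kahler : local_forms 1 := fun c z v =>
  \sum_(k < n)
    ('i / 2%:R * \sum_(p < n) \sum_(q < n) metric_inv c z p q *
       (dzbar q (fun w => g c w p k) z - dzbar k (fun w => g c w p q) z))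
    * form_dzbar k v.

Definition delbar_adj_kahler : local_forms 1 := fun c z v =>
  \sum_(j < n)
    ('i / 2%:R * \sum_(p < n) \sum_(q < n) metric_inv c z p q *
       (dz j (fun w => g c w p q) z - dz p (fun w => g c w j q) z))
    * form_dz j v.

(* det g is a positive real. *)
Definition log_det : local_forms 0 := fun c z _ =>
  (ln (complex.Re (\det (g c z))))%:C.

Definition pluriclosed :=
  forall c z, chart_image c z -> forall v,
    del (delbar (kahler_form c)) z v = 0.

(* omega^n / n!, the Riemannian volume form of the real metric
   X, Y |-> omega(X, JY), for which |d/dx_j|^2 = g_{j \bar j}. *)
Definition volume_form : local_forms (n * 2) := fun c z v =>
  form_pow kahler_form n c z v / (n`!)%:R.

Record static (lambda : R) : Prop := Static {
  static_pluriclosed : pluriclosed ;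
  static_eq : forall c z, chart_image c z -> forall v,
    - del (del_adj_kahler c) z v - delbar (delbar_adj_kahler c) z v
    - 'i / 2%:R * del (delbar (log_det c)) z v
    = lambda%:C * kahler_form c z v ;
  static_volume : integral_form volume_form = 1
}.

End Manifold.
Arguments form_pow {R n M} a m _ _ _.

(* Main.v *)
Require Import Defs.
From mathcomp Require Import all_boot all_order all_fingroup all_algebra.
From mathcomp Require Import all_classical all_reals all_analysis.
From mathcomp Require Import complex ring lra.

(** Put [beta = del^* omega], a (0,1)-form, and [gamma = delbar^* omega], its
    conjugate. Since [beta] has type (0,1) and [gamma] type (1,0), the static
    equation expresses [lambda omega] as minus the (1,1)-part of
    [d(beta + gamma + (i/2) delbar log det g)]; the last summand contributes
    only in type (1,1) because [delbar delbar = 0]. Hence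
      [omega~ = omega - lambda^-1 (delbar beta + del gamma)]
    equals [- lambda^-1 d(beta + gamma + (i/2) delbar log det g)] in each chart and
    is closed there. It is global because [beta] is a contraction of the torsion
    tensor of [g]. A real 2-form whose (1,1)-part is positive satisfies
    [omega~(X, JX) > 0], so a symplectic Gram-Schmidt process applied to a complex
    frame shows that the Pfaffian of [omega~], hence [omega~^n], is positive at every
    point. Finally [Vol(g) = 1] forces a partition of unity to exist and [M] to be
    nonempty, so the integral is a sum of nonnegative terms, one of them positive. *)

Set Implicit Arguments.
Unset Strict Implicit.
Unset Printing Implicit Defensive.

Import Order.TTheory GRing.Theory Num.Theory.
Import numFieldNormedType.Exports.

Local Open Scope classical_set_scope.
Local Open Scope ring_scope.
Local Open Scope complex_scope.

(** * Calculus on open subsets of C^n *)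

(** Regularity is given only by iterated derivatives in fixed directions, so Schwarz's theorem and
    the chain rule are derived from the one-variable mean value theorem, without a total derivative.
    Two formulas for [tamed_form] coexist because each does what the other cannot: the one by [beta]
    and [gamma] passes from chart to chart, the one by [primitive] gives closedness but contains
    [log det g], which changes with the chart. The invariance of [beta] is hidden by its coordinate
    formula: under a transition map, antiholomorphic derivatives of the metric pick up second
    derivatives of the map, which cancel only after antisymmetrizing in the two barred indices. The
    (2,0)- and (0,2)-parts are not controlled in size, so positivity of the top power is no
    perturbation of positivity of [omega^n]. It rests on taming, which unlike J-invariance is all
    that is available, and which has to be inherited by Schur complements. The integral selects a
    partition of unity by choice; since every partition gives a positive sum, the selected one is
    irrelevant. *)

Section DirectionalDerivatives.
Context {R : realType} {V : normedModType R}.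
Implicit Types (f : V -> R) (p v w : V).

(** Both sides are limits of the same difference quotient. This is the passage through which
    one-variable theorems reach functions on [V]. *)
Lemma is_derive_lineP f p v (s d : R) :
  is_derive s 1 (fun s : R => f (p + s *: v)) d <-> is_derive (p + s *: v) v f d.
Proof.
have E : (fun h : R => h^-1 *: (((fun s : R => f (p + s *: v)) \o shift s) (h *: 1) -
      f (p + s *: v))) =
    (fun h : R => h^-1 *: ((f \o shift (p + s *: v)) (h *: v) - f (p + s *: v))).
  apply/funext => h /=; congr (_ *: (f _ - _)).
  by rewrite [h%:A]mulr1 scalerDl addrCA.
by split=> -[h1 h2]; split; move: h1 h2; rewrite /derivable /derive E.
Qed.

Lemma is_derive_line f p v (s : R) : derivable f (p + s *: v) v ->
  is_derive s 1 (fun s : R => f (p + s *: v)) ('D_v f (p + s *: v)).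
Proof. by move=> df; apply/is_derive_lineP; split. Qed.

Lemma derive_mulD (a b c d : V -> R) p v :
  derivable a p v -> derivable b p v -> derivable c p v -> derivable d p v ->
  'D_v (fun w => a w * b w + c w * d w) p =
    a p * 'D_v b p + b p * 'D_v a p + (c p * 'D_v d p + d p * 'D_v c p).
Proof.
move=> da db dc dd.
rewrite -[LHS]/('D_v (a * b + c * d) p) (deriveD (derivableM da db) (derivableM dc dd)).
by rewrite (deriveM da db) (deriveM dc dd).
Qed.

Lemma derive_mulB (a b c d : V -> R) p v :
  derivable a p v -> derivable b p v -> derivable c p v -> derivable d p v ->
  'D_v (fun w => a w * b w - c w * d w) p =
    a p * 'D_v b p + b p * 'D_v a p - (c p * 'D_v d p + d p * 'D_v c p).
Proof.
move=> da db dc dd.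
rewrite -[LHS]/('D_v (a * b - c * d) p) (deriveB (derivableM da db) (derivableM dc dd)).
by rewrite (deriveM da db) (deriveM dc dd).
Qed.

(** The mean value theorem on the segment from 0 to [t]. Absolute values let one statement serve
    increments of either sign. *)
Lemma MVT_line f p v (t : R) :
  (forall s, `|s| <= `|t| -> derivable f (p + s *: v) v) ->
  exists2 s, `|s| <= `|t| & f (p + t *: v) - f p = t * 'D_v f (p + s *: v).
Proof.
move=> df.
have dg (s : R) : `|s| <= `|t| ->
    is_derive s 1 (fun s : R => f (p + s *: v)) ('D_v f (p + s *: v)).
  by move=> /df; exact: is_derive_line.
have cg (s : R) : `|s| <= `|t| -> {for s, continuous (fun s : R => f (p + s *: v))}.
  move=> /dg [h _]; apply: differentiable_continuous.
  exact/derivable1_diffP.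
case: (leP 0 t) => t0.
- have sub (s : R) : s \in `[0, t]%R -> `|s| <= `|t|.
    by rewrite in_itv /= => /andP[s0 st]; rewrite !ger0_norm.
  have [||s sI] := @MVT_segment R (fun s : R => f (p + s *: v))
    (fun s : R => 'D_v f (p + s *: v)) 0 t t0.
  + move=> x; rewrite in_itv /= => /andP[x0 xt]; apply: dg.
    by rewrite !ger0_norm// ltW.
  + by apply: continuous_in_subspaceT => x /[1!inE] xI; apply/cg/sub.
  + rewrite scale0r addr0 subr0 mulrC => h; exists s => //; exact: sub.
- have sub (s : R) : s \in `[t, 0]%R -> `|s| <= `|t|.
    by rewrite in_itv /= => /andP[s0 st]; rewrite !ler0_norm ?lerN2// ltW.
  have [||s sI] := @MVT_segment R (fun s : R => f (p + s *: v))
    (fun s : R => 'D_v f (p + s *: v)) t 0 (ltW t0).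
  + move=> x; rewrite in_itv /= => /andP[x0 xt]; apply/dg/sub.
    by rewrite in_itv /= !ltW.
  + by apply: continuous_in_subspaceT => x /[1!inE] xI; apply/cg/sub.
  + rewrite scale0r addr0 sub0r mulrN => h; exists s; first exact: sub.
    by apply: oppr_inj; rewrite opprB h mulrC.
Qed.

Lemma derivable_shift f p v w :
  derivable f (p + w) v -> derivable (fun q => f (q + w)) p v.
Proof.
by rewrite /derivable /=; under eq_fun do rewrite /= addrA.
Qed.

Lemma derive_shiftE f p v w : 'D_v (fun q => f (q + w)) p = 'D_v f (p + w).
Proof.
by rewrite /derive /=; under [in RHS]eq_fun do rewrite /= addrA.
Qed.

(** Two applications of the mean value theorem turn the second difference into [s * t] times the
    mixed derivative at a nearby point; continuity of that derivative at [p] gives the error [e]. *)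
Lemma second_difference f p v w (e : R) : 0 < e ->
  (\forall q \near p, derivable f q v /\ derivable ('D_v f) q w) ->
  {for p, continuous ('D_w ('D_v f))} ->
  exists2 d : R, 0 < d & forall s t : R, `|s| <= d -> `|t| <= d ->
    `|f (p + s *: v + t *: w) - f (p + s *: v) - f (p + t *: w) + f p
      - s * t * 'D_w ('D_v f) p| <= e * `|s * t|.
Proof.
move=> e0 df cf.
have /nbhs_ballP [r /= r0 hr] : \forall q \near p,
    (derivable f q v /\ derivable ('D_v f) q w) /\
    `|'D_w ('D_v f) p - 'D_w ('D_v f) q| <= e.
  apply: filterI => //.
  by move/cvgrPdist_le : cf => /(_ _ e0).
(* With [d] below [r] over this sum, the whole parallelogram stays in the ball; the summand 1 keeps
   the denominator positive when [v] and [w] vanish. *)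
have N0 : 0 < `|v| + `|w| + 1 by rewrite ltr_wpDl// addr_ge0.
near (0 : R)^'+ => d.
have d0 : 0 < d by near: d; exact: nbhs_right_gt.
exists d => //.
have dr : d < r / (`|v| + `|w| + 1).
  by near: d; apply: nbhs_right_lt; rewrite divr_gt0.
have hB (s t : R) : `|s| <= d -> `|t| <= d -> ball p r (p + s *: v + t *: w).
  move=> sd td; rewrite -ball_normE /= opprD addrA opprD addrA subrr sub0r.
  rewrite -opprD normrN; apply: le_lt_trans (ler_normD _ _) _.
  rewrite !normrZ; apply: (@le_lt_trans _ _ (d * (`|v| + `|w| + 1))).
    have := ler_wpM2r (normr_ge0 v) sd; have := ler_wpM2r (normr_ge0 w) td.
    by move: (normr_ge0 v) (normr_ge0 w); lra.
  by rewrite -ltr_pdivlMr.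
have hB0 (s : R) : `|s| <= d -> ball p r (p + s *: v).
  move=> sd; have := hB s 0 sd; rewrite normr0 scale0r addr0; apply; exact: ltW.
move=> s t sd td.
(* The first application is to the increment of [f] in direction [w], as a function along [v]; the
   second is to the derivative of [f] along [v], in direction [w]. *)
have [|s' s's] := @MVT_line (fun q => f (q + t *: w) - f q) p v s.
  move=> s' /le_trans/(_ sd) s'd.
  apply: derivableB; last by have [[]] := hr _ (hB0 _ s'd).
  by apply: derivable_shift; have [[]] := hr _ (hB _ _ s'd td).
have s'd := le_trans s's sd.
rewrite deriveB; first last.
- by have [[]] := hr _ (hB0 _ s'd).
- by apply: derivable_shift; have [[]] := hr _ (hB _ _ s'd td).
rewrite derive_shiftE => E1.
have [|t' t't E2] := @MVT_line ('D_v f) (p + s' *: v) w t.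
  by move=> t' /le_trans/(_ td) t'd; have [[]] := hr _ (hB _ _ s'd t'd).
rewrite E2 in E1.
have -> : f (p + s *: v + t *: w) - f (p + s *: v) - f (p + t *: w) + f p =
  f (p + s *: v + t *: w) - f (p + s *: v) - (f (p + t *: w) - f p) by ring.
rewrite E1 mulrA -mulrBr normrM mulrC ler_wpM2r// distrC.
by have [_] := hr _ (hB _ _ s'd (le_trans t't td)).
Unshelve. all: by end_near. Qed.

(** Schwarz's theorem: the second difference is symmetric in the two directions, so with equal steps
    [d] both mixed derivatives are within [e / 2] of the same quotient by [d * d]. *)
Lemma derive_comm f p v w :
  (\forall q \near p, derivable f q v /\ derivable ('D_v f) q w) ->
  (\forall q \near p, derivable f q w /\ derivable ('D_w f) q v) ->
  {for p, continuous ('D_w ('D_v f))} -> {for p, continuous ('D_v ('D_w f))} ->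
  'D_w ('D_v f) p = 'D_v ('D_w f) p.
Proof.
move=> dv dw cv cw; apply/eqP; rewrite -subr_eq0 -normr_le0.
apply/ler_addgt0Pl => e e0; rewrite addr0.
have e20 : 0 < e / 2 by rewrite divr_gt0.
have [d1 d10 H1] := second_difference e20 dv cv.
have [d2 d20 H2] := second_difference e20 dw cw.
pose d := Num.min d1 d2.
have d0 : 0 < d by rewrite lt_min d10.
have dd1 : `|d| <= d1 by rewrite ger0_norm ?(ltW d0)// ge_min lexx.
have dd2 : `|d| <= d2 by rewrite ger0_norm ?(ltW d0)// ge_min lexx orbT.
have := lerD (H1 _ _ dd1 dd1) (H2 _ _ dd2 dd2).
rewrite -mulrDl -splitr => /(le_trans (ler_normB _ _)).
rewrite (addrAC p (d *: w)).
set X := f _; set Y := f _; set Z := f _; set L1 := 'D_w _ p; set L2 := 'D_v _ p.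
have -> : X - Y - Z + f p - d * d * L1 - (X - Z - Y + f p - d * d * L2) =
  (d * d) * - (L1 - L2) by ring.
rewrite normrM normrN mulrC ler_pM2r// normr_gt0 mulf_neq0 ?gt_eqF//.
Qed.

(** Substitute for total differentiability along finitely many directions. The increment is made one
    direction at a time, with the mean value theorem for the last one and induction for the
    others. *)
Lemma C1_estimate f p m (e : 'I_m -> V) (eps : R) : 0 < eps ->
  (forall i, \forall q \near p, derivable f q (e i)) ->
  (forall i, {for p, continuous ('D_(e i) f)}) ->
  exists2 d : R, 0 < d & forall t : 'I_m -> R, (forall i, `|t i| <= d) ->
    `|f (p + \sum_(i < m) t i *: e i) - f p - \sum_(i < m) t i * 'D_(e i) f p|
      <= eps * \sum_(i < m) `|t i|.
Proof.
move=> eps0; elim: m e => [|m IH] e df cf.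
  by exists 1 => // t _; rewrite !big_ord0 addr0 !subrr normr0 mulr0.
have /IH {}IH := fun i => df (widen_ord (leqnSn m) i).
have {IH} [d1 d10 IH] := IH (fun i => cf (widen_ord (leqnSn m) i)).
have /nbhs_ballP [r /= r0 hr] : \forall q \near p,
    derivable f q (e ord_max) /\
    `|'D_(e ord_max) f p - 'D_(e ord_max) f q| <= eps.
  apply: filterI; first exact: df.
  by move/cvgrPdist_le : (cf ord_max) => /(_ _ eps0).
have N0 : 0 < \sum_(i < m.+1) `|e i| + 1.
  by rewrite ltr_wpDl// sumr_ge0.
near (0 : R)^'+ => d.
have d0 : 0 < d by near: d; exact: nbhs_right_gt.
exists d => // t td.
have dd1 : d <= d1 by near: d; exact: nbhs_right_le.
have dr : d < r / (\sum_(i < m.+1) `|e i| + 1).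
  by near: d; apply: nbhs_right_lt; rewrite divr_gt0.
have IHt := IH (fun i => t (widen_ord (leqnSn m) i))
  (fun i => le_trans (td _) dd1).
rewrite !big_ord_recr /= addrA; set q := p + _.
have hB (s : R) : `|s| <= `|t ord_max| -> ball p r (q + s *: e ord_max).
  move=> st; rewrite -ball_normE /= /q -addrA opprD addrA subrr sub0r normrN.
  apply: le_lt_trans (ler_normD _ _) _.
  apply: (@le_lt_trans _ _ (d * (\sum_(i < m.+1) `|e i| + 1))); last first.
    by rewrite -ltr_pdivlMr.
  rewrite big_ord_recr /= !mulrDr mulr1 ler_wpDr ?(ltW d0)// lerD//; last first.
    by rewrite normrZ ler_wpM2r// (le_trans st).
  apply: le_trans (ler_norm_sum _ _ _) _; rewrite mulr_sumr.
  by apply: ler_sum => i _; rewrite normrZ ler_wpM2r.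
have [|s st E] := @MVT_line f q (e ord_max) (t ord_max).
  by move=> s /hB/hr[].
have [_ Hs] := hr _ (hB _ st).
have -> : f (q + t ord_max *: e ord_max) =
  f q + t ord_max * 'D_(e ord_max) f (q + s *: e ord_max) by rewrite -E; ring.
set S := \sum_(i < m) _ * _ in IHt *; set L := 'D_ _ f p in Hs *.
have -> : f q + t ord_max * 'D_(e ord_max) f (q + s *: e ord_max) - f p
   - (S + t ord_max * L) = (f q - f p - S) -
   t ord_max * (L - 'D_(e ord_max) f (q + s *: e ord_max)) by ring.
apply: le_trans (ler_normB _ _) _; rewrite [leRHS]mulrDr lerD//.
by rewrite normrM mulrC ler_wpM2r.
Unshelve. all: by end_near. Qed.

(** Chain rule along a curve in the span of the [e i]: divide [C1_estimate] by [h] and use that the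
    quotients of the [t i] converge. *)
Lemma is_derive_chain f p m (e : 'I_m -> V) (t : 'I_m -> R -> R) (dt : 'I_m -> R) :
  (forall i, \forall q \near p, derivable f q (e i)) ->
  (forall i, {for p, continuous ('D_(e i) f)}) ->
  (forall i, t i 0 = 0) -> (forall i, is_derive (0 : R) 1 (t i) (dt i)) ->
  is_derive (0 : R) 1 (fun h => f (p + \sum_(i < m) t i h *: e i))
    (\sum_(i < m) dt i * 'D_(e i) f p).
Proof.
move=> df cf t0 dt0.
have tq i : (fun h => h^-1 * t i h) @ (0 : R)^' --> dt i.
  have [+ <-] := dt0 i; rewrite /derivable /derive.
  set q := (q in q @ _); suff -> : q = (fun h => h^-1 * t i h) by [].
  by apply/funext => h; rewrite /q /= t0 addr0 subr0 [h%:A]mulr1.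
have tc i : {for (0 : R), continuous (t i)}.
  have [h1 _] := dt0 i.
  by apply: differentiable_continuous; exact/derivable1_diffP.
set S := \sum_(i < m) _.
suff H : (fun h => h^-1 *: (((fun h => f (p + \sum_(i < m) t i h *: e i)) \o
     shift (0:R)) (h *: (1:R)) - f (p + \sum_(i < m) t i 0 *: e i)))
     @ (0 : R)^' --> S.
  by apply: DeriveDef; [apply/cvg_ex; exists S|exact: cvg_lim].
have -> : f (p + \sum_(i < m) t i 0 *: e i) = f p.
  by rewrite big1 ?addr0// => i _; rewrite t0 scale0r.
have SS : (fun h => \sum_(i < m) (h^-1 * t i h) * 'D_(e i) f p) @ (0:R)^' --> S.
  by apply: cvg_big => [|i _]; [exact: add_continuous|apply: cvgMr_tmp; exact: tq].
apply/cvgrPdist_le => eps eps0.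
have NB : (fun h => \sum_(i < m) `|h^-1 * t i h|) @ (0:R)^' -->
    \sum_(i < m) `|dt i|.
  by apply: cvg_big => [|i _]; [exact: add_continuous|apply: cvg_norm; exact: tq].
set N := \sum_(i < m) `|dt i| in NB.
(* For small [h] the quotients have total size at most [N + 1], so the tolerance [eps / 2 / (N + 1)]
   in [C1_estimate] costs [eps / 2] after division by [h]. *)
have N0 : 0 < N + 1 by rewrite ltr_wpDl// sumr_ge0.
have e20 : 0 < eps / 2 / (N + 1) by rewrite !divr_gt0.
have [d d0 Hd] := C1_estimate e20 df cf.
near=> h.
have h0 : h != 0 by near: h; exact: nbhs_dnbhs_neq.
rewrite /= addr0 [h%:A]mulr1.
have H1 : `|S - \sum_(i < m) (h^-1 * t i h) * 'D_(e i) f p| <= eps / 2.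
  by near: h; move/cvgrPdist_le : SS; apply; rewrite divr_gt0.
have H2 : \sum_(i < m) `|h^-1 * t i h| <= N + 1.
  near: h; move/cvgrPdist_le : NB => /(_ 1 ltr01); apply: filterS => h.
  by rewrite distrC => /(le_trans (ler_norm _)); rewrite lerBlDl.
have H3 : forall i, `|t i h| <= d.
  near: h; apply: filter_forall => i.
  have /cvgrPdist_le/(_ _ d0) := tc i; rewrite t0.
  move=> tc'; near=> h; rewrite -normrN -sub0r.
  by near: h; exact: nbhs_dnbhs tc'.
have := Hd (t^~ h) H3; rewrite -(@ler_pM2l _ `|h^-1|) ?normr_gt0 ?invr_eq0//.
rewrite -normrM => H4.
have H5 : `|h^-1| * (eps / 2 / (N + 1) * \sum_(i < m) `|t i h|) <= eps / 2.
  rewrite mulrCA mulr_sumr.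
  under eq_bigr do rewrite -normrM.
  apply: le_trans (_ : eps / 2 / (N + 1) * (N + 1) <= _).
    by rewrite ler_wpM2l// ltW.
  by rewrite divfK// gt_eqF.
have := le_trans (ler_normB _ _) (lerD H1 (le_trans H4 H5)).
rewrite -splitr; congr (`|_| <= _).
rewrite !mulrBr mulr_sumr; under [X in _ - X - _]eq_bigr do rewrite -mulrA.
rewrite [_ *: _]mulrBr; ring.
Unshelve. all: by end_near. Qed.
End DirectionalDerivatives.

(** * Functions of class C^k on an open set *)

Section SmoothFunctions.
Context {R : realType} {n : nat} (U : set (Cn R n)).
Hypothesis openU : open U.
Implicit Types (f g : Cn R n -> R) (z v : Cn R n).

Lemma near_open (P : Cn R n -> Prop) z :
  U z -> (forall w, U w -> P w) -> \forall w \near z, P w.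
Proof.
move=> Uz UP; apply: filterS UP _.
exact: open_nbhs_nbhs.
Qed.

Lemma Ck_mono k f : Ck k.+1 U f -> Ck k U f.
Proof.
elim: k f => [|k IH] f [cf df]; first by [].
split=> // v; have [dfv /IH] := df v; by split.
Qed.

Lemma continuous_near_eq f g z : (\forall w \near z, f w = g w) ->
  {for z, continuous f} -> {for z, continuous g}.
Proof.
move=> fg cf; apply: cvg_trans (near_eq_cvg fg) _.
by rewrite -(nbhs_singleton fg).
Qed.

Lemma Ck_ext k f g : (forall z, U z -> f z = g z) -> Ck k U f -> Ck k U g.
Proof.
elim: k f g => [|k IH] f g fg.
- move=> [cf _]; split=> // z Uz.
  by apply: continuous_near_eq (cf _ Uz); exact: near_open.
- move=> [cf df]; split=> [z Uz|v].
    by apply: continuous_near_eq (cf _ Uz); exact: near_open.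
  have [dfv Cv] := df v; split=> [z Uz|].
    apply: near_eq_derivable (dfv _ Uz); exact: near_open.
  apply: IH Cv => z Uz; apply: near_eq_derive; exact: near_open.
Qed.

Lemma Ck_cst k (c : R) : Ck k U (fun=> c).
Proof.
elim: k c => [|k IH] c; split=> //; first by move=> z _; exact: cst_continuous.
- by move=> z _; exact: cst_continuous.
- move=> v; split=> [z _|]; first exact: derivable_cst.
  by apply: Ck_ext (IH 0) => z _; rewrite derive_cst.
Qed.

Lemma CkD k f g : Ck k U f -> Ck k U g -> Ck k U (fun z => f z + g z).
Proof.
elim: k f g => [|k IH] f g [cf df] [cg dg].
  by split=> // z Uz; apply: continuousD; [exact: cf|exact: cg].
split=> [z Uz|v]; first by apply: continuousD; [exact: cf|exact: cg].
have [dfv Cf] := df v; have [dgv Cg] := dg v; split=> [z Uz|].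
  by apply: derivableD; [exact: dfv|exact: dgv].
apply: Ck_ext (IH _ _ Cf Cg) => z Uz.
by rewrite -deriveD//; [exact: dfv|exact: dgv].
Qed.

(** In the product rule each derivative is multiplied by an undifferentiated factor, which is
    brought down to class [k] by [Ck_mono] before the induction hypothesis is used. *)
Lemma CkM k f g : Ck k U f -> Ck k U g -> Ck k U (fun z => f z * g z).
Proof.
elim: k f g => [|k IH] f g Cf Cg; have [cf df] := Cf; have [cg dg] := Cg.
  by split=> // z Uz; apply: continuousM; [exact: cf|exact: cg].
split=> [z Uz|v]; first by apply: continuousM; [exact: cf|exact: cg].
have [dfv Cfv] := df v; have [dgv Cgv] := dg v; split=> [z Uz|].
  by apply: derivableM; [exact: dfv|exact: dgv].
apply: Ck_ext (CkD (IH _ _ (Ck_mono Cf) Cgv) (IH _ _ (Ck_mono Cg) Cfv)) => z Uz.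
by rewrite -[RHS]/('D_v (f * g) z) deriveM//; [exact: dfv|exact: dgv].
Qed.

Lemma CkV k f : (forall z, U z -> f z != 0) -> Ck k U f ->
  Ck k U (fun z => (f z)^-1).
Proof.
move=> f0; elim: k => [|k IH] Cf; have [cf df] := Cf.
  by split=> // z Uz; apply: continuousV; [exact: f0|exact: cf].
split=> [z Uz|v]; first by apply: continuousV; [exact: f0|exact: cf].
have [dfv Cfv] := df v; split=> [z Uz|].
  by apply: derivableV; [exact: f0|exact: dfv].
have CV := IH (Ck_mono Cf).
apply: Ck_ext (CkM (CkM (Ck_cst k (-1)) (CkM CV CV)) Cfv) => z Uz.
rewrite deriveV; [|exact: f0|exact: dfv].
by rewrite mulN1r -expr2 exprVn.
Qed.

(** No induction: the derivative is the inverse of [f] times a derivative of [f], which [CkV] and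
    [CkM] already cover. *)
Lemma Ck_ln k f : (forall z, U z -> 0 < f z) -> Ck k U f ->
  Ck k U (fun z => ln (f z)).
Proof.
move=> f0; case: k => [|k] Cf; have [cf df] := Cf.
  split=> // z Uz; apply: (@continuous_comp _ _ _ f (@ln R)); first exact: cf.
  exact/continuous_ln/f0.
split=> [z Uz|v].
  apply: (@continuous_comp _ _ _ f (@ln R)); first exact: cf.
  exact/continuous_ln/f0.
have [dfv Cfv] := df v.
have H z : U z -> is_derive z v (fun z => ln (f z)) ((f z)^-1 * 'D_v f z).
  move=> Uz.
  have E : is_derive z v f ('D_v f z) by split=> //; exact: dfv.
  (* The point [z] becomes the point of parameter 0 on a line, where the one-variable derivative of
     [ln] applies. *)
  rewrite -[z]addr0 -(scale0r v) in E *.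
  move/is_derive_lineP : E => E; apply/is_derive_lineP.
  by apply: is_derive1_comp; apply: is_derive1_ln; rewrite scale0r addr0 f0.
split=> [z Uz|]; first by have [] := H z Uz.
apply: Ck_ext (CkM (CkV (fun z Uz => lt0r_neq0 (f0 z Uz)) (Ck_mono Cf)) Cfv) => z Uz.
by have [_ ->] := H z Uz.
Qed.

Lemma smooth_derive f v : smooth U f -> smooth U ('D_v f).
Proof. by move=> sf k; have [_ /(_ v)[]] := sf k.+1. Qed.

Lemma smooth_continuous f z : smooth U f -> U z -> {for z, continuous f}.
Proof. by move=> /(_ 0%N)[cf _]; exact: cf. Qed.

Lemma smooth_derivable f z v : smooth U f -> U z -> derivable f z v.
Proof. by move=> /(_ 1%N)[_ /(_ v)[df _]]; exact: df. Qed.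

Lemma smooth_ext f g : (forall z, U z -> f z = g z) -> smooth U f -> smooth U g.
Proof. by move=> fg sf k; exact: Ck_ext (sf k). Qed.

Lemma smooth_derive_comm f z v w : smooth U f -> U z ->
  'D_w ('D_v f) z = 'D_v ('D_w f) z.
Proof.
move=> sf Uz; apply: derive_comm.
- by apply: near_open => // q Uq; split; apply: smooth_derivable => //;
    exact: smooth_derive.
- by apply: near_open => // q Uq; split; apply: smooth_derivable => //;
    exact: smooth_derive.
- by apply: smooth_continuous => //; do 2! apply: smooth_derive.
- by apply: smooth_continuous => //; do 2! apply: smooth_derive.
Qed.

End SmoothFunctions.

(** * Complex-valued smooth functions and derivatives along complexified vectors *)

Section Conjugation.
Context {R : realType}.
Implicit Types x y : R[i].

Lemma conjcD x y : (x + y)^* = x^*%C + y^*%C. Proof. exact: rmorphD. Qed.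
Lemma conjcB x y : (x - y)^* = x^*%C - y^*%C. Proof. exact: rmorphB. Qed.
Lemma conjcM x y : (x * y)^* = x^*%C * y^*%C. Proof. exact: rmorphM. Qed.
Lemma conjc_sum I (r : seq I) (P : pred I) (F : I -> R[i]) :
  (\sum_(i <- r | P i) F i)^* = \sum_(i <- r | P i) (F i)^*%C.
Proof. exact: rmorph_sum. Qed.

End Conjugation.

Section ComplexSmoothFunctions.
Context {R : realType} {n : nat} (U : set (Cn R n)).
Hypothesis openU : open U.
Implicit Types (f g : Cn R n -> R[i]) (z v : Cn R n) (u : TC R n).

Lemma complex_eqP (x y : R[i]) :
  complex.Re x = complex.Re y -> complex.Im x = complex.Im y -> x = y.
Proof. by case: x y => a b [c d] /= -> ->. Qed.

Lemma smoothC_ext f g : (forall z, U z -> f z = g z) -> smoothC U f -> smoothC U g.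
Proof.
by move=> fg [sr si]; split;
  [apply: smooth_ext openU _ _ _ sr|apply: smooth_ext openU _ _ _ si] => z /fg ->.
Qed.

Lemma smoothC_cst (c : R[i]) : smoothC U (fun=> c).
Proof. by split=> k; exact: Ck_cst. Qed.

Lemma smoothCD f g : smoothC U f -> smoothC U g -> smoothC U (fun z => f z + g z).
Proof.
move=> [fr fi] [gr gi]; split.
- apply: smooth_ext openU _ _ _ (fun k => CkD openU (fr k) (gr k)) => z _.
  by case: (f z) (g z) => ? ? [].
- apply: smooth_ext openU _ _ _ (fun k => CkD openU (fi k) (gi k)) => z _.
  by case: (f z) (g z) => ? ? [].
Qed.

Lemma smoothCM f g : smoothC U f -> smoothC U g -> smoothC U (fun z => f z * g z).
Proof.
move=> [fr fi] [gr gi]; split.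
- apply: smooth_ext openU _ _ _ (fun k => CkD openU (CkM openU (fr k) (gr k))
    (CkM openU (Ck_cst openU k (-1)) (CkM openU (fi k) (gi k)))) => z _.
  by case: (f z) (g z) => ? ? [? ?] /=; rewrite mulN1r.
- apply: smooth_ext openU _ _ _ (fun k => CkD openU (CkM openU (fr k) (gi k))
    (CkM openU (fi k) (gr k))) => z _.
  by case: (f z) (g z) => ? ? [].
Qed.

Lemma smoothC_conj f : smoothC U f -> smoothC U (fun z => (f z)^*).
Proof.
move=> [fr fi]; split.
- by apply: smooth_ext openU _ _ _ fr => z _; case: (f z).
- apply: smooth_ext openU _ _ _
    (fun k => CkM openU (Ck_cst openU k (-1)) (fi k)) => z _.
  by case: (f z) => a b /=; rewrite mulN1r.
Qed.

Lemma smoothCN f : smoothC U f -> smoothC U (fun z => - f z).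
Proof.
move=> sf; apply: smoothC_ext (smoothCM (smoothC_cst (-1)) sf) => z _.
by rewrite mulN1r.
Qed.

Lemma smoothCB f g : smoothC U f -> smoothC U g -> smoothC U (fun z => f z - g z).
Proof. by move=> sf sg; apply: smoothCD => //; exact: smoothCN. Qed.

Lemma smoothC_sum I (r : seq I) (P : pred I) (F : I -> Cn R n -> R[i]) :
  (forall i, P i -> smoothC U (F i)) ->
  smoothC U (fun z => \sum_(i <- r | P i) F i z).
Proof.
move=> sF; elim: r => [|i r IH].
  by apply: smoothC_ext (smoothC_cst 0) => z _; rewrite big_nil.
case: (boolP (P i)) => Pi.
  apply: smoothC_ext (smoothCD (sF _ Pi) IH) => z _.
  by rewrite big_cons Pi.
by apply: smoothC_ext IH => z _; rewrite big_cons (negPf Pi).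
Qed.

Lemma smoothC_prod I (r : seq I) (P : pred I) (F : I -> Cn R n -> R[i]) :
  (forall i, P i -> smoothC U (F i)) ->
  smoothC U (fun z => \prod_(i <- r | P i) F i z).
Proof.
move=> sF; elim: r => [|i r IH].
  by apply: smoothC_ext (smoothC_cst 1) => z _; rewrite big_nil.
case: (boolP (P i)) => Pi.
  apply: smoothC_ext (smoothCM (sF _ Pi) IH) => z _.
  by rewrite big_cons Pi.
by apply: smoothC_ext IH => z _; rewrite big_cons (negPf Pi).
Qed.

(** The inverse is the conjugate divided by the squared modulus [N], a nowhere vanishing real
    function. *)
Lemma smoothCV f : (forall z, U z -> f z != 0) -> smoothC U f ->
  smoothC U (fun z => (f z)^-1).
Proof.
move=> f0 [fr fi].
pose N z := complex.Re (f z) * complex.Re (f z) + complex.Im (f z) * complex.Im (f z).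
have N0 z : U z -> N z != 0.
  move=> /f0; apply: contraNneq; rewrite /N; case: (f z) => a b /= /eqP.
  rewrite -!expr2 paddr_eq0 ?sqr_ge0// !sqrf_eq0 => /andP[/eqP-> /eqP->].
  by rewrite eq_complex /= eqxx.
have CN k : Ck k U N by apply: CkD => //; exact: CkM.
split.
- apply: smooth_ext openU _ _ _
    (fun k => CkM openU (fr k) (CkV openU N0 (CN k))) => z _.
  by rewrite /N; case: (f z) => a b /=; rewrite -!expr2.
- apply: smooth_ext openU _ _ _ (fun k => CkM openU (Ck_cst openU k (-1))
    (CkM openU (fi k) (CkV openU N0 (CN k)))) => z _.
  by rewrite /N; case: (f z) => a b /=; rewrite -!expr2 mulN1r.
Qed.

Lemma smoothC_det m (A : Cn R n -> 'M[R[i]]_m) :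
  (forall i j, smoothC U (fun z => A z i j)) -> smoothC U (fun z => \det (A z)).
Proof.
move=> sA; rewrite /determinant; apply: smoothC_sum => s _.
by apply: smoothCM; [exact: smoothC_cst|exact: smoothC_prod].
Qed.

(** Cramer's rule makes the entries quotients of polynomials in smooth entries by the
    determinant. *)
Lemma smoothC_invmx m (A : Cn R n -> 'M[R[i]]_m) i j :
  (forall i j, smoothC U (fun z => A z i j)) ->
  (forall z, U z -> A z \in unitmx) -> smoothC U (fun z => invmx (A z) i j).
Proof.
move=> sA uA.
have H : smoothC U (fun z => (\det (A z))^-1 * cofactor (A z) j i).
  apply: smoothCM.
    apply: smoothCV; last exact: smoothC_det.
    by move=> z /uA; rewrite unitmxE unitfE.
  apply: smoothCM; first exact: smoothC_cst.
  apply: smoothC_det => k l.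
  by apply: smoothC_ext (sA (lift j k) (lift i l)) => z _; rewrite !mxE.
by apply: smoothC_ext H => z /uA uz; rewrite /invmx uz !mxE.
Qed.

Lemma Cderive_eq f g z v : (forall z, U z -> f z = g z) -> U z ->
  Cderive f z v = Cderive g z v.
Proof.
move=> fg Uz; apply: complex_eqP => /=; apply: near_eq_derive;
  by apply: (near_open openU Uz) => w /fg ->.
Qed.

Lemma Cderive_cst (c : R[i]) z v : Cderive (fun=> c) z v = 0.
Proof. by rewrite /Cderive !derive_cst. Qed.

Lemma CderiveD f g z v : smoothC U f -> smoothC U g -> U z ->
  Cderive (fun z => f z + g z) z v = Cderive f z v + Cderive g z v.
Proof.
move=> [fr fi] [gr gi] Uz; apply: complex_eqP => /=.
- have -> : (fun w => complex.Re (f w + g w)) =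
    (fun w => complex.Re (f w)) + (fun w => complex.Re (g w)).
    by apply/funext => w; rewrite !fctE; case: (f w) (g w) => ? ? [].
  by rewrite deriveD//; apply: smooth_derivable (Uz).
- have -> : (fun w => complex.Im (f w + g w)) =
    (fun w => complex.Im (f w)) + (fun w => complex.Im (g w)).
    by apply/funext => w; rewrite !fctE; case: (f w) (g w) => ? ? [].
  by rewrite deriveD//; apply: smooth_derivable (Uz).
Qed.

Lemma CderiveM f g z v : smoothC U f -> smoothC U g -> U z ->
  Cderive (fun z => f z * g z) z v = f z * Cderive g z v + g z * Cderive f z v.
Proof.
move=> [fr fi] [gr gi] Uz.
have dfr := smooth_derivable (v:=v) fr Uz.
have dfi := smooth_derivable (v:=v) fi Uz.
have dgr := smooth_derivable (v:=v) gr Uz.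
have dgi := smooth_derivable (v:=v) gi Uz.
have -> : Cderive (fun z => f z * g z) z v =
    'D_v (fun w => complex.Re (f w) * complex.Re (g w) -
                   complex.Im (f w) * complex.Im (g w)) z +i*
    'D_v (fun w => complex.Re (f w) * complex.Im (g w) +
                   complex.Im (f w) * complex.Re (g w)) z.
  by congr ('D_v _ z +i* 'D_v _ z); apply/funext => w; case: (f w) (g w) => ? ? [].
rewrite (derive_mulB dfr dgr dfi dgi) (derive_mulD dfr dgi dfi dgr) /Cderive.
move: ('D_v _ z) ('D_v _ z) ('D_v _ z) ('D_v _ z) => a b c d.
by case: (f z) (g z) => p q [r s]; apply: complex_eqP => /=; ring.
Qed.

Lemma Cderive_conj f z v : smoothC U f -> U z ->
  Cderive (fun z => (f z)^*) z v = (Cderive f z v)^*.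
Proof.
move=> [fr fi] Uz; apply: complex_eqP => /=.
- by congr ('D_v _ z); apply/funext => w; case: (f w).
- rewrite -deriveN; last exact: smooth_derivable.
  by congr ('D_v _ z); apply/funext => w; rewrite !fctE; case: (f w).
Qed.

Lemma smoothC_Cderive f v : smoothC U f -> smoothC U (fun z => Cderive f z v).
Proof. by move=> [fr fi]; split; exact: smooth_derive. Qed.

Lemma Cderive_comm f z v w : smoothC U f -> U z ->
  Cderive (fun z => Cderive f z v) z w = Cderive (fun z => Cderive f z w) z v.
Proof.
by move=> [fr fi] Uz; apply: complex_eqP => /=; exact: smooth_derive_comm Uz.
Qed.

Definition real_dir (a : bool * 'I_n) : Cn R n :=
  if a.1 then dirx a.2 else diry a.2.

(* [d/dz_j = (d/dx_j - i d/dy_j) / 2] and [d/d\bar z_j = (d/dx_j + i d/dy_j) / 2]. *)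
Definition dir_coef u (a : bool * 'I_n) : R[i] :=
  if a.1 then (u.1 0 a.2 + u.2 0 a.2) / 2%:R
  else 'i * (u.2 0 a.2 - u.1 0 a.2) / 2%:R.

(** Expressing the Wirtinger operators in the real frame reduces each rule for [cdiff] to the same
    rule for derivatives in 2n fixed real directions. *)
Lemma cdiffE f z u : cdiff f z u = \sum_a dir_coef u a * Cderive f z (real_dir a).
Proof.
rewrite -(pair_bigA _ (fun b j => dir_coef u (b, j) * Cderive f z (real_dir (b, j)))).
rewrite /= big_bool /= -big_split; apply: eq_bigr => j _.
rewrite /dz /dzbar /dir_coef /real_dir /=.
by move: (Cderive _ _ _) (Cderive _ _ _) => p q; field.
Qed.

Lemma cdiff_eq f g z u : (forall z, U z -> f z = g z) -> U z ->
  cdiff f z u = cdiff g z u.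
Proof.
by move=> fg Uz; rewrite !cdiffE; apply: eq_bigr => a _; rewrite (Cderive_eq _ fg Uz).
Qed.

Lemma cdiff_cst (c : R[i]) z u : cdiff (fun=> c) z u = 0.
Proof. by rewrite cdiffE big1// => a _; rewrite Cderive_cst mulr0. Qed.

Lemma cdiffD f g z u : smoothC U f -> smoothC U g -> U z ->
  cdiff (fun z => f z + g z) z u = cdiff f z u + cdiff g z u.
Proof.
move=> sf sg Uz; rewrite !cdiffE -big_split; apply: eq_bigr => a _.
by rewrite CderiveD// mulrDr.
Qed.

Lemma cdiffM f g z u : smoothC U f -> smoothC U g -> U z ->
  cdiff (fun z => f z * g z) z u = f z * cdiff g z u + g z * cdiff f z u.
Proof.
move=> sf sg Uz; rewrite !cdiffE !mulr_sumr -big_split; apply: eq_bigr => a _.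
by rewrite CderiveM// mulrDr /=; ring.
Qed.

Lemma cdiffZ (c : R[i]) f z u : smoothC U f -> U z ->
  cdiff (fun z => c * f z) z u = c * cdiff f z u.
Proof.
move=> sf Uz; by rewrite (cdiffM _ (smoothC_cst c) sf Uz) cdiff_cst mulr0 addr0.
Qed.

Lemma cdiff_sum I (r : seq I) (P : pred I) (F : I -> Cn R n -> R[i]) z u :
  (forall i, P i -> smoothC U (F i)) -> U z ->
  cdiff (fun z => \sum_(i <- r | P i) F i z) z u =
    \sum_(i <- r | P i) cdiff (F i) z u.
Proof.
move=> sF Uz; elim: r => [|i r IH].
  rewrite big_nil; apply: etrans (cdiff_cst 0 z u).
  by apply: (fun H => cdiff_eq u H Uz) => w _; rewrite big_nil.
rewrite big_cons; case: ifPn => Pi.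
  rewrite -IH -cdiffD//; [|exact: sF|exact: smoothC_sum].
  by apply: (fun H => cdiff_eq u H Uz) => w _; rewrite big_cons Pi.
by rewrite -IH; apply: (fun H => cdiff_eq u H Uz) => w _; rewrite big_cons (negPf Pi).
Qed.

Lemma cdiff_conj f z u : smoothC U f -> U z ->
  cdiff (fun z => (f z)^*) z u = (cdiff f z (conj_vec u))^*.
Proof.
move=> sf Uz; rewrite !cdiffE rmorph_sum; apply: eq_bigr => a _.
rewrite Cderive_conj// rmorphM; congr (_ * _).
rewrite /dir_coef /=; case: a.1.
  by rewrite !mxE rmorphM fmorphV rmorph_nat rmorphD /= !conjcK addrC.
have Ji : (0 +i* (-1)) = - 'i :> R[i] by apply: complex_eqP; rewrite /= ?oppr0.
rewrite !mxE !rmorphM fmorphV rmorph_nat rmorphB /= !conjcK.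
by rewrite Ji; ring.
Qed.

Lemma smoothC_cdiff f u : smoothC U f -> smoothC U (fun z => cdiff f z u).
Proof.
move=> sf.
have H : smoothC U (fun z => \sum_a dir_coef u a * Cderive f z (real_dir a)).
  apply: smoothC_sum => a _; apply: smoothCM; first exact: smoothC_cst.
  exact: smoothC_Cderive.
by apply: smoothC_ext H => z _; rewrite cdiffE.
Qed.

(** The coefficients of [u] and [w] are constant, so no bracket term appears and Schwarz's theorem
    applies to each pair of real directions. *)
Lemma cdiff_comm f z u w : smoothC U f -> U z ->
  cdiff (fun z => cdiff f z u) z w = cdiff (fun z => cdiff f z w) z u.
Proof.
move=> sf Uz.
have E u' w' : cdiff (fun z => cdiff f z u') z w' =
  \sum_b \sum_a dir_coef u' b * (dir_coef w' a *
     Cderive (fun z => Cderive f z (real_dir b)) z (real_dir a)).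
  rewrite (@cdiff_eq _ (fun z => \sum_b dir_coef u' b * Cderive f z (real_dir b)));
    [|by move=> ? _; rewrite cdiffE|by []].
  rewrite cdiff_sum//; last first.
    by move=> b _; apply: smoothCM; [exact: smoothC_cst|exact: smoothC_Cderive].
  apply: eq_bigr => b _; rewrite cdiffZ//; last exact: smoothC_Cderive.
  by rewrite cdiffE mulr_sumr.
rewrite !E exchange_big; apply: eq_bigr => a _; apply: eq_bigr => b _.
by rewrite mulrCA Cderive_comm.
Qed.

End ComplexSmoothFunctions.

(** * Chain rule for maps between open subsets of C^n *)

Lemma complex_sum (R : realType) I (r : seq I) (G H : I -> R) :
  (\sum_(j <- r) G j) +i* (\sum_(j <- r) H j) = \sum_(j <- r) (G j +i* H j).
Proof.
by elim: r => [|j r IH]; rewrite ?big_nil// !big_cons -IH.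
Qed.

Lemma sum_split_ord (V : zmodType) n (G : 'I_(n + n) -> V) :
  \sum_(i < n + n) G i = \sum_(j < n) (G (lshift n j) + G (rshift n j)).
Proof. by rewrite big_split_ord big_split. Qed.

Section ChainRule.
Context {R : realType} {n : nat} (U V : set (Cn R n)).
Hypotheses (openU : open U) (openV : open V).
Variable F : Cn R n -> Cn R n.
Hypothesis smoothF : forall k, smoothC U (Defs.coord k \o F).
Implicit Types (z v : Cn R n) (u : TC R n).

Lemma Cn_sum_dirs (w : Cn R n) :
  w = \sum_(j < n) w.1 0 j *: dirx j + \sum_(j < n) w.2 0 j *: diry j :> Cn R n.
Proof.
have fstE I (r : seq I) (G : I -> Cn R n) :
    (\sum_(i <- r) G i).1 = \sum_(i <- r) (G i).1.
  by elim/big_ind2 : _ => // x1 x2 y1 y2 <- <-.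
have sndE I (r : seq I) (G : I -> Cn R n) :
    (\sum_(i <- r) G i).2 = \sum_(i <- r) (G i).2.
  by elim/big_ind2 : _ => // x1 x2 y1 y2 <- <-.
apply: injective_projections.
- rewrite /= !fstE /= [X in _ + X]big1 ?addr0; last by move=> j _; rewrite scaler0.
  exact: row_sum_delta.
- rewrite /= !sndE /= [X in X + _]big1 ?add0r; last by move=> j _; rewrite scaler0.
  exact: row_sum_delta.
Qed.

(** The curve [F (z + s *: v)] is expanded along the 2n real coordinate directions, so that
    [is_derive_chain] applies; indices in ['I_(n + n)] list the x-directions and then the
    y-directions. *)
Lemma is_derive_comp_smooth (h : Cn R n -> R) z v : smooth V h -> U z -> V (F z) ->
  is_derive z v (h \o F)
    (\sum_(j < n) ('D_v (fun w => (F w).1 0 j) z * 'D_(dirx j) h (F z) +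
                   'D_v (fun w => (F w).2 0 j) z * 'D_(diry j) h (F z))).
Proof.
move=> sh Uz VFz.
pose e (i : 'I_(n + n)) : Cn R n :=
  match fintype.split i with inl j => dirx j | inr j => diry j end.
pose t (i : 'I_(n + n)) (s : R) : R :=
  match fintype.split i with
  | inl j => (F (z + s *: v)).1 0 j - (F z).1 0 j
  | inr j => (F (z + s *: v)).2 0 j - (F z).2 0 j
  end.
pose dt (i : 'I_(n + n)) : R :=
  match fintype.split i with
  | inl j => 'D_v (fun w => (F w).1 0 j) z
  | inr j => 'D_v (fun w => (F w).2 0 j) z
  end.
have FE (s : R) : F (z + s *: v) = F z + \sum_(i < n + n) t i s *: e i.
  rewrite big_split_ord /=.
  under eq_bigr do rewrite /t /e (unsplitK (inl _)).
  under [X in _ + (_ + X)]eq_bigr do rewrite /t /e (unsplitK (inr _)).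
  apply: (addrI (- F z)); rewrite addrA addNr add0r addrC [LHS]Cn_sum_dirs.
  by congr (_ + _); apply: eq_bigr => j _; rewrite /= !mxE.
have dline (q : Cn R n -> R) (d : R) : is_derive z v q d ->
    is_derive (0 : R) 1 (fun s : R => q (z + s *: v)) d.
  by move=> qd; apply/is_derive_lineP; rewrite scale0r addr0.
have dtP i : is_derive (0 : R) 1 (t i) (dt i).
  rewrite /t /dt; case: (fintype.split i) => j.
  - have D : is_derive z v (fun w => (F w).1 0 j) ('D_v (fun w => (F w).1 0 j) z).
      by split=> //; have [sr _] := smoothF j; exact: smooth_derivable sr Uz.
    by have := is_deriveB (dline _ _ D) (is_derive_cst ((F z).1 0 j) (0 : R) 1);
      rewrite subr0.
  - have D : is_derive z v (fun w => (F w).2 0 j) ('D_v (fun w => (F w).2 0 j) z).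
      by split=> //; have [_ sr] := smoothF j; exact: smooth_derivable sr Uz.
    by have := is_deriveB (dline _ _ D) (is_derive_cst ((F z).2 0 j) (0 : R) 1);
      rewrite subr0.
have t0 i : t i 0 = 0.
  by rewrite /t scale0r addr0; case: fintype.split => j; rewrite subrr.
have := is_derive_chain (f := h) (p := F z) (e := e) _ _ t0 dtP.
have -> : \sum_(i < n + n) dt i * 'D_(e i) h (F z) =
    \sum_(j < n) ('D_v (fun w => (F w).1 0 j) z * 'D_(dirx j) h (F z) +
                   'D_v (fun w => (F w).2 0 j) z * 'D_(diry j) h (F z)).
  rewrite sum_split_ord; apply: eq_bigr => j _.
  by rewrite /dt /e (unsplitK (inl _)) (unsplitK (inr _)).
have -> : (fun s : R => h (F z + \sum_(i < n + n) t i s *: e i)) =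
    (fun s : R => (h \o F) (z + s *: v)).
  by apply/funext => s; rewrite -FE.
move=> H; rewrite -[z]addr0 -(scale0r v); apply/is_derive_lineP.
rewrite scale0r addr0; apply: H => i.
- by apply: (near_open openV VFz) => q Vq; exact: smooth_derivable sh Vq.
- by apply: smooth_continuous VFz; exact: smooth_derive.
Qed.

(** The real chain rule regrouped: for each [j] the x- and y-terms combine into the Wirtinger
    derivatives of [h], weighted by the derivatives of the coordinate of [F] and of its
    conjugate. *)
Lemma Cderive_comp (h : Cn R n -> R[i]) z v : smoothC V h -> U z -> V (F z) ->
  Cderive (h \o F) z v =
    \sum_(j < n) (Cderive (Defs.coord j \o F) z v * dz j h (F z) +
                  Cderive (fun w => (Defs.coord j (F w))^*) z v * dzbar j h (F z)).
Proof.
move=> [hr hi] Uz VFz; rewrite {1}/Cderive /=.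
have [_ Er] := is_derive_comp_smooth v hr Uz VFz.
have [_ Ei] := is_derive_comp_smooth v hi Uz VFz.
have {}Er : 'D_v (fun w => complex.Re (h (F w))) z = _ := Er.
have {}Ei : 'D_v (fun w => complex.Im (h (F w))) z = _ := Ei.
rewrite {}Er {}Ei.
rewrite complex_sum; apply: eq_bigr => j _.
rewrite (Cderive_conj _ (smoothF j) Uz).
rewrite /dz /dzbar /Cderive /=.
move: ('D_v (fun w => (F w).1 0 j) z) ('D_v (fun w => (F w).2 0 j) z) => a b.
move: ('D_(dirx j) _ _) ('D_(dirx j) _ _) => q p.
move: ('D_(diry j) _ _) ('D_(diry j) _ _) => s r.
have -> : (a * p + b * r) +i* (a * q + b * s) =
  (p +i* q) * a%:C + (r +i* s) * b%:C :> R[i].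
  by apply: complex_eqP => /=; ring.
have -> : (a +i* b) = a%:C + 'i * b%:C :> R[i].
  by apply: complex_eqP => /=; ring.
have -> : (a -i* b) = a%:C - 'i * b%:C :> R[i].
  by apply: complex_eqP => /=; ring.
move: (a%:C) (b%:C) (p +i* q) (r +i* s) => A B P Q.
(* The imaginary unit is an opaque atom for [field]; its square is substituted afterwards. *)
set I := (X in A + X * B); have II : I * I = -1 by rewrite -expr2 sqr_i.
have -> : (A + I * B) * ((P - I * Q) / 2) + (A - I * B) * ((P + I * Q) / 2) =
   P * A - (I * I) * (Q * B) by field.
by rewrite II; ring.
Qed.

Lemma cdiff_comp (h : Cn R n -> R[i]) z u : smoothC V h -> U z -> V (F z) ->
  cdiff (h \o F) z u = cdiff h (F z) (Defs.pushforward F z u).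
Proof.
move=> sh Uz VFz; rewrite cdiffE /cdiff /Defs.pushforward /=.
under eq_bigr do rewrite (Cderive_comp _ sh Uz VFz) mulr_sumr.
rewrite exchange_big; apply: eq_bigr => j _ /=.
rewrite !mxE !cdiffE !mulr_suml -big_split.
by apply: eq_bigr => a _ /=; rewrite mulrDr !mulrA.
Qed.

Lemma continuous_of_coord z : U z -> {for z, continuous F}.
Proof.
move=> Uz.
have E : F = (fun w => \sum_(j < n) (F w).1 0 j *: dirx j +
                       \sum_(j < n) (F w).2 0 j *: diry j).
  by apply/funext => w; exact: Cn_sum_dirs.
rewrite /prop_for /continuous_at [X in nbhs (X z)]E [X in X @ _]E.
have Q (q : 'I_n -> Cn R n -> R) (d : 'I_n -> Cn R n) :
    (forall j, {for z, continuous (q j)}) ->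
    (fun w => \sum_(j < n) q j w *: d j) @ z --> \sum_(j < n) q j z *: d j.
  move=> cq; apply: cvg_big => [|j _]; first exact: add_continuous.
  by apply: cvgZr_tmp; exact: cq.
apply: cvgD.
- apply: (Q (fun j w => (F w).1 0 j)) => j; have [sr _] := smoothF j.
  exact: smooth_continuous sr Uz.
- apply: (Q (fun j w => (F w).2 0 j)) => j; have [_ si] := smoothF j.
  exact: smooth_continuous si Uz.
Qed.

Hypothesis FUV : forall z, U z -> V (F z).

(** Induction over all smooth [h] at once: the chain rule writes a derivative of [h \o F] with
    compositions of derivatives of [h], which are other smooth functions on [V]. *)
Lemma Ck_comp k (h : Cn R n -> R) : smooth V h -> Ck k U (h \o F).
Proof.
have c0 (f : Cn R n -> R) z : smooth V f -> U z -> {for z, continuous (f \o F)}.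
  move=> sf Uz; apply: continuous_comp; first exact: continuous_of_coord.
  exact: smooth_continuous sf (FUV Uz).
elim: k h => [|k IH] h sh; first by split=> // z; exact: c0.
split=> [z|v]; first exact: c0.
split=> [z Uz|].
  by have [] := is_derive_comp_smooth v sh Uz (FUV Uz).
have H : Ck k U (fun z => \sum_(j < n)
    ('D_v (fun w => (F w).1 0 j) z * ('D_(dirx j) h \o F) z +
     'D_v (fun w => (F w).2 0 j) z * ('D_(diry j) h \o F) z)).
  elim: (index_enum _) => [|j r IHr].
    by apply: (Ck_ext openU) (Ck_cst openU k 0) => z _; rewrite big_nil.
  have [sr si] := smoothF j.
  have C1 := CkM openU (smooth_derive v sr k) (IH _ (smooth_derive (dirx j) sh)).
  have C2 := CkM openU (smooth_derive v si k) (IH _ (smooth_derive (diry j) sh)).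
  apply: (Ck_ext openU) (CkD openU (CkD openU C1 C2) IHr) => z _.
  by rewrite big_cons.
apply: (Ck_ext openU) H => z Uz.
by have [_ ->] := is_derive_comp_smooth v sh Uz (FUV Uz).
Qed.

Lemma smoothC_comp (f : Cn R n -> R[i]) : smoothC V f -> smoothC U (f \o F).
Proof. by move=> [sr si]; split=> k; [exact: (Ck_comp k sr)|exact: (Ck_comp k si)]. Qed.

End ChainRule.

(** * Forms of low degree *)

Section LowDegreeForms.
Context {R : realType} {n : nat}.
Implicit Types (z : Cn R n) (u w : TC R n).

(** The curried exterior derivative of a 1-form on constant vector fields; [ext_d1E] links it to
    [ext_d], and the algebra below is free of finite index sets. *)
Definition d1 (a : Cn R n -> TC R n -> R[i]) z u w : R[i] :=
  cdiff (a^~ w) z u - cdiff (a^~ u) z w.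

Lemma lift01 : lift (0 : 'I_2) (0 : 'I_1) = 1. Proof. exact: val_inj. Qed.
Lemma lift10 : lift (1 : 'I_2) (0 : 'I_1) = 0. Proof. exact: val_inj. Qed.

Lemma ext_d1E (a : Cn R n -> TC R n -> R[i]) z v :
  @ext_d R n 1 (fun y v => a y (v 0)) z v = d1 a z (v 0) (v 1).
Proof.
rewrite /ext_d /d1 !big_ord_recl big_ord0 addr0 /= expr0 mul1r expr1 mulN1r.
by rewrite lift01 lift10.
Qed.

Lemma ext_d2E (e : Cn R n -> TC R n -> TC R n -> R[i]) z v :
  @ext_d R n 2 (fun y v => e y (v 0) (v 1)) z v =
  cdiff (fun y => e y (v 1) (v 2%:R)) z (v 0)
  - cdiff (fun y => e y (v 0) (v 2%:R)) z (v 1)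
  + cdiff (fun y => e y (v 0) (v 1)) z (v 2%:R).
Proof.
rewrite /ext_d !big_ord_recl big_ord0 addr0 /= expr0 mul1r expr1 mulN1r expr2.
rewrite mulrNN mul1r mul1r addrA.
have L00 : lift (0 : 'I_3) (0 : 'I_2) = 1 by exact: val_inj.
have L01 : lift (0 : 'I_3) (1 : 'I_2) = 2%:R by exact: val_inj.
have L10 : lift (1 : 'I_3) (0 : 'I_2) = 0 by exact: val_inj.
have L11 : lift (1 : 'I_3) (1 : 'I_2) = 2%:R by exact: val_inj.
have L20 : lift (2%:R : 'I_3) (0 : 'I_2) = 0 by exact: val_inj.
have L21 : lift (2%:R : 'I_3) (1 : 'I_2) = 1 by exact: val_inj.
by rewrite lift01 L00 L01 L10 L11 L20 L21.
Qed.

Lemma bidegree0E k (a : mform R n k) v :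
  bidegree 0 a v = a (fun i => antihol_part (v i)).
Proof.
rewrite /bidegree (big_pred1 finset.set0); last by move=> S; rewrite /= cards_eq0.
by congr a; apply/funext => i; rewrite inE.
Qed.

Lemma bidegree_maxE k (a : mform R n k) v :
  bidegree k a v = a (fun i => hol_part (v i)).
Proof.
rewrite /bidegree (big_pred1 finset.setT).
  by congr a; apply/funext => i; rewrite inE.
move=> S; rewrite /= eqEcard finset.subsetT cardsT card_ord /=.
have := max_card (mem S); rewrite card_ord => Sk.
by rewrite eqn_leq Sk.
Qed.

Lemma ord2P (i : 'I_2) : i = 0 \/ i = 1.
Proof. by case: i => -[|[|//]] ?; [left|right]; exact: val_inj. Qed.

Lemma bidegree1E (a : mform R n 2) v :
  bidegree 1 a v =
    a (fun i => if i == 0 then hol_part (v 0) else antihol_part (v 1)) +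
    a (fun i => if i == 0 then antihol_part (v 0) else hol_part (v 1)).
Proof.
rewrite /bidegree (bigD1 (finset.set1 (0 : 'I_2))) /= ?cards1//
  (bigD1 (finset.set1 (1 : 'I_2))) /=;
  last by rewrite cards1 /=; apply/eqP => /setP/(_ 0); rewrite !inE.
rewrite big1 ?addr0.
  congr (a _ + a _); apply/funext => i; rewrite !inE;
  by case: (ord2P i) => ->.
move=> S /andP[/andP[/cards1P[x ->]]]; case: (ord2P x) => ->; by rewrite ?eqxx ?andbF.
Qed.

Lemma sum_perm2 (V : zmodType) (G : 'S_2 -> V) :
  \sum_(s : 'S_2) G s = G 1%g + G (tperm 0 1).
Proof.
rewrite (bigD1 1%g) //= (bigD1 (tperm 0 1)) /=; last first.
  by apply/eqP => /permP/(_ 0); rewrite tpermL perm1.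
rewrite big1 ?addr0// => s /andP[s1 st].
case: (ord2P (s 0)) => s0; case: (ord2P (s 1)) => s1'.
- by have := @perm_inj _ s 0 1; rewrite s0 s1' => /(_ erefl).
- case/negP: s1; apply/eqP/permP => i; rewrite perm1.
  by case: (ord2P i) => ->.
- case/negP: st; apply/eqP/permP => i.
  by case: (ord2P i) => ->; rewrite ?tpermL ?tpermR.
- by have := @perm_inj _ s 0 1; rewrite s0 s1' => /(_ erefl).
Qed.

Lemma wedge11E (a b : TC R n -> R[i]) (v : 'I_2 -> TC R n) :
  @wedge R n 1 1 (fun v => a (v 0)) (fun v => b (v 0)) v =
    a (v 0) * b (v 1) - a (v 1) * b (v 0).
Proof.
rewrite /wedge !factS fact0 !mul1n invr1 mul1r (sum_perm2 (fun s : 'S_2 => _)).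
rewrite odd_perm1 expr0 mul1r !perm1 odd_tperm /= expr1.
rewrite (_ : lshift 1 (0 : 'I_1) = 0); last exact: val_inj.
rewrite (_ : rshift 1 (0 : 'I_1) = 1); last exact: val_inj.
by rewrite tpermL tpermR mulN1r mulNr.
Qed.

Lemma TC_fst_sum (G : 'I_n -> TC R n) : (\sum_(i < n) G i).1 = \sum_(i < n) (G i).1.
Proof. by elim/big_ind2 : _ => // x1 x2 y1 y2 <- <-. Qed.

Lemma TC_snd_sum (G : 'I_n -> TC R n) : (\sum_(i < n) G i).2 = \sum_(i < n) (G i).2.
Proof. by elim/big_ind2 : _ => // x1 x2 y1 y2 <- <-. Qed.

Lemma pair2_eta (v : 'I_2 -> TC R n) : v = (fun i => if i == 0 then v 0 else v 1).
Proof.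
apply/funext => i; case: ifPn => [/eqP->//|].
by case: i => -[|[|//]] ?// _; congr v; exact: val_inj.
Qed.

Section OneForms.
Variable U : set (Cn R n).
Hypothesis openU : open U.

Definition smooth1form (a : Cn R n -> TC R n -> R[i]) :=
  (forall u, smoothC U (a^~ u)) /\
  (forall z (c : R[i]) u w, U z -> a z (c *: u + w) = c * a z u + a z w).

Variable a : Cn R n -> TC R n -> R[i].
Hypothesis sa : smooth1form a.

Lemma smoothC_d1 u w : smoothC U (fun z => d1 a z u w).
Proof. by have [s _] := sa; apply: smoothCB => //; exact: smoothC_cdiff. Qed.

Lemma cdiff_linear (f : Cn R n -> R[i]) z (c : R[i]) u w :
  cdiff f z (c *: u + w) = c * cdiff f z u + cdiff f z w.
Proof.
rewrite /cdiff mulr_sumr -big_split; apply: eq_bigr => j _ /=.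
by rewrite !mxE; ring.
Qed.

Lemma d1_linearl z (c : R[i]) u u' w : U z ->
  d1 a z (c *: u + u') w = c * d1 a z u w + d1 a z u' w.
Proof.
have [s l] := sa; move=> Uz; rewrite /d1 cdiff_linear.
have -> : cdiff (a^~ (c *: u + u')) z w = c * cdiff (a^~ u) z w + cdiff (a^~ u') z w.
  rewrite (cdiff_eq openU w (g := fun z => c * a z u + a z u') _ Uz); last first.
    by move=> y Uy; exact: l.
  have sc : smoothC U (fun z => c * a z u).
    by apply: smoothCM => //; exact: smoothC_cst.
  by rewrite (cdiffD w sc (s u') Uz) (cdiffZ openU c w (s u) Uz).
by ring.
Qed.

Lemma d1_anti z u w : d1 a z w u = - d1 a z u w.
Proof. by rewrite /d1 opprB. Qed.

Lemma d1_alt z u : d1 a z u u = 0.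
Proof. by rewrite /d1 subrr. Qed.

Lemma d1_linearr z (c : R[i]) u u' w : U z ->
  d1 a z w (c *: u + u') = c * d1 a z w u + d1 a z w u'.
Proof.
by move=> Uz; rewrite -[LHS]opprK -d1_anti d1_linearl// !(d1_anti _ w); ring.
Qed.

(** Bilinearity in the holomorphic and antiholomorphic parts; the three groups are the components of
    type (0,2), (1,1) and (2,0). *)
Lemma d1_split z u w : U z -> d1 a z u w =
  d1 a z (antihol_part u) (antihol_part w) +
  (d1 a z (hol_part u) (antihol_part w) + d1 a z (antihol_part u) (hol_part w)) +
  d1 a z (hol_part u) (hol_part w).
Proof.
have E u' : u' = 1 *: hol_part u' + antihol_part u'.
  rewrite scale1r; case: u' => p q.
  by rewrite /hol_part /antihol_part /=; congr pair; rewrite ?addr0 ?add0r.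
move=> Uz.
have -> : d1 a z u w = d1 a z (1 *: hol_part u + antihol_part u)
   (1 *: hol_part w + antihol_part w) by rewrite -!E.
rewrite (d1_linearl _ _ _ _ Uz) !(d1_linearr _ _ _ _ Uz).
move: (d1 a z _ _) => x1; move: (d1 a z _ _) => x2.
by move: (d1 a z _ _) => x3; move: (d1 a z _ _) => x4; ring.
Qed.

(** The identity [d d = 0]: after expansion, each second derivative of a component occurs in both
    orders with opposite signs, and the orders agree by [cdiff_comm]. *)
Lemma d1_closed z u v w : U z ->
  cdiff (fun y => d1 a y v w) z u - cdiff (fun y => d1 a y u w) z v
  + cdiff (fun y => d1 a y u v) z w = 0.
Proof.
have [s _] := sa; move=> Uz.
have E p q r : cdiff (fun y => d1 a y p q) z r =
    cdiff (fun y => cdiff (a^~ q) y p) z r - cdiff (fun y => cdiff (a^~ p) y q) z r.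
  have sq t : smoothC U (fun y => cdiff (a^~ q) y t) by apply: smoothC_cdiff.
  have sp t : smoothC U (fun y => cdiff (a^~ p) y t) by apply: smoothC_cdiff.
  rewrite /d1 (cdiffD r (sq p) (smoothCN openU (sp q)) Uz).
  congr (_ + _); rewrite -mulN1r -(cdiffZ openU _ _ (sp q) Uz); congr (cdiff _ z r).
  by apply/funext => y; rewrite mulN1r.
rewrite !E.
rewrite (cdiff_comm openU u v (s w) Uz).
rewrite (cdiff_comm openU u w (s v) Uz).
rewrite (cdiff_comm openU v w (s u) Uz).
move: (cdiff (fun y => _) z _) => x1; move: (cdiff (fun y => _) z _) => x2.
by move: (cdiff (fun y => _) z _) => x3; ring.
Qed.

End OneForms.

Lemma smooth1formD U (openU : open U) (a b : Cn R n -> TC R n -> R[i]) (c : R[i]) :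
  smooth1form U a -> smooth1form U b ->
  smooth1form U (fun z u => a z u + c * b z u).
Proof.
move=> [sa la] [sb lb]; split.
  by move=> u; apply: smoothCD => //; apply: smoothCM => //; exact: smoothC_cst.
by move=> z k u w Uz; rewrite la// lb//; ring.
Qed.

Lemma d1D U (openU : open U) (a b : Cn R n -> TC R n -> R[i]) (c : R[i]) z u w :
  smooth1form U a -> smooth1form U b -> U z ->
  d1 (fun z u => a z u + c * b z u) z u w = d1 a z u w + c * d1 b z u w.
Proof.
move=> [sa _] [sb _] Uz.
have sM t : smoothC U (fun z => c * b z t).
  by apply: smoothCM => //; exact: smoothC_cst.
rewrite /d1 (cdiffD u (sa w) (sM w) Uz) (cdiffD w (sa u) (sM u) Uz).
by rewrite (cdiffZ openU c u (sb w) Uz) (cdiffZ openU c w (sb u) Uz); ring.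
Qed.

End LowDegreeForms.

(** * The forms attached to a static metric *)

(** Gaussian elimination: the pivot is the value of the form at the first basis vector, a unipotent
    factor [L] does not change the determinant, and the Schur complement [S] is again positive. The
    order on [R[i]] makes positive values real. *)
Lemma det_gt0 (R : realType) m (A : 'M[R[i]]_m) :
  (forall u : 'rV_m, u != 0 -> 0 < (u *m A *m (map_mx conjc u)^T) 0 0) ->
  0 < \det A.
Proof.
elim: m A => [|m IH] A hA; first by rewrite det_mx00.
rewrite -[A](@submxK _ 1 m 1 m) in hA *.
move: (ulsubmx _) (ursubmx _) (dlsubmx _) (drsubmx _) hA => a b c D hA.
suff : 0 < \det (block_mx a b c D) by [].
have {}hA (u : 'rV_(1 + m)) : u != 0 ->
  0 < (u *m block_mx a b c D *m (map_mx conjc u)^T) 0 0 := hA u.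
have a0 : 0 < a 0 0.
  have /hA : row_mx (1%:M : 'rV[R[i]]_1) (0 : 'rV_m) != 0.
    apply/eqP => /matrixP/(_ 0 (lshift m 0)); rewrite row_mxEl !mxE /=.
    by move/eqP; rewrite oner_eq0.
  rewrite mul_row_block !mul1mx !mul0mx !addr0 map_row_mx tr_row_mx mul_row_col.
  have -> : map_mx conjc (1%:M : 'rV[R[i]]_1) = 1%:M.
    by apply/matrixP => i j; rewrite !mxE; case: (i == j); rewrite ?conjc1 ?conjc0.
  have -> : map_mx conjc (0 : 'rV[R[i]]_m) = 0.
    by apply/matrixP => i j; rewrite !mxE conjc0.
  by rewrite trmx1 trmx0 mulmx1 mulmx0 addr0.
have an0 : a 0 0 != 0 by rewrite gt_eqF.
have aE : a = (a 0 0)%:M by exact: mx11_scalar.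
pose S := D - (a 0 0)^-1 *: (c *m b).
pose L : 'M[R[i]]_(1 + m) := block_mx 1%:M 0 (- ((a 0 0)^-1 *: c)) 1%:M.
have ca : (a 0 0)^-1 *: c *m a = c.
  by rewrite aE mul_mx_scalar !mxE /= mulr1n scalerA divff// scale1r.
have LA : L *m block_mx a b c D = block_mx a b 0 S.
  rewrite mulmx_block !mul1mx !mul0mx !addr0 !mulNmx ca addNr.
  by rewrite -scalemxAl addrC.
have <- : \det (L *m block_mx a b c D) = \det (block_mx a b c D).
  by rewrite det_mulmx det_lblock !det1 !mul1r.
rewrite LA det_ublock {1}aE det_scalar1 mulr_gt0//; apply: IH => y y0.
(* The first entry is chosen so that this vector times the matrix has zero first block; the form
   then takes the value of [S] at [y]. *)
have /hA : row_mx (- ((a 0 0)^-1 *: (y *m c))) y != 0.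
  apply: contra_neq y0 => /(congr1 rsubmx); rewrite row_mxKr => ->.
  by apply/rowP => i; rewrite !mxE.
rewrite mul_row_block.
have -> : - ((a 0 0)^-1 *: (y *m c)) *m a + y *m c = 0.
  by rewrite mulNmx scalemxAr -mulmxA ca addNr.
have -> : - ((a 0 0)^-1 *: (y *m c)) *m b + y *m D = y *m S.
  by rewrite /S mulmxBr mulNmx -scalemxAr mulmxA scalemxAl addrC.
by rewrite map_row_mx tr_row_mx mul_row_col mul0mx add0r.
Qed.

Section OneFormTypes.
Context {R : realType} {n : nat}.
Variable a : Cn R n -> TC R n -> R[i].
Implicit Types (z : Cn R n) (u w : TC R n).

(** For a (0,1)-form only the summand [p = 0] of [del] survives, and it is the (1,1)-part of the
    exterior derivative. The next lemma is the mirror image for (1,0)-forms. *)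
Lemma del01E : (forall z u, a z (antihol_part u) = a z u) ->
  (forall z u, a z (hol_part u) = 0) -> forall z v,
  del (fun y (v : 'I_1 -> TC R n) => a y (v 0)) z v =
    d1 a z (hol_part (v 0)) (antihol_part (v 1)) +
    d1 a z (antihol_part (v 0)) (hol_part (v 1)).
Proof.
move=> aa ah z v; pose a1 y (v : 'I_1 -> TC R n) := a y (v 0).
have -> : del a1 z v = bidegree 1 (ext_d (fun y => bidegree 0 (a1 y)) z) v +
    bidegree 2 (ext_d (fun y => bidegree 1 (a1 y)) z) v.
  by rewrite /del big_ord_recl big_ord1.
have -> : (fun y => bidegree 0 (a1 y)) = (fun y v => a y (v 0)).
  by apply/funext => w; apply/funext => u; rewrite bidegree0E /a1 aa.
have -> : (fun y => bidegree 1 (a1 y)) = (fun y v => 0).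
  by apply/funext => w; apply/funext => u; rewrite bidegree_maxE /a1 ah.
rewrite bidegree_maxE bidegree1E.
rewrite (ext_d1E (fun _ _ => 0)) /d1 !cdiff_cst subrr addr0.
by rewrite !ext_d1E /d1 /=.
Qed.

Lemma delbar10E : (forall z u, a z (hol_part u) = a z u) ->
  (forall z u, a z (antihol_part u) = 0) -> forall z v,
  delbar (fun y (v : 'I_1 -> TC R n) => a y (v 0)) z v =
    d1 a z (hol_part (v 0)) (antihol_part (v 1)) +
    d1 a z (antihol_part (v 0)) (hol_part (v 1)).
Proof.
move=> aa ah z v; pose a1 y (v : 'I_1 -> TC R n) := a y (v 0).
have -> : delbar a1 z v = bidegree 0 (ext_d (fun y => bidegree 0 (a1 y)) z) v +
    bidegree 1 (ext_d (fun y => bidegree 1 (a1 y)) z) v.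
  by rewrite /delbar big_ord_recl big_ord1.
have -> : (fun y => bidegree 0 (a1 y)) = (fun y v => 0).
  by apply/funext => w; apply/funext => u; rewrite bidegree0E /a1 ah.
have -> : (fun y => bidegree 1 (a1 y)) = (fun y v => a y (v 0)).
  by apply/funext => w; apply/funext => u; rewrite bidegree_maxE /a1 aa.
rewrite bidegree0E bidegree1E.
rewrite (ext_d1E (fun _ _ => 0)) /d1 !cdiff_cst subrr add0r.
by rewrite !ext_d1E /d1 /=.
Qed.

Lemma d1_hol_hol z u w : (forall z u, a z (hol_part u) = 0) ->
  d1 a z (hol_part u) (hol_part w) = 0.
Proof.
move=> ah; rewrite /d1.
have E t : a^~ (hol_part t) = fun=> 0 by apply/funext => y; exact: ah.
by rewrite !E !cdiff_cst subrr.
Qed.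

Lemma d1_antihol_antihol z u w : (forall z u, a z (antihol_part u) = 0) ->
  d1 a z (antihol_part u) (antihol_part w) = 0.
Proof.
move=> ah; rewrite /d1.
have E t : a^~ (antihol_part t) = fun=> 0 by apply/funext => y; exact: ah.
by rewrite !E !cdiff_cst subrr.
Qed.

End OneFormTypes.

Section MetricForms.
Context {R : realType} {n : nat} (M : complexManifold R n).
Variable g : hermitian_metric M.
Implicit Types (c : cm_index M) (z : Cn R n) (u w : TC R n).

Lemma chart_image_open c : open (chart_image c).
Proof. exact: cm_image_open. Qed.
Hint Resolve chart_image_open : core.

(** A nonzero vector in the kernel would have norm zero. *)
Lemma metric_unit c z : chart_image c z -> g c z \in unitmx.
Proof.
move=> Uz; rewrite -row_free_unit -kermx_eq0; apply/rowV0P => u /sub_kermxP u0.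
apply/eqP/negPn/negP => /(@hm_positive _ _ _ g _ _ Uz _).
by rewrite u0 mul0mx mxE ltxx.
Qed.

Lemma metric_det_gt0 c z : chart_image c z -> 0 < complex.Re (\det (g c z)).
Proof.
move=> Uz; have := det_gt0 (@hm_positive _ _ _ g _ _ Uz).
by rewrite ltcE /= => /andP[].
Qed.

Lemma smoothC_metric_inv c p q :
  smoothC (chart_image c) (fun z => metric_inv g c z p q).
Proof.
apply: smoothC_invmx => //; first by move=> *; exact: hm_smooth.
by move=> z; exact: metric_unit.
Qed.

Lemma metric_inv_conj c z p q : chart_image c z ->
  (metric_inv g c z p q)^* = metric_inv g c z q p.
Proof.
move=> Uz; have H := @hm_hermitian _ _ _ g _ _ Uz.
have -> : metric_inv g c z q p = (invmx (g c z))^T q p by rewrite mxE.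
by rewrite trmx_inv H -map_invmx mxE.
Qed.

Lemma metric_conj c z p q : chart_image c z -> (g c z p q)^* = g c z q p.
Proof.
move=> Uz; 
have /matrixP/(_ p q) := @hm_hermitian _ _ _ g _ _ Uz; 
by rewrite !mxE => ->.
Qed.

Lemma conj_vecK u : conj_vec (conj_vec u) = u.
Proof.
by case: u => p q; congr pair; apply/rowP => i; rewrite !mxE conjcK.
Qed.

Lemma dzbarE j (f : Cn R n -> R[i]) z : dzbar j f z = cdiff f z (0, delta_mx 0 j).
Proof.
rewrite /cdiff (bigD1 j) //= big1 ?addr0; last first.
  by move=> i ij; rewrite !mxE !eqxx (negPf ij) /= !mul0r addr0.
by rewrite !mxE !eqxx mul0r add0r mul1r.
Qed.

Lemma dzE j (f : Cn R n -> R[i]) z : dz j f z = cdiff f z (delta_mx 0 j, 0).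
Proof.
rewrite /cdiff (bigD1 j) //= big1 ?addr0; last first.
  by move=> i ij; rewrite !mxE !eqxx (negPf ij) /= !mul0r addr0.
by rewrite !mxE !eqxx mul0r addr0 mul1r.
Qed.

Lemma smoothC_dzbar U j (f : Cn R n -> R[i]) : open U -> smoothC U f ->
  smoothC U (fun z => dzbar j f z).
Proof.
move=> o sf.
have H := smoothC_cdiff o (0, delta_mx 0 j) sf.
by apply: (smoothC_ext o) H => z _; rewrite dzbarE.
Qed.

Definition beta c z u : R[i] := del_adj_kahler g c z (fun=> u).
Definition gamma c z u : R[i] := delbar_adj_kahler g c z (fun=> u).

Lemma beta_antihol c z u : beta c z (antihol_part u) = beta c z u.
Proof. by []. Qed.

Lemma beta_hol c z u : beta c z (hol_part u) = 0.
Proof.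
by rewrite /beta /del_adj_kahler big1// => k _; rewrite /form_dzbar /= mxE mulr0.
Qed.

Lemma gamma_hol c z u : gamma c z (hol_part u) = gamma c z u.
Proof. by []. Qed.

Lemma gamma_antihol c z u : gamma c z (antihol_part u) = 0.
Proof.
by rewrite /gamma /delbar_adj_kahler big1// => k _; rewrite /form_dz /= mxE mulr0.
Qed.

Lemma smooth_beta c : smooth1form (chart_image c) (beta c).
Proof.
have o := @chart_image_open c; split.
  move=> u; rewrite /beta /del_adj_kahler; apply: smoothC_sum => // k _.
  apply: smoothCM => //; last exact: smoothC_cst.
  apply: smoothCM => //; first exact: smoothC_cst.
  apply: smoothC_sum => // p _; apply: smoothC_sum => // q _.
  apply: smoothCM => //; first exact: smoothC_metric_inv.
  apply: smoothCB => //.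
  - by apply: smoothC_dzbar => //; exact: hm_smooth.
  - by apply: smoothC_dzbar => //; exact: hm_smooth.
move=> z t u w _; rewrite /beta /del_adj_kahler mulr_sumr -big_split.
by apply: eq_bigr => k _; rewrite /form_dzbar /= !mxE; ring.
Qed.

Lemma conj_i_half : ('i / 2%:R : R[i])^* = - ('i / 2%:R).
Proof.
have Ji : (0 +i* (-1)) = - 'i :> R[i] by apply: complex_eqP; rewrite /= ?oppr0.
by rewrite rmorphM fmorphV rmorph_nat /= Ji mulNr.
Qed.

Lemma conj_i_halfM (S x : R[i]) :
  ('i / 2%:R * S * x : R[i])^* = - ('i / 2%:R) * S^*%C * x^*%C.
Proof. by rewrite 2!(rmorphM conjc) -conj_i_half. Qed.

(** Conjugation transposes the metric and its inverse and exchanges [dz] with [dzbar]; the sign from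
    the conjugate of ['i / 2] reverses the difference of derivatives. Smoothness and naturality are
    then proved for [beta] only. *)
Lemma gammaE c z u : chart_image c z -> gamma c z u = (beta c z (conj_vec u))^*.
Proof.
move=> Uz; rewrite /gamma /beta /delbar_adj_kahler /del_adj_kahler conjc_sum.
have H (r t : 'I_n) w : (cdiff (fun y => g c y r t) z w)^* =
    cdiff (fun y => g c y t r) z (conj_vec w).
  rewrite -[w in LHS]conj_vecK -(cdiff_conj _ (hm_smooth g c r t) Uz).
  by apply: (cdiff_eq (@chart_image_open c)) => // y Uy; exact: metric_conj.
have conj_dz j : conj_vec (delta_mx 0 j, 0) = (0, delta_mx 0 j) :> TC R n.
  by congr (_, _); apply/rowP => l; rewrite !mxE ?conjc_nat ?conjc0.
have conj_dzbar j : conj_vec (0, delta_mx 0 j) = (delta_mx 0 j, 0) :> TC R n.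
  by congr (_, _); apply/rowP => l; rewrite !mxE ?conjc_nat ?conjc0.
apply: eq_bigr => k _; rewrite /form_dz /form_dzbar.
apply: etrans _ (esym (conj_i_halfM _ _)); rewrite mxE conjcK; congr (_ * _).
rewrite mulNr -mulrN; congr (_ * _).
(* The transposition caused by conjugation swaps the roles of the summation indices [p] and [q]. *)
rewrite conjc_sum -sumrN exchange_big; apply: eq_bigr => p _.
rewrite conjc_sum -sumrN; apply: eq_bigr => q _.
rewrite conjcM metric_inv_conj// -[RHS]mulrN; congr (_ * _).
by rewrite conjcB !dzbarE !dzE !H !conj_dzbar opprB.
Qed.

Lemma smooth_gamma c : smooth1form (chart_image c) (gamma c).
Proof.
have o := @chart_image_open c; have [sb lb] := smooth_beta c; split.
  move=> u; apply: (smoothC_ext o (f := fun z => (beta c z (conj_vec u))^*)).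
    by move=> z Uz; rewrite gammaE.
  exact: smoothC_conj.
move=> z t u w _; rewrite /gamma /delbar_adj_kahler mulr_sumr -big_split.
by apply: eq_bigr => k _; rewrite /form_dz /= !mxE; ring.
Qed.

Definition log_det_fun c z : R[i] := (ln (complex.Re (\det (g c z))))%:C.

Lemma smooth_log_det c : smoothC (chart_image c) (log_det_fun c).
Proof.
have o := @chart_image_open c.
have [sr _] : smoothC (chart_image c) (fun z => \det (g c z)).
  by apply: smoothC_det => // i j; exact: hm_smooth.
split; last by move=> k; exact: Ck_cst.
by move=> k; apply: Ck_ln => // z; exact: metric_det_gt0.
Qed.

Definition dbar_log_det c z u : R[i] := cdiff (log_det_fun c) z (antihol_part u).

Lemma smooth_dbar_log_det c : smooth1form (chart_image c) (dbar_log_det c).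
Proof.
have o := @chart_image_open c; split.
  by move=> u; apply: smoothC_cdiff => //; exact: smooth_log_det.
move=> z t u w _; rewrite /dbar_log_det -cdiff_linear; congr cdiff.
by rewrite /antihol_part /=; congr pair; rewrite /= scaler0 addr0.
Qed.

Lemma dbar_log_det_hol c z u : dbar_log_det c z (hol_part u) = 0.
Proof.
rewrite /dbar_log_det /cdiff big1// => j _ /=.
by rewrite !mxE !mul0r addr0.
Qed.

Lemma delbar_log_detE c : delbar (log_det g c) = fun z v => dbar_log_det c z (v 0).
Proof.
apply/funext => z; apply/funext => v.
rewrite /delbar big_ord_recl big_ord0 addr0 /= bidegree0E /ext_d.
rewrite big_ord_recl big_ord0 addr0 expr0 mul1r /dbar_log_det.
apply: (congr1 (fun f => cdiff f z (antihol_part (v 0)))).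
by apply/funext => y; rewrite bidegree0E.
Qed.

(** This is [delbar delbar = 0], an instance of the symmetry of second derivatives. *)
Lemma d1_dbar_log_det_antihol c z u w : chart_image c z ->
  d1 (dbar_log_det c) z (antihol_part u) (antihol_part w) = 0.
Proof.
move=> Uz; rewrite /d1 /dbar_log_det.
rewrite (cdiff_comm (@chart_image_open c) _ _ (smooth_log_det c) Uz).
by rewrite subrr.
Qed.

Lemma kahler_formE c z v : kahler_form g c z v =
  \sum_(j < n) \sum_(k < n) 'i / 2%:R * g c z j k *
    ((v 0).1 0 j * (v 1).2 0 k - (v 1).1 0 j * (v 0).2 0 k).
Proof.
apply: eq_bigr => j _; apply: eq_bigr => k _; congr (_ * _).
exact: (wedge11E (fun u => u.1 0 j) (fun u => u.2 0 k)).
Qed.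

(** Each operator in the static equation acts on a form of pure type (0,1) or (1,0), so all three
    terms become mixed components of [d1] and can be compared with the derivative of one 1-form. *)
Lemma static_kahlerE lambda c z v : static g lambda -> chart_image c z ->
  lambda%:C * kahler_form g c z v =
  - (d1 (beta c) z (hol_part (v 0)) (antihol_part (v 1)) +
     d1 (beta c) z (antihol_part (v 0)) (hol_part (v 1)))
  - (d1 (gamma c) z (hol_part (v 0)) (antihol_part (v 1)) +
     d1 (gamma c) z (antihol_part (v 0)) (hol_part (v 1)))
  - 'i / 2%:R * (d1 (dbar_log_det c) z (hol_part (v 0)) (antihol_part (v 1)) +
     d1 (dbar_log_det c) z (antihol_part (v 0)) (hol_part (v 1))).
Proof.
move=> hg Uz.
have Eb : del (del_adj_kahler g c) z v = _ :=
  del01E (@beta_antihol c) (@beta_hol c) z v.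
have Eg : delbar (delbar_adj_kahler g c) z v = _ :=
  delbar10E (@gamma_hol c) (@gamma_antihol c) z v.
have El := del01E (a := dbar_log_det c) (fun _ _ => erefl) (@dbar_log_det_hol c) z v.
by have := static_eq hg Uz v; rewrite delbar_log_detE Eb Eg El => <-.
Qed.

End MetricForms.

(** * The tamed form in a chart: closedness, reality, (1,1)-part *)

Section TamedForm.
Context {R : realType} {n : nat} (M : complexManifold R n).
Variable g : hermitian_metric M.
Implicit Types (c : cm_index M) (z : Cn R n) (u w : TC R n).

Lemma d1_0l U (a : Cn R n -> TC R n -> R[i]) z w : open U -> smooth1form U a ->
  U z -> d1 a z 0 w = 0.
Proof.
move=> o sa Uz; have := d1_linearl o sa (-1) 0 0 w Uz.
by rewrite scaler0 addr0 mulN1r addNr.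
Qed.

Lemma d1_0r U (a : Cn R n -> TC R n -> R[i]) z w : open U -> smooth1form U a ->
  U z -> d1 a z w 0 = 0.
Proof. by move=> o sa Uz; rewrite d1_anti (d1_0l _ o sa Uz) oppr0. Qed.

(* [omega - lambda^-1 (delbar del^* omega + del delbar^* omega)]. *)
Definition tamed_form lambda : local_forms M 2 := fun c z v =>
  kahler_form g c z v - (lambda^-1)%:C *
    (d1 (beta g c) z (antihol_part (v 0)) (antihol_part (v 1)) +
     d1 (gamma g c) z (hol_part (v 0)) (hol_part (v 1))).

(* [- lambda^-1 d(primitive)] is [tamed_form] in each chart; unlike [tamed_form],
   the summand involving [log det g] depends on the chart. *)
Definition primitive c z u : R[i] :=
  beta g c z u + 1 * gamma g c z u + 'i / 2%:R * dbar_log_det g c z u.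

Lemma smooth_primitive c : smooth1form (chart_image c) (primitive c).
Proof.
have o := @chart_image_open _ _ M c.
apply: smooth1formD => //; last exact: smooth_dbar_log_det.
by apply: smooth1formD => //; [exact: smooth_beta|exact: smooth_gamma].
Qed.

Lemma tamed_formE lambda c z v : static g lambda -> lambda != 0 ->
  chart_image c z ->
  tamed_form lambda c z v = - (lambda^-1)%:C * d1 (primitive c) z (v 0) (v 1).
Proof.
move=> hg l0 Uz; have o := @chart_image_open _ _ M c.
have sb := smooth_beta g c; have sc := smooth_gamma g c.
have sd := smooth_dbar_log_det g c.
(* The factor 1 before the second term matches the shape [a + c * b] in which [d1D] states
   linearity. *)
have -> : d1 (primitive c) z (v 0) (v 1) = d1 (beta g c) z (v 0) (v 1)
    + 1 * d1 (gamma g c) z (v 0) (v 1)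
    + 'i / 2%:R * d1 (dbar_log_det g c) z (v 0) (v 1).
  rewrite -(d1D o 1 _ _ sb sc Uz) -(d1D o _ _ _ _ sd Uz)//.
  exact: smooth1formD.
(* What remains is the (0,2)-part of [d beta], the (2,0)-part of [d gamma], and the (1,1)-parts of
   all three terms, whose weighted sum is [- lambda omega] by the static equation. *)
rewrite (d1_split o sb _ _ Uz) (d1_split o sc _ _ Uz) (d1_split o sd _ _ Uz).
rewrite (d1_hol_hol (a := beta g c)); last exact: beta_hol.
rewrite (d1_antihol_antihol (a := gamma g c)); last exact: gamma_antihol.
rewrite (d1_hol_hol (a := dbar_log_det g c)); last exact: dbar_log_det_hol.
rewrite d1_dbar_log_det_antihol//.
have := static_kahlerE v hg Uz; rewrite /tamed_form.
move: (kahler_form g c z v) => k.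
move: (d1 (beta g c) z (antihol_part _) (antihol_part _)) => b1.
move: (d1 (beta g c) z (hol_part _) (antihol_part _)) => b2.
move: (d1 (beta g c) z (antihol_part _) (hol_part _)) => b3.
move: (d1 (gamma g c) z (hol_part _) (antihol_part _)) => c2.
move: (d1 (gamma g c) z (antihol_part _) (hol_part _)) => c3.
move: (d1 (gamma g c) z (hol_part _) (hol_part _)) => c4.
move: (d1 (dbar_log_det g c) z (hol_part _) (antihol_part _)) => e2.
move: (d1 (dbar_log_det g c) z (antihol_part _) (hol_part _)) => e3.
move: (_ / _) => i2 H.
have L : lambda%:C * (lambda^-1)%:C = 1 :> R[i].
  by rewrite -rmorphM /= mulfV.
have L' : (lambda^-1)%:C * lambda%:C = 1 :> R[i] by rewrite mulrC.
have -> : k = (lambda^-1)%:C * (lambda%:C * k) by rewrite mulrA L' mul1r.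
rewrite H; move: ((lambda^-1)%:C) => t.
by ring.
Qed.

Lemma update2E (v : 'I_2 -> TC R n) (i : 'I_2) u :
  [eta v with i |-> u] 0 = (if i == 0 then u else v 0) /\
  [eta v with i |-> u] 1 = (if i == 1 then u else v 1).
Proof. by rewrite /= ![_ == i]eq_sym. Qed.

Lemma tamed_form_multilinear lambda c z : static g lambda -> lambda != 0 ->
  chart_image c z -> multilinear (tamed_form lambda c z).
Proof.
move=> hg l0 Uz v i t u w; have o := @chart_image_open _ _ M c.
rewrite !tamed_formE//.
rewrite !(update2E v i _).1 !(update2E v i _).2.
case: (ord2P i) => ->.
- rewrite /= (d1_linearl o (smooth_primitive c) _ _ _ _ Uz).
  by move: (d1 _ z _ _) (d1 _ z _ _) => p q; ring.
- rewrite /= (d1_linearr o (smooth_primitive c) _ _ _ _ Uz).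
  by move: (d1 _ z _ _) (d1 _ z _ _) => p q; ring.
Qed.

Lemma tamed_form_alternating lambda c z : static g lambda -> lambda != 0 ->
  chart_image c z -> Defs.alternating (tamed_form lambda c z).
Proof.
move=> hg l0 Uz v i j ij vij; rewrite tamed_formE//.
suff -> : v 0 = v 1 by rewrite d1_alt mulr0.
by case: (ord2P i) (ord2P j) ij vij => -> [] ->.
Qed.

Lemma tamed_form_smooth lambda c v :
  smoothC (chart_image c) (fun z => tamed_form lambda c z v).
Proof.
have o := @chart_image_open _ _ M c.
apply: smoothCB => //.
  rewrite /kahler_form; apply: smoothC_sum => // j _; apply: smoothC_sum => // k _.
  apply: smoothCM => //; last exact: smoothC_cst.
  by apply: smoothCM => //; [exact: smoothC_cst|exact: hm_smooth].
apply: smoothCM => //; first exact: smoothC_cst.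
by apply: smoothCD => //; apply: smoothC_d1 => //;
  [exact: smooth_beta|exact: smooth_gamma].
Qed.

(** The exterior derivative at [z] only sees the form on the open chart image, where it is a
    constant multiple of [d (primitive c)]; hence a primitive in each chart suffices. *)
Lemma tamed_form_closed lambda : static g lambda -> lambda != 0 ->
  closed_form (tamed_form lambda).
Proof.
move=> hg l0 c z Uz v; have o := @chart_image_open _ _ M c.
have sp := smooth_primitive c.
have -> : ext_d (tamed_form lambda c) z v =
   ext_d (fun y (v : 'I_2 -> TC R n) =>
     - (lambda^-1)%:C * d1 (primitive c) y (v 0) (v 1)) z v.
  apply: eq_bigr => i _; congr (_ * _).
  by apply: (cdiff_eq o) => // y Uy; rewrite tamed_formE.
rewrite (ext_d2E (fun y u w => - (lambda^-1)%:C * d1 (primitive c) y u w)).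
have Z p q r : cdiff (fun y => - (lambda^-1)%:C * d1 (primitive c) y p q) z r =
    - (lambda^-1)%:C * cdiff (fun y => d1 (primitive c) y p q) z r.
  exact: (cdiffZ o (- (lambda^-1)%:C) r (smoothC_d1 o sp p q) Uz).
have E := congr2 +%R
  (congr2 (fun x y => x - y) (Z (v 1) (v 2%:R) (v 0)) (Z (v 0) (v 2%:R) (v 1)))
  (Z (v 0) (v 1) (v 2%:R)).
apply: (etrans E); rewrite -mulrBr -mulrDr.
have D := d1_closed o sp (v 0) (v 1) (v 2%:R) Uz.
by apply: (etrans (congr1 ( *%R _) D)); rewrite mulr0.
Qed.

Lemma d1_gammaE c z u w : chart_image c z ->
  d1 (gamma g c) z u w = (d1 (beta g c) z (conj_vec u) (conj_vec w))^*.
Proof.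
move=> Uz; have o := @chart_image_open _ _ M c.
have [sb _] := smooth_beta g c.
have E p q : cdiff ((gamma g c)^~ p) z q =
    (cdiff ((beta g c)^~ (conj_vec p)) z (conj_vec q))^*.
  rewrite -(cdiff_conj _ (sb _) Uz).
  by apply: (cdiff_eq o) => // y Uy; exact: gammaE.
by rewrite /d1 !E conjcB.
Qed.

Lemma kahler_form_real c z : chart_image c z -> real_mform (kahler_form g c z).
Proof.
move=> Uz v; rewrite !kahler_formE conjc_sum exchange_big.
apply: eq_bigr => j _; rewrite conjc_sum; apply: eq_bigr => k _.
rewrite conj_i_halfM metric_conj// conjcB !conjcM /conj_vec /= !mxE.
by move: (_ / _) (g c z k j) ((v 0).1 0 j)^*%C ((v 1).2 0 k)^*%C
  ((v 1).1 0 j)^*%C ((v 0).2 0 k)^*%C => *; ring.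
Qed.

(** Conjugation exchanges the (0,2)-part of [d beta] with the (2,0)-part of [d gamma], and [lambda]
    is real. *)
Lemma tamed_form_real lambda : real_form (tamed_form lambda).
Proof.
move=> c z Uz v.
have conj_real (x : R) : (x%:C)^*%C = x%:C by exact: conjc_real.
rewrite /tamed_form kahler_form_real// conjcB conjcM conj_real conjcD.
congr (_ - _ * _).
have Ha u : antihol_part (conj_vec u) = conj_vec (hol_part u).
  by congr (_, _); apply/rowP => i; rewrite !mxE conjc0.
have Hh u : hol_part (conj_vec u) = conj_vec (antihol_part u).
  by congr (_, _); apply/rowP => i; rewrite !mxE conjc0.
rewrite !d1_gammaE// conjcK !Ha !Hh !conj_vecK addrC.
by [].
Qed.

(** On one holomorphic and one antiholomorphic argument, each correction term has an argument
    projected to zero. *)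
Lemma tamed_form_bidegree1 lambda c z v : chart_image c z ->
  bidegree 1 (tamed_form lambda c z) v = kahler_form g c z v.
Proof.
move=> Uz; have o := @chart_image_open _ _ M c.
have sb := smooth_beta g c; have sc := smooth_gamma g c.
rewrite bidegree1E /tamed_form /=.
have ah u : antihol_part (hol_part u) = 0 by [].
have ha u : hol_part (antihol_part u) = 0 by [].
rewrite !ah !ha (d1_0l _ o sb Uz) (d1_0r _ o sb Uz).
rewrite (d1_0l _ o sc Uz) (d1_0r _ o sc Uz).
rewrite !addr0 !mulr0 !subr0 !kahler_formE -big_split; apply: eq_bigr => j _.
rewrite -big_split; apply: eq_bigr => k _ /=.
by rewrite !mxE; ring.
Qed.

Lemma kahler_form_mx c z v : kahler_form g c z v = 'i / 2%:R *
  (((v 0).1 *m g c z *m (v 1).2^T) 0 0 - ((v 1).1 *m g c z *m (v 0).2^T) 0 0).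
Proof.
rewrite kahler_formE; have E (p q : 'rV[R[i]]_n) : (p *m g c z *m q^T) 0 0 =
    \sum_(j < n) \sum_(k < n) g c z j k * (p 0 j * q 0 k).
  rewrite exchange_big mxE; apply: eq_bigr => k _; rewrite !mxE mulr_suml.
  by apply: eq_bigr => j _; rewrite mulrCA mulrA.
rewrite !E -sumrB mulr_sumr; apply: eq_bigr => j _.
rewrite -sumrB mulr_sumr; apply: eq_bigr => k _.
by rewrite -mulrBr mulrA.
Qed.

(** For [X] the real vector of [u], both terms of [omega(X, JX)] carry a factor [- 'i], and with the
    prefactor ['i / 2] they add up to the squared norm of [u]. *)
Lemma kahler_form_positive c z : chart_image c z ->
  positive_mform (kahler_form g c z).
Proof.
move=> Uz u /(@hm_positive _ _ _ g _ _ Uz) upos.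
rewrite kahler_form_mx /=.
suff -> : 'i / 2%:R * ((u *m g c z *m (- 'i *: map_mx conjc u)^T) 0 0
   - ('i *: u *m g c z *m (map_mx conjc u)^T) 0 0) =
   (u *m g c z *m (map_mx conjc u)^T) 0 0 by [].
rewrite linearZ /= -scalemxAr -!scalemxAl !mxE.
move: (\sum_(_ < n) _) => x.
set I := (X in X / _ * _ = _).
have II : I * I = -1 by rewrite -expr2 sqr_i.
have -> : I / 2%:R * (- I * x - I * x) = - (I * I) * x by field.
by rewrite II opprK mul1r.
Qed.

End TamedForm.

(** * Change of charts *)

Section PullbackOneForm.
Context {R : realType} {n : nat} (V W : set (Cn R n)).
Hypotheses (openV : open V) (openW : open W).
Variable F : Cn R n -> Cn R n.
Hypothesis smoothF : forall k, smoothC W (Defs.coord k \o F).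
Hypotheses (FW : forall z, W z -> V (F z)).
Implicit Types (z : Cn R n) (u w : TC R n).

Lemma push1E z u k : (Defs.pushforward F z u).1 0 k = cdiff (Defs.coord k \o F) z u.
Proof. by rewrite mxE. Qed.

Lemma push2E z u k : (Defs.pushforward F z u).2 0 k =
  cdiff (fun y => (Defs.coord k (F y))^*) z u.
Proof. by rewrite mxE. Qed.

Lemma smoothF_conj k : smoothC W (fun y => (Defs.coord k (F y))^*).
Proof. exact: smoothC_conj (smoothF k). Qed.

Lemma form1_expand (a : Cn R n -> TC R n -> R[i]) z u : smooth1form V a -> V z ->
  a z u = \sum_(k < n) (u.1 0 k * a z (delta_mx 0 k, 0) +
                        u.2 0 k * a z (0, delta_mx 0 k)).
Proof.
move=> [_ l] Vz.
have l0 : a z 0 = 0.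
  by have := l z (-1) 0 0 Vz; rewrite scaler0 addr0 mulN1r addNr.
have lD x y : a z (x + y) = a z x + a z y.
  by have := l z 1 x y Vz; rewrite scale1r mul1r.
have lsum (G : 'I_n -> TC R n) : a z (\sum_(k < n) G k) = \sum_(k < n) a z (G k).
  exact: (big_morph _ lD l0).
have uE : u = \sum_(k < n) (u.1 0 k *: (delta_mx 0 k, 0) +
                            u.2 0 k *: (0, delta_mx 0 k)) :> TC R n.
  apply: injective_projections.
  - rewrite TC_fst_sum [LHS]row_sum_delta; apply: eq_bigr => k _ /=.
    by rewrite scaler0 addr0.
  - rewrite TC_snd_sum [LHS]row_sum_delta; apply: eq_bigr => k _ /=.
    by rewrite scaler0 add0r.
have lZ t x : a z (t *: x) = t * a z x.
  by have := l z t x 0 Vz; rewrite l0 !addr0.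
by rewrite {1}uE lsum; apply: eq_bigr => k _; rewrite l// lZ.
Qed.

Variables a a' : Cn R n -> TC R n -> R[i].
Hypotheses (sa' : smooth1form V a').
Hypothesis compat : forall z u, W z -> a z u = a' (F z) (Defs.pushforward F z u).

(** Product and chain rule applied to the coordinate expansion of [a']. The sum collects the second
    derivatives of [F] and of its conjugate; it is the obstruction to naturality of a single
    derivative. *)
Lemma cdiff_pullback z u w : W z ->
  cdiff (a^~ w) z u =
    cdiff (a'^~ (Defs.pushforward F z w)) (F z) (Defs.pushforward F z u) +
    \sum_(k < n)
     (a' (F z) (delta_mx 0 k, 0) * cdiff (fun y => cdiff (Defs.coord k \o F) y w) z u +
      a' (F z) (0, delta_mx 0 k) *
        cdiff (fun y => cdiff (fun x => (Defs.coord k (F x))^*) y w) z u).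
Proof.
move=> Wz; have [sA _] := sa'.
pose A (k : 'I_n) := a'^~ (delta_mx 0 k, 0).
pose B (k : 'I_n) := a'^~ (0, delta_mx 0 k).
have sAF k : smoothC W (A k \o F).
  exact: (smoothC_comp openW openV smoothF FW (sA _)).
have sBF k : smoothC W (B k \o F).
  exact: (smoothC_comp openW openV smoothF FW (sA _)).
have sF1 k : smoothC W (fun y => cdiff (Defs.coord k \o F) y w).
  exact: smoothC_cdiff.
have sF2 k : smoothC W (fun y => cdiff (fun x => (Defs.coord k (F x))^*) y w).
  by apply: smoothC_cdiff => //; exact: smoothF_conj.
rewrite (@cdiff_eq _ _ W openW _ (fun y => \sum_(k < n)
  ((A k \o F) y * cdiff (Defs.coord k \o F) y w +
   (B k \o F) y * cdiff (fun x => (Defs.coord k (F x))^*) y w)) _ _ _ Wz); last first.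
  move=> y Wy; rewrite compat// (form1_expand _ sa' (FW Wy)).
  by apply: eq_bigr => k _; rewrite push1E push2E mulrC [X in _ + X]mulrC.
rewrite (cdiff_sum openW); [|move=> k _|exact: Wz]; last first.
  exact: (smoothCD openW (smoothCM openW (sAF k) (sF1 k))
    (smoothCM openW (sBF k) (sF2 k))).
have -> : cdiff (a'^~ (Defs.pushforward F z w)) (F z) (Defs.pushforward F z u) =
  \sum_(k < n) ((Defs.pushforward F z w).1 0 k *
     cdiff (A k) (F z) (Defs.pushforward F z u)
   + (Defs.pushforward F z w).2 0 k *
     cdiff (B k) (F z) (Defs.pushforward F z u)).
  have sM (t : R[i]) f : smoothC V f -> smoothC V (fun y => t * f y).
    by move=> sf; apply: smoothCM => //; exact: smoothC_cst.
  rewrite (@cdiff_eq _ _ V openV _ (fun y => \sum_(k < n)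
    ((Defs.pushforward F z w).1 0 k * A k y +
     (Defs.pushforward F z w).2 0 k * B k y)) _ _ _ (FW Wz)); last first.
    by move=> y Vy; rewrite (form1_expand _ sa' Vy).
  rewrite (cdiff_sum openV); [|move=> k _|exact: FW]; last first.
    exact: (smoothCD openV (sM _ _ (sA _)) (sM _ _ (sA _))).
  apply: eq_bigr => k _.
  rewrite (cdiffD _ (sM _ _ (sA _)) (sM _ _ (sA _)) (FW Wz)).
  by rewrite !(fun t f sf => @cdiffZ _ _ V openV t f _ _ sf (FW Wz)).
rewrite -big_split; apply: eq_bigr => k _.
rewrite (cdiffD _ (smoothCM openW (sAF k) (sF1 k))
  (smoothCM openW (sBF k) (sF2 k)) Wz).
rewrite (cdiffM _ (sAF k) (sF1 k) Wz) (cdiffM _ (sBF k) (sF2 k) Wz).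
rewrite (cdiff_comp openV smoothF _ (sA _) Wz (FW Wz)).
rewrite (cdiff_comp openV smoothF _ (sA _) Wz (FW Wz)).
rewrite push1E push2E /A /B /=.
move: (cdiff _ z w) (cdiff _ z w) (cdiff _ z u) (cdiff _ z u) => p q r s.
move: (cdiff _ (F z) _) (cdiff _ (F z) _) (a' _ _) (a' _ _) => *.
ring.
Qed.

(** The second-derivative terms of [cdiff_pullback] are symmetric in [u] and [w], so
    antisymmetrization removes them. *)
Lemma d1_pullback z u w : W z -> d1 a z u w =
  d1 a' (F z) (Defs.pushforward F z u) (Defs.pushforward F z w).
Proof.
move=> Wz; rewrite /d1 !cdiff_pullback// opprD addrACA.
rewrite -[RHS]addr0; congr (_ + _); apply/eqP; rewrite subr_eq0; apply/eqP.
apply: eq_bigr => k _; apply: (congr2 +%R); apply: (congr1 ( *%R _)).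
- exact: cdiff_comm (smoothF k) Wz.
- exact: cdiff_comm (smoothF_conj k) Wz.
Qed.

Lemma conj_push z u : W z ->
  conj_vec (Defs.pushforward F z u) = Defs.pushforward F z (conj_vec u).
Proof.
move=> Wz; congr (_, _); apply/rowP => k; rewrite !mxE.
- by rewrite (cdiff_conj _ (smoothF k) Wz) conjcK.
- by rewrite (cdiff_conj _ (smoothF k) Wz) conj_vecK.
Qed.

End PullbackOneForm.

(** * Behaviour of the metric, the torsion and the tamed form under a transition map *)

Section ChartChange.
Context {R : realType} {n : nat} (M : complexManifold R n).
Variable g : hermitian_metric M.
Variables c c' : cm_index M.
Implicit Types (z : Cn R n) (u w : TC R n).

Let U := chart_image c.
Let V := chart_image c'.
Let W := chart_overlap c c'.
Let F := transition c c'.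

Let openU : open U. Proof. exact: chart_image_open. Qed.
Let openV : open V. Proof. exact: chart_image_open. Qed.

(** Within the open chart image, [W] is the preimage of an open domain under the continuous inverse
    chart. *)
Lemma chart_overlap_open : open W.
Proof.
rewrite openE => z [x [xc xc'] xz].
have zU : U z by exists x.
have inv_z : cm_inv c z = x by rewrite -xz cm_mapK.
have cz := cm_inv_continuous zU.
have : \forall y \near z, cm_dom c' (cm_inv c y).
  apply: cz; rewrite inv_z; apply: open_nbhs_nbhs; split => //.
  exact: cm_dom_open.
apply: filterS2 (open_nbhs_nbhs (conj openU zU)) => y [x' x'c <-].
by rewrite cm_mapK// => x'c'; exists x'.
Qed.

Let openW := chart_overlap_open.

Lemma chart_overlap_sub : W `<=` U.
Proof. by move=> z [x [xc _] <-]; exists x. Qed.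

Lemma transition_image z : W z -> V (F z).
Proof. by move=> [x [xc xc'] <-]; rewrite /F /transition /= cm_mapK//; exists x. Qed.

Let WU := chart_overlap_sub.
Let FW := transition_image.

Lemma transition_smooth k : smoothC W (Defs.coord k \o F).
Proof. by have [] := @cm_holomorphic _ _ M c c' k. Qed.

Let sF := transition_smooth.

Lemma transition_dzbar k j z : W z -> dzbar j (Defs.coord k \o F) z = 0.
Proof. by have [_] := @cm_holomorphic _ _ M c c' k; apply. Qed.

Let J z := holo_jacobian F z.

(** Holomorphy removes the antiholomorphic derivatives, so the pushforward is block diagonal;
    together with [push2_mx] this is why it respects types. *)
Lemma push1_mx z u : W z -> (Defs.pushforward F z u).1 = u.1 *m (J z)^T.
Proof.
move=> Wz; apply/rowP => k; rewrite push1E mxE; apply: eq_bigr => j _.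
by rewrite transition_dzbar// mulr0 addr0 !mxE.
Qed.

Lemma push2_mx z u : W z ->
  (Defs.pushforward F z u).2 = u.2 *m (map_mx conjc (J z))^T.
Proof.
move=> Wz; apply/rowP => k; rewrite push2E (cdiff_conj _ (sF k) Wz) mxE conjc_sum.
apply: eq_bigr => j _.
by rewrite transition_dzbar// mulr0 addr0 conjcM /conj_vec !mxE conjcK.
Qed.

Lemma push_hol z u : W z ->
  hol_part (Defs.pushforward F z u) = Defs.pushforward F z (hol_part u).
Proof.
move=> Wz; apply: injective_projections.
- exact: etrans (push1_mx u Wz) (esym (push1_mx (hol_part u) Wz)).
- exact: etrans (esym (mul0mx _ _)) (esym (push2_mx (hol_part u) Wz)).
Qed.

Lemma push_antihol z u : W z ->
  antihol_part (Defs.pushforward F z u) = Defs.pushforward F z (antihol_part u).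
Proof.
move=> Wz; apply: injective_projections.
- exact: etrans (esym (mul0mx _ _)) (esym (push1_mx (antihol_part u) Wz)).
- exact: etrans (push2_mx u Wz) (esym (push2_mx (antihol_part u) Wz)).
Qed.

Lemma metric_transform z : W z ->
  g c z = (J z)^T *m g c' (F z) *m map_mx conjc (J z).
Proof. by move=> Wz; exact: hm_compat. Qed.

Lemma kahler_form_compat z v : W z -> kahler_form g c z v =
  kahler_form g c' (F z) (fun l => Defs.pushforward F z (v l)).
Proof.
move=> Wz; rewrite !kahler_form_mx (push1_mx (v 0) Wz) (push1_mx (v 1) Wz).
rewrite (push2_mx (v 0) Wz) (push2_mx (v 1) Wz).
by rewrite (metric_transform Wz) !trmx_mul !trmxK !mulmxA.
Qed.

(** The Jacobian and its conjugate are factors of the invertible matrix [g c z]. *)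
Lemma jacobian_unit z : W z -> J z \in unitmx /\ map_mx conjc (J z) \in unitmx.
Proof.
move=> Wz; have := metric_unit g (WU Wz).
rewrite (metric_transform Wz) !unitmx_mul unitmx_tr => /andP[/andP[-> _] ->].
by [].
Qed.

Lemma metric_inv_transform z : W z ->
  map_mx conjc (J z) *m invmx (g c z) *m (J z)^T = invmx (g c' (F z)).
Proof.
move=> Wz; have [uJ uJc] := jacobian_unit Wz.
have ug' := metric_unit g (FW Wz).
set X := map_mx conjc (J z) *m _ *m _.
have XJ : X *m g c' (F z) *m map_mx conjc (J z) = map_mx conjc (J z).
  rewrite /X -!mulmxA [_^T *m _]mulmxA -(metric_transform Wz) mulVmx ?mulmx1//.
  exact: metric_unit (WU Wz).
have X1 : X *m g c' (F z) = 1%:M.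
  by rewrite -[LHS](mulmxK uJc) XJ mulmxV.
by rewrite -[LHS](mulmxK ug') X1 mul1mx.
Qed.

(* [torsion_mx d z k] has entries [T_{p \bar q \bar k}], components of the tensor
   [delbar omega]; contracting [p] with [\bar q] gives [del^* omega]. *)
Definition torsion_mx (d : cm_index M) z (k : 'I_n) : 'M[R[i]]_n :=
  \matrix_(p, q) (dzbar q (fun y => g d y p k) z - dzbar k (fun y => g d y p q) z).

(** As a trace, the contraction with the inverse metric can be transformed by cyclicity. The index
    order agrees because [metric_inv] at [p], [q] is the entry of [invmx] at [q], [p]. *)
Lemma betaE d z u : beta g d z u =
  \sum_(k < n) ('i / 2%:R * \tr (invmx (g d z) *m torsion_mx d z k)) * u.2 0 k.
Proof.
apply: eq_bigr => k _; congr (_ * _ * _).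
rewrite exchange_big; apply: eq_bigr => q _; rewrite mxE; apply: eq_bigr => p _.
by rewrite mxE.
Qed.

Lemma smooth_jacobian a p : smoothC W (fun y => J y a p).
Proof.
have H := smoothC_cdiff openW (delta_mx 0 p, 0) (sF a).
by apply: (smoothC_ext openW) H => y _; rewrite mxE dzE.
Qed.

Lemma cdiff_jacobian a p u z : W z ->
  cdiff (fun y => J y a p) z u =
  cdiff (fun y => cdiff (Defs.coord a \o F) y u) z (delta_mx 0 p, 0).
Proof.
move=> Wz; rewrite -(cdiff_comm openW _ _ (sF a) Wz).
by apply: (cdiff_eq openW) => // y _; rewrite mxE dzE.
Qed.

(** Exchanging derivatives puts [dzbar] innermost, where it gives a function that vanishes on all of
    the open set [W]. *)
Lemma dzbar_jacobian a p q z : W z -> dzbar q (fun y => J y a p) z = 0.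
Proof.
move=> Wz; rewrite dzbarE cdiff_jacobian//.
rewrite (cdiff_eq openW (g := fun=> 0) _ _ Wz) ?cdiff_cst// => y Wy.
by rewrite -dzbarE transition_dzbar.
Qed.

Lemma dz_jacobianC a p q z : W z ->
  dz q (fun y => J y a p) z = dz p (fun y => J y a q) z.
Proof.
move=> Wz; rewrite !dzE cdiff_jacobian//; apply: (cdiff_eq openW) => // y _.
by rewrite mxE dzE.
Qed.

(** Product rule on the transformation law of the metric. The holomorphic Jacobian contributes
    nothing; the term in the derivative of the conjugate Jacobian shows that a single derivative of
    [g] is not a tensor. *)
Lemma dzbar_metric p q k z : W z ->
  dzbar q (fun y => g c y p k) z =
  \sum_(a < n) \sum_(d < n) J z a p *
    (g c' (F z) a d * (dz q (fun y => J y d k) z)^*%C +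
     (J z d k)^*%C *
       \sum_(b < n) (J z b q)^*%C * dzbar b (fun y => g c' y a d) (F z)).
Proof.
move=> Wz; rewrite dzbarE.
have sX a r := smooth_jacobian a r.
have sY a r : smoothC W (fun y => (J y a r)^*) by exact: smoothC_conj (sX a r).
have sG a d : smoothC W ((fun y => g c' y a d) \o F).
  by apply: (smoothC_comp openW openV sF FW); exact: hm_smooth.
have sGY a d : smoothC W (fun y => ((fun y => g c' y a d) \o F) y * (J y d k)^*%C).
  exact: smoothCM.
have sXGY a d : smoothC W (fun y => J y a p *
    (((fun y => g c' y a d) \o F) y * (J y d k)^*%C)).
  exact: smoothCM.
rewrite (cdiff_eq openW (g := fun y => \sum_(a < n) \sum_(d < n) J y a p *
    (((fun y => g c' y a d) \o F) y * (J y d k)^*%C)) _ _ Wz); last first.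
  move=> y Wy; rewrite (metric_transform Wy) mxE exchange_big; apply: eq_bigr => d _.
  rewrite !mxE mulr_suml; apply: eq_bigr => a _.
  by rewrite [(J y)^T _ _]mxE -mulrA.
rewrite (cdiff_sum openW); [|by move=> a _; exact: smoothC_sum|by []].
apply: eq_bigr => a _.
rewrite (cdiff_sum openW); [|by move=> d _; exact: sXGY|by []].
apply: eq_bigr => d _.
rewrite (cdiffM _ (sX a p) (sGY a d) Wz) -dzbarE dzbarE.
rewrite -[cdiff (fun y => J y a p) z _]dzbarE dzbar_jacobian// mulr0 addr0.
congr (_ * _).
rewrite (cdiffM _ (sG a d) (sY d k) Wz); congr (_ * _ + _ * _).
  rewrite (cdiff_conj _ (sX d k) Wz) dzE; congr (cdiff _ _ _)^*.
  by congr (_, _); apply/rowP => l; rewrite !mxE ?conjc0 ?conjc_nat.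
rewrite (cdiff_comp openV sF _ (hm_smooth g c' a d) Wz (FW Wz)).
apply: eq_bigr => b _; rewrite push1_mx// push2_mx//.
rewrite mul0mx [X in X * _ + _]mxE mul0r add0r; congr (_ * _).
by rewrite -rowE !mxE.
Qed.

(** The non-tensorial term of [dzbar_metric] is symmetric in [q] and [k] by [dz_jacobianC], so it
    drops out of the difference that defines the torsion. *)
Lemma torsion_transform z k : W z -> torsion_mx c z k =
  (J z)^T *m (\sum_(d < n) (J z d k)^*%C *: torsion_mx c' (F z) d) *m
  map_mx conjc (J z).
Proof.
move=> Wz; apply/matrixP => p q.
pose B a d b := dzbar b (fun y => g c' y a d) (F z).
pose D a r s := \sum_(d < n) \sum_(b < n) (J z d r)^*%C * ((J z b s)^*%C * B a d b).
have L a : \sum_(d < n) J z a p *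
      (g c' (F z) a d * (dz q (fun y => J y d k) z)^*%C +
       (J z d k)^*%C * \sum_(b < n) (J z b q)^*%C * B a d b) -
    \sum_(d < n) J z a p *
      (g c' (F z) a d * (dz k (fun y => J y d q) z)^*%C +
       (J z d q)^*%C * \sum_(b < n) (J z b k)^*%C * B a d b) =
    J z a p * (D a k q - D a q k).
  rewrite /D -!sumrB mulr_sumr; apply: eq_bigr => d _.
  rewrite (dz_jacobianC d q k Wz) -!mulr_sumr.
  move: (dz _ _ _)^*%C (g _ _ _ _) (\sum_(_ < n) _) (\sum_(_ < n) _) => x y s t.
  by move: (J z a p) (J z d k)^*%C (J z d q)^*%C => *; ring.
rewrite mxE (dzbar_metric p q k Wz) (dzbar_metric p k q Wz) -sumrB.
rewrite (eq_bigr _ (fun a _ => L a)) [RHS]mxE.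
have E b : ((J z)^T *m (\sum_(d < n) (J z d k)^*%C *: torsion_mx c' (F z) d)) p b *
    (map_mx conjc (J z)) b q =
    \sum_(a < n) J z a p *
      \sum_(d < n) (J z d k)^*%C * ((J z b q)^*%C * (B a d b - B a b d)).
  rewrite mxE mulr_suml; apply: eq_bigr => a _.
  rewrite [(J z)^T _ _]mxE [map_mx _ _ _ _]mxE -mulrA; congr (_ * _).
  rewrite summxE mulr_suml; apply: eq_bigr => d _.
  rewrite mxE -mulrA [_ * (J z b q)^*%C]mulrC; congr (_ * (_ * _)).
  by rewrite mxE.
rewrite (eq_bigr _ (fun b _ => E b)) exchange_big; apply: eq_bigr => a _.
rewrite -mulr_sumr; congr (_ * _).
rewrite /D [X in _ - X]exchange_big [RHS]exchange_big -sumrB; apply: eq_bigr => d _.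
rewrite -sumrB; apply: eq_bigr => b _.
by rewrite [in X in _ - X]mulrCA -!mulrBr.
Qed.

(** Cyclicity of the trace brings together the factors that [metric_inv_transform] turns into the
    inverse metric of the other chart; the remaining conjugate Jacobian entry is absorbed by the
    pushforward of the (0,1)-component. *)
Lemma beta_compat z u : W z ->
  beta g c z u = beta g c' (F z) (Defs.pushforward F z u).
Proof.
move=> Wz; rewrite !betaE.
have T k : \tr (invmx (g c z) *m torsion_mx c z k) =
    \sum_(d < n) (J z d k)^*%C * \tr (invmx (g c' (F z)) *m torsion_mx c' (F z) d).
  rewrite torsion_transform// mulmxA mxtrace_mulC !mulmxA metric_inv_transform//.
  rewrite mulmx_sumr raddf_sum; apply: eq_bigr => d _.
  by rewrite /= -scalemxAr mxtraceZ.
under eq_bigr do rewrite T mulr_sumr mulr_suml.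
rewrite exchange_big; apply: eq_bigr => d _.
rewrite push2_mx// mxE mulr_sumr; apply: eq_bigr => k _.
rewrite [(map_mx _ _)^T _ _]mxE [(map_mx _ _) _ _]mxE.
by move: (\tr _) (_ / _) (u.2 0 k) (_^*)%C => *; ring.
Qed.

(** Naturality of [d1] is combined with the fact that the pushforward by a holomorphic map commutes
    with both type projections. *)
Lemma tamed_form_compat lambda z v : W z -> tamed_form g lambda c z v =
  tamed_form g lambda c' (F z) (fun l => Defs.pushforward F z (v l)).
Proof.
move=> Wz.
have beta_compat' y u : W y ->
    beta g c y u = beta g c' (F y) (Defs.pushforward F y u).
  exact: beta_compat.
have gamma_compat y u : W y ->
    gamma g c y u = gamma g c' (F y) (Defs.pushforward F y u).
  move=> Wy; rewrite (gammaE g u (WU Wy)) (gammaE g _ (FW Wy)).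
  by rewrite (beta_compat _ Wy) (conj_push sF u Wy).
have Eb u w := d1_pullback openV openW sF FW (smooth_beta g c') beta_compat'
  (antihol_part u) (antihol_part w) Wz.
have Ec u w := d1_pullback openV openW sF FW (smooth_gamma g c') gamma_compat
  (hol_part u) (hol_part w) Wz.
apply: (congr2 (fun x y => x - _ * y)); first exact: kahler_form_compat.
apply: (congr2 +%R).
- apply: etrans (Eb (v 0) (v 1)) _.
  by rewrite -(push_antihol (v 0) Wz) -(push_antihol (v 1) Wz).
- apply: etrans (Ec (v 0) (v 1)) _.
  by rewrite -(push_hol (v 0) Wz) -(push_hol (v 1) Wz).
Qed.

End ChartChange.

(** * Pfaffians and positivity of the top power *)

Section BlockIndices.
Variable m : nat.

Lemma ev_subproof (i : 'I_m) : (i * 2 < m * 2)%N.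
Proof. by rewrite ltn_mul2r ltn_ord. Qed.

Lemma od_subproof (i : 'I_m) : ((i * 2).+1 < m * 2)%N.
Proof. by have := ltn_ord i; rewrite -(leq_pmul2r (isT : (0 < 2)%N)) mulSn. Qed.

Lemma blk_subproof (x : 'I_(m * 2)) : (x./2 < m)%N.
Proof. by rewrite ltn_half_double -muln2 ltn_ord. Qed.

(** Indices come in consecutive pairs, as in the frame [d/dx_1, d/dy_1, ...]: [ev i] and [od i] form
    block [i], [blk] finds the block and [flip] the partner. *)
Definition ev (i : 'I_m) : 'I_(m * 2) := Ordinal (ev_subproof i).
Definition od (i : 'I_m) : 'I_(m * 2) := Ordinal (od_subproof i).
Definition blk (x : 'I_(m * 2)) : 'I_m := Ordinal (blk_subproof x).

Lemma blk_ev i : blk (ev i) = i.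
Proof. by apply: val_inj; rewrite /= muln2 doubleK. Qed.

Lemma blk_od i : blk (od i) = i.
Proof. by apply: val_inj; rewrite /= muln2 uphalf_double. Qed.

Lemma odd_ev i : odd (ev i) = false.
Proof. by rewrite /= muln2 odd_double. Qed.

Lemma odd_od i : odd (od i) = true.
Proof. by rewrite /= muln2 odd_double. Qed.

Lemma ev_blk (x : 'I_(m * 2)) : odd x = false -> ev (blk x) = x.
Proof.
by move=> ox; apply: val_inj; rewrite /= muln2 -[RHS]odd_double_half ox.
Qed.

Lemma od_blk (x : 'I_(m * 2)) : odd x -> od (blk x) = x.
Proof.
by move=> ox; apply: val_inj; rewrite /= muln2 -[RHS]odd_double_half ox.
Qed.

Definition flip (x : 'I_(m * 2)) : 'I_(m * 2) :=
  if odd x then ev (blk x) else od (blk x).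

Lemma flip_ev i : flip (ev i) = od i.
Proof. by rewrite /flip odd_ev blk_ev. Qed.

Lemma flip_od i : flip (od i) = ev i.
Proof. by rewrite /flip odd_od blk_od. Qed.

Lemma flipK : involutive flip.
Proof.
move=> x; rewrite {2}/flip; case: ifP => ox.
  by rewrite flip_ev od_blk.
by rewrite flip_od ev_blk.
Qed.

Lemma big_blocks (S : Type) (idx : S) (op : Monoid.com_law idx)
    (G : 'I_(m * 2) -> S) :
  \big[op/idx]_x G x = \big[op/idx]_(i < m) op (G (ev i)) (G (od i)).
Proof.
rewrite (reindex (fun p : 'I_m * bool => if p.2 then ev p.1 else od p.1)) /=.
  rewrite -(pair_bigA _ (fun i b => G (if b then ev i else od i))) /=.
  by apply: eq_bigr => i _; rewrite big_bool.
exists (fun x => (blk x, ~~ odd x)) => [[i b] _|x _] /=.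
  by case: b; rewrite ?blk_ev ?blk_od ?odd_ev ?odd_od.
by case: ifPn => ox; [rewrite ev_blk//; exact: negbTE|rewrite od_blk//; exact: negbNE].
Qed.

End BlockIndices.

(** * The Pfaffian sum under congruence *)

Section Pfaffian.
Variable R : comNzRingType.

(* For an antisymmetric [A] this is [2^m m!] times the Pfaffian of [A]: every perfect
   matching is counted once for each labelling and orientation of its edges. *)
Definition pf m (A : 'I_(m * 2) -> 'I_(m * 2) -> R) : R :=
  \sum_(s : 'S_(m * 2)) (-1) ^+ s * \prod_(i < m) A (s (ev i)) (s (od i)).

(** The Leibniz proof of [det (A B) = det A det B] carries over: expand over all index functions [h]
    and sum over [s] first. Injective [h] give signed copies of [\det L], the others a determinant
    with two equal rows. *)
Lemma pf_congr m (L A : 'M[R]_(m * 2)) :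
  pf (fun x y => (L *m A *m L^T) x y) = \det L * pf (fun x y => A x y).
Proof.
set N := (m * 2)%N.
have E x y : (L *m A *m L^T) x y =
    \sum_(p : 'I_N * 'I_N) L x p.1 * L y p.2 * A p.1 p.2.
  rewrite -(pair_bigA _ (fun k l => L x k * L y l * A k l)) /= exchange_big mxE.
  apply: eq_bigr => l _; rewrite !mxE mulr_suml; apply: eq_bigr => k _.
  by rewrite [in RHS]mulrAC.
transitivity (\sum_(h : {ffun 'I_N -> 'I_N}) \sum_(s : 'S_N)
   (-1) ^+ s * (\prod_x L (s x) (h x) * \prod_(i < m) A (h (ev i)) (h (od i)))).
  rewrite exchange_big; apply: eq_bigr => s _; rewrite -big_distrr /=.
  congr (_ * _); under eq_bigr do rewrite E.
  rewrite (bigA_distr_bigA (fun i (p : 'I_N * 'I_N) =>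
     L (s (ev i)) p.1 * L (s (od i)) p.2 * A p.1 p.2)).
  (* Choosing a pair of indices for every block amounts to choosing one function on all [m * 2]
     indices. *)
  rewrite (reindex (fun h : {ffun 'I_N -> 'I_N} => [ffun i => (h (ev i), h (od i))])).
    apply: eq_bigr => h _; rewrite big_blocks /= -big_split /=.
    by apply: eq_bigr => i _; rewrite ffunE.
  exists (fun f : {ffun 'I_m -> 'I_N * 'I_N} =>
    [ffun x : 'I_N => if odd x then (f (blk x)).2 else (f (blk x)).1]) => [h _|f _].
    apply/ffunP => x; rewrite !ffunE /=; case: ifP => ox.
      by rewrite od_blk.
    by rewrite ev_blk.
  apply/ffunP => i; rewrite !ffunE odd_ev odd_od blk_ev blk_od.
  by case: (f i).
have D (h : {ffun 'I_N -> 'I_N}) :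
    \sum_(s : 'S_N) (-1) ^+ s * \prod_x L (s x) (h x) =
    \det (\matrix_(x, y) L y (h x)).
  apply: eq_bigr => s _; congr (_ * _); apply: eq_bigr => x _; by rewrite mxE.
under eq_bigr => h _ do under eq_bigr do rewrite mulrA.
under eq_bigr => h _ do rewrite -mulr_suml D.
rewrite (bigID (fun f : {ffun 'I_N -> 'I_N} => injectiveb f)) /= addrC big1 ?add0r.
  rewrite (reindex (@pval _)) /=; last first.
    pose in_Sn := insubd (1%g : 'S_N).
    by exists in_Sn => /= f Uf; first apply: val_inj; apply: insubdK.
  rewrite /pf mulr_sumr; apply: eq_big => /= [s | s _]; rewrite ?(valP s)//.
  rewrite mulrA; congr (_ * _); last first.
    by apply: eq_bigr => i _; rewrite !pvalE.
  have -> : (\matrix_(x, y) L y (pval s x)) = row_perm s L^T.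
    by apply/matrixP => x y; rewrite !mxE pvalE.
  by rewrite row_permE det_mulmx det_perm det_tr mulrC.
move=> f /injectivePn[x [y xy fxy]].
by rewrite (determinant_alternate xy) ?mul0r// => j; rewrite !mxE fxy.
Qed.

End Pfaffian.

(** * Signs of permutations that preserve the pairing *)

Section BlockPermutations.
Variable m : nat.

Lemma ev_inj : injective (@ev m).
Proof. by move=> i j /(congr1 (@blk m)); rewrite !blk_ev. Qed.

Lemma od_inj : injective (@od m).
Proof. by move=> i j /(congr1 (@blk m)); rewrite !blk_od. Qed.

Lemma ev_od i j : ev i != od j :> 'I_(m * 2).
Proof.
by apply/eqP => /(congr1 (fun x : 'I_(m * 2) => odd x)); rewrite odd_ev odd_od.
Qed.

(** A transposition of two blocks is a product of two transpositions of indices. *)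
Lemma block_perm_even (p : 'S_m) : exists2 s : 'S_(m * 2), odd_perm s = false &
  forall i, s (ev i) = ev (p i) /\ s (od i) = od (p i).
Proof.
have [ts -> _] := prod_tpermP p.
elim: ts => [|t ts [s s0 sE]].
  by exists 1%g; rewrite ?odd_perm1// => i; rewrite big_nil !perm1.
exists (tperm (ev t.1) (ev t.2) * tperm (od t.1) (od t.2) * s)%g.
  rewrite !odd_permM s0 !odd_tperm (inj_eq ev_inj) (inj_eq od_inj) addbF.
  by rewrite addbb.
move=> i; rewrite big_cons !permM.
have -> : tperm (od t.1) (od t.2) (tperm (ev t.1) (ev t.2) (ev i)) =
    ev (tperm t.1 t.2 i).
  rewrite -(inj_tperm _ _ _ ev_inj) tpermD// eq_sym; exact: ev_od.
have -> : tperm (ev t.1) (ev t.2) (od i) = od i.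
  by rewrite tpermD//; exact: ev_od.
by rewrite -(inj_tperm _ _ _ od_inj).
Qed.

Lemma flip_perm_sign (b : 'I_m -> bool) : exists2 s : 'S_(m * 2),
  (forall (T : pzRingType), (-1) ^+ s = \prod_(i < m) (-1) ^+ b i :> T) &
  forall i, s (ev i) = (if b i then od i else ev i) /\
            s (od i) = (if b i then ev i else od i).
Proof.
have H : forall r : seq 'I_m, uniq r -> exists2 s : 'S_(m * 2),
    (forall (T : pzRingType), (-1) ^+ s = \prod_(i <- r) (-1) ^+ b i :> T) &
    forall i, s (ev i) = (if (i \in r) && b i then od i else ev i) /\
              s (od i) = (if (i \in r) && b i then ev i else od i).
  elim => [_|j r IH /= /andP[jr /IH[s sS sE]]].
    exists 1%g => [T|i]; first by rewrite odd_perm1 big_nil.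
    by rewrite !perm1.
  case bj : (b j); last first.
    exists s => [T|i]; first by rewrite big_cons bj mul1r sS.
    rewrite inE; case: eqVneq => [->|_] /=; last exact: sE.
    by rewrite bj; have := sE j; rewrite (negPf jr).
  exists (tperm (ev j) (od j) * s)%g => [T|i].
    by rewrite odd_permM odd_tperm ev_od signr_addb sS big_cons bj.
  rewrite inE !permM; case: eqVneq => [->|ij] /=.
    have := sE j; rewrite (negPf jr) bj /= tpermL tpermR => -[-> ->].
    by [].
  have h1 : od j != ev i by rewrite eq_sym ev_od.
  have h2 : j != i by rewrite eq_sym.
  by rewrite !tpermD ?(inj_eq ev_inj) ?(inj_eq od_inj) ?ev_od.
have [s sS sE] := H (index_enum _) (index_enum_uniq _).
exists s => // i; have := sE i; rewrite mem_index_enum; exact.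
Qed.

(** Such an [s] first flips some blocks and then permutes whole blocks. The second factor is even,
    so the sign counts the blocks whose image is reversed, that is, those with [s (ev i)] odd. *)
Lemma block_perm_sign (T : pzRingType) (s : 'S_(m * 2)) :
  (forall i, s (od i) = flip (s (ev i))) ->
  (-1) ^+ s = \prod_(i < m) (-1) ^+ odd (s (ev i)) :> T.
Proof.
move=> sF.
pose p0 i := blk (s (ev i)).
have p0_inj : injective p0.
  move=> i j pij.
  have [e|o] := eqVneq (s (ev i)) (s (ev j)).
    exact/ev_inj/perm_inj/e.
  case/negP: o; suff : s (ev i) != s (od j).
    rewrite sF /flip; move: pij; rewrite /p0.
    case oi : (odd (s (ev i))); case oj : (odd (s (ev j))) => pij.
    - by rewrite -(od_blk oi) -(od_blk oj) pij eqxx.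
    - by rewrite -(od_blk oi) pij eqxx.
    - by rewrite -(ev_blk oi) pij eqxx.
    - by rewrite -(ev_blk oi) -(ev_blk oj) pij eqxx.
  by rewrite (inj_eq perm_inj) ev_od.
have [f fS fE] := flip_perm_sign (fun i => odd (s (ev i))).
have [t t0 tE] := block_perm_even (perm p0_inj).
have -> : s = (f * t)%g.
  apply/permP => x; rewrite permM.
  have [e o] : s (ev (blk x)) = t (f (ev (blk x))) /\
      s (od (blk x)) = t (f (od (blk x))).
    have [fe fo] := fE (blk x); have [te to] := tE (blk x).
    rewrite fe fo sF /flip; case: ifP => ox.
      by rewrite te to permE /p0 (od_blk ox).
    by rewrite te to permE /p0 (ev_blk ox).
  case ox : (odd x); first by rewrite -(od_blk ox).
  by rewrite -(ev_blk ox).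
rewrite odd_permM t0 addbF fS; apply: eq_bigr => i _; rewrite permM.
have [fe _] := fE i; rewrite fe; have [te to] := tE i.
by case: ifP => oi; rewrite ?te ?to ?odd_ev ?odd_od.
Qed.

End BlockPermutations.

Section StandardForm.
Variables (R : numDomainType) (m : nat).

(** The block-diagonal antisymmetric matrix with [d i] above and [- d i] below the diagonal of block
    [i]. *)
Definition block_form (d : 'I_m -> R) (x y : 'I_(m * 2)) : R :=
  if y == flip x then d (blk x) * (-1) ^+ odd x else 0.

(** The identity contributes the product of the [d i]. Another permutation contributes only if it
    preserves the pairing, and then its sign cancels the signs from the reversed blocks. *)
Lemma pf_block_form_gt0 (d : 'I_m -> R) : (forall i, 0 < d i) ->
  0 < pf (block_form d).
Proof.
move=> d0; rewrite /pf (bigD1 1%g) //= odd_perm1 expr0 mul1r.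
rewrite ltr_pwDl//.
  apply: prodr_gt0 => i _; rewrite !perm1 /block_form flip_ev eqxx blk_ev odd_ev.
  by rewrite mulr1.
apply: sumr_ge0 => s _.
case: (boolP [forall i, s (od i) == flip (s (ev i))]) => [/forallP sF|].
  rewrite (block_perm_sign R (fun i => eqP (sF i))) -big_split /=.
  apply: prodr_ge0 => i _; rewrite /block_form sF mulrCA -expr2 sqrr_sign mulr1.
  exact: ltW.
rewrite negb_forall => /existsP[i /negPf si].
by rewrite (bigD1 i) //= /block_form si mul0r mulr0.
Qed.

End StandardForm.

(** * Wedge powers of a 2-form as Pfaffian sums *)

Section WedgePower.
Context {R : realType} {n : nat}.

(** In the inductive step [wedge] contributes the inverse of [2! N!] and the induction hypothesis
    that of [2 ^ m]; the inner permutations are absorbed by the outer sum and give back [N!], which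
    leaves the inverse of [2 ^ m.+1]. *)
Lemma wedge_powE (a : mform R n 2) m (v : 'I_(m * 2) -> TC R n) :
  wedge_pow a m v = ((2 ^ m)%N%:R)^-1 *
    pf (fun x y => a (fun i => if i == 0 then v x else v y)).
Proof.
elim: m v => [|m IH] v.
  rewrite /= /pf expn0 invr1 mul1r (bigD1 1%g) //= odd_perm1 big_ord0 mulr1.
  rewrite big1 ?addr0// => s; case/eqP; apply/permP => -[x hx]; exfalso.
  by move: hx; rewrite mul0n.
set N := (m * 2)%N; pose G x y := a (fun i => if i == 0 then v x else v y).
pose l0 : 'I_(2 + N) := lshift N 0; pose l1 : 'I_(2 + N) := lshift N 1.
pose H (s : 'S_(2 + N)) : R[i] := (-1) ^+ s * (G (s l0) (s l1) *
  \prod_(i < m) G (s (rshift 2 (ev i))) (s (rshift 2 (od i)))).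
have pfE : pf (m := m.+1) G = \sum_(s : 'S_(2 + N)) H s.
  apply: eq_bigr => s _; congr (_ * _); rewrite big_ord_recl.
  congr (G (s _) (s _) * _); try exact: val_inj.
  by apply: eq_bigr => i _; congr (G (s _) (s _)); exact: val_inj.
(* A permutation [t] of the last [N] slots extends to [t'] fixing the first two, and translation of
   the summation variable by [t'] makes the sum independent of [t]. *)
have HE (t : 'S_N) :
    \sum_(s : 'S_(2 + N)) (-1) ^+ t * ((-1) ^+ s * (G (s l0) (s l1) *
    \prod_(i < m) G (s (rshift 2 (t (ev i)))) (s (rshift 2 (t (od i)))))) =
    \sum_(s : 'S_(2 + N)) H s.
  pose t' : 'S_(2 + N) := lift_perm ord0 ord0 (lift_perm ord0 ord0 t).
  have t'0 : t' l0 = l0.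
    rewrite /t' (_ : l0 = ord0); last exact: val_inj.
    exact: lift_perm_id.
  have t'1 : t' l1 = l1.
    rewrite /t' (_ : l1 = lift ord0 ord0); last exact: val_inj.
    by rewrite lift_perm_lift lift_perm_id.
  have t'2 (x : 'I_N) : t' (rshift 2 x) = rshift 2 (t x).
    rewrite /t' (_ : rshift 2 x = lift ord0 (lift ord0 x)); last exact: val_inj.
    by rewrite !lift_perm_lift; exact: val_inj.
  rewrite [RHS](reindex_inj (mulgI t')); apply: eq_bigr => s _.
  rewrite /H !permM t'0 t'1 odd_permM !odd_lift_perm /= signr_addb mulrA.
  congr (_ * (_ * _)); apply: eq_bigr => i _.
  by rewrite !permM !t'2.
rewrite [LHS]/= /wedge -[pf _]/(pf (m := m.+1) G) pfE.
set X := \sum_(s : 'S_(2 + N)) H s.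
have -> : \sum_(s : 'S_(2 + N)) (-1) ^+ s * a (fun i => v (s (lshift N i))) *
    wedge_pow a m (fun j => v (s (rshift 2 j))) =
    ((2 ^ m)%N%:R)^-1 * ((N`!)%:R * X).
  have -> : (N`!)%:R * X = \sum_(t : 'S_N) X.
    by rewrite sumr_const card_Sn mulr_natl.
  rewrite -[in RHS](eq_bigr _ (fun t _ => HE t)).
  rewrite exchange_big mulr_sumr; apply: eq_bigr => s _.
  rewrite IH mulrCA; congr (_ * _); rewrite /pf mulr_sumr; apply: eq_bigr => t _.
  rewrite mulrCA; congr (_ * _); rewrite -mulrA; congr (_ * (_ * _)).
  by rewrite [in LHS](pair2_eta (fun i => _)).
have n2 : (2 ^ m)%N%:R != 0 :> R[i] by rewrite pnatr_eq0 -lt0n expn_gt0.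
have nN : (N`!)%:R != 0 :> R[i] by rewrite pnatr_eq0 -lt0n fact_gt0.
rewrite -/N (_ : 2`! = 2)// expnS !natrM.
move: (N`!%:R) ((2 ^ m)%N%:R) X n2 nN => p q X n2 nN; field.
by rewrite n2 nN.
Qed.

End WedgePower.

(** * Normal form of a tamed antisymmetric matrix *)

Section SymplecticGramSchmidt.
Variable R : realFieldType.

(** The complex structure acting on coordinate rows from the right, as [comb_J] confirms. *)
Definition Jmx m : 'M[R]_(m * 2) := \matrix_(x, y) block_form (fun=> 1) x y.

Lemma flip_rshift m (x : 'I_(m * 2)) :
  @flip m.+1 (rshift 2 x) = rshift 2 (flip x).
Proof.
rewrite /flip (_ : odd (rshift 2 x) = odd x); last by rewrite /= negbK.
by case: (odd x); apply: val_inj.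
Qed.

Lemma block_form_recl m (d : 'I_m.+1 -> R) :
  \matrix_(x, y) block_form d x y =
  block_mx (d ord0 *: Jmx 1) 0 0
    (\matrix_(x, y) block_form (fun i => d (lift ord0 i)) x y) :> 'M[R]_(2 + m * 2).
Proof.
have blk_l (i : 'I_2) : blk (lshift (m * 2) i : 'I_(m.+1 * 2)) = ord0.
  by apply: val_inj => /=; case: i => -[|[|]].
have flip_l (i : 'I_2) : @flip m.+1 (lshift (m * 2) i) = lshift (m * 2) (@flip 1 i).
  by apply: val_inj; case: i => -[|[|]].
apply/matrixP => x y.
case: (fintype.splitP x) => [i xi|i xi]; case: (fintype.splitP y) => [j yj|j yj].
- rewrite (_ : x = lshift _ i); last exact: val_inj.
  rewrite (_ : y = lshift _ j); last exact: val_inj.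
  rewrite block_mxEul !mxE /block_form blk_l flip_l -!val_eqE /=.
  by case: eqP => _; rewrite ?mulr0// mul1r.
- rewrite (_ : x = lshift _ i); last exact: val_inj.
  rewrite (_ : y = rshift _ j); last exact: val_inj.
  rewrite block_mxEur !mxE /block_form flip_l -val_eqE /= gtn_eqF//.
  exact: ltn_addr (ltn_ord _).
- rewrite (_ : x = rshift _ i); last exact: val_inj.
  rewrite (_ : y = lshift _ j); last exact: val_inj.
  rewrite block_mxEdl !mxE /block_form flip_rshift -val_eqE /= ltn_eqF//.
  exact: ltn_addr (ltn_ord _).
- rewrite (_ : x = rshift _ i); last exact: val_inj.
  rewrite (_ : y = rshift _ j); last exact: val_inj.
  rewrite block_mxEdr !mxE /block_form flip_rshift -!val_eqE /= eqn_add2l.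
  rewrite (_ : blk (rshift 2 i : 'I_(m.+1 * 2)) = lift ord0 (blk i)); last exact: val_inj.
  by rewrite /= negbK.
Qed.

Lemma JmxS m : Jmx m.+1 = block_mx (Jmx 1) 0 0 (Jmx m) :> 'M[R]_(2 + m * 2).
Proof. by rewrite /Jmx block_form_recl scale1r. Qed.

Lemma Jmx1_sqr : Jmx 1 *m Jmx 1 = - 1%:M.
Proof.
apply/matrixP => i j; rewrite !mxE big_ord_recl big_ord_recl big_ord0 addr0.
rewrite !mxE /block_form.
by case: i => -[|[|//]] hi; case: j => -[|[|//]] hj;
  rewrite -!val_eqE /= ?expr0 ?expr1 ?mulr0 ?mul0r ?addr0 ?add0r ?mulr1 ?mul1r
    ?oppr0 ?mulN1r.
Qed.

Lemma antisym2 (a : 'M[R]_(1 * 2)) : a^T = - a ->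
  a = a (@ev 1 ord0) (@od 1 ord0) *: Jmx 1.
Proof.
move=> aT.
have aE i j : a j i = - a i j by move/matrixP: aT => /(_ i j); rewrite !mxE.
have a0 i : a i i = 0.
  by have := aE i i; move/eqP; rewrite -addr_eq0 -mulr2n mulrn_eq0 => /eqP.
apply/matrixP => i j; rewrite !mxE /block_form.
have C (x : 'I_(1 * 2)) : x = ev ord0 \/ x = od ord0.
  by case: x => -[|[|//]] hx; [left|right]; exact: val_inj.
case: (C i) => ->; case: (C j) => ->.
- by rewrite a0 flip_ev (negPf (ev_od _ _)) mulr0.
- by rewrite flip_ev eqxx odd_ev !mulr1.
- by rewrite flip_od eqxx odd_od mul1r expr1 mulrN1; exact: aE.
- by rewrite a0 flip_od eq_sym (negPf (ev_od _ _)) mulr0.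
Qed.

(** Block elimination, two indices at a time: the leading block is a multiple [d0] of J, taming
    makes [d0] positive, and the Schur complement is again antisymmetric and tamed. Only block
    unipotent matrices are used, whence determinant 1 and an unchanged Pfaffian. *)
Lemma symplectic_gram_schmidt m (A : 'M[R]_(m * 2)) : A^T = - A ->
  (forall x : 'rV_(m * 2), x != 0 -> 0 < (x *m A *m (x *m Jmx m)^T) 0 0) ->
  exists (L : 'M[R]_(m * 2)) (d : 'I_m -> R),
    [/\ \det L = 1, forall i, 0 < d i &
        L *m A *m L^T = \matrix_(x, y) block_form d x y].
Proof.
elim: m A => [|m IH] A AT tA.
  exists 1%:M, (fun=> 1); split=> [|i|]; rewrite ?det1 ?ltr01//.
  by apply/matrixP => -[].
pose N := (m * 2)%N.
have {}AT : (A : 'M[R]_(2 + N))^T = - A := AT.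
have {}tA (x : 'rV_(2 + N)) : x != 0 ->
  0 < (x *m (A : 'M[R]_(2 + N)) *m (x *m (Jmx m.+1 : 'M[R]_(2 + N)))^T) 0 0 := tA x.
rewrite JmxS in tA.
suff [L [d [dL d0 E]]] : exists (L : 'M[R]_(2 + N)) (d : 'I_m.+1 -> R),
    [/\ \det L = 1, forall i, 0 < d i &
      L *m A *m L^T = block_mx (d ord0 *: Jmx 1) 0 0
       (\matrix_(x, y) block_form (fun i => d (lift ord0 i)) x y)].
  by exists L, d; split=> //; rewrite block_form_recl.
rewrite -[A : 'M[R]_(2 + N)]submxK in AT tA *.
move: (ulsubmx (A : 'M[R]_(2 + N))) (ursubmx (A : 'M[R]_(2 + N)))
  (dlsubmx (A : 'M[R]_(2 + N))) (drsubmx (A : 'M[R]_(2 + N))) AT tA => a b c D AT tA.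
have [aT cT bT DT] : [/\ a^T = - a, c^T = - b, b^T = - c & D^T = - D].
  have : (block_mx a b c D)^T = - block_mx a b c D := AT.
  by rewrite tr_block_mx opp_block_mx => /eq_block_mx[].
have aE := antisym2 aT; set d0 := a _ _ in aE.
have d0_gt0 : 0 < d0.
  (* Taming at the first basis vector pairs it with its image under J, the second basis vector, so
     the value is [d0] itself. *)
  have /tA : row_mx (delta_mx 0 (@ev 1 ord0)) (0 : 'rV[R]_N) != 0.
    apply/eqP => /matrixP/(_ 0 (lshift N (@ev 1 ord0))); rewrite row_mxEl !mxE !eqxx.
    by move/eqP; rewrite oner_eq0.
  rewrite !mul_row_block !mul0mx !mulmx0 !addr0 tr_row_mx mul_row_col trmx0.
  rewrite mulmx0 addr0 -!rowE.
  suff -> : (row (@ev 1 ord0) a *m (row (@ev 1 ord0) (Jmx 1))^T) 0 0 = d0 by [].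
  rewrite mxE (bigD1 (@od 1 ord0)) //= big1.
    by rewrite !mxE /block_form flip_ev eqxx odd_ev !mulr1 addr0.
  by move=> j jo; rewrite !mxE /block_form flip_ev (negPf jo) mulr0.
have d0n0 : d0 != 0 by rewrite gt_eqF.
(* This is [- c a^-1]: since [a] is [d0] times J and J squares to -1, the inverse of [a] is
   [- d0^-1] times J. *)
pose K := d0^-1 *: (c *m Jmx 1).
have Ka : K *m a = - c.
  rewrite aE /K -scalemxAl -scalemxAr scalerA mulVf// scale1r -mulmxA Jmx1_sqr.
  by rewrite mulmxN mulmx1.
have aK : a *m K^T = - b.
  have aTE : a = - a^T by rewrite aT opprK.
  by rewrite {1}aTE mulNmx -trmx_mul Ka linearN /= cT !opprK.
pose L : 'M[R]_(2 + N) := block_mx 1%:M 0 K 1%:M.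
pose S := K *m b + D.
have LA : L *m block_mx a b c D = block_mx a b 0 S.
  by rewrite mulmx_block !mul1mx !mul0mx !addr0 Ka addNr.
have LAL : L *m block_mx a b c D *m L^T = block_mx a 0 0 S.
  rewrite LA tr_block_mx mulmx_block !trmx1 trmx0 !mulmx1 !mulmx0 !mul0mx.
  by rewrite !addr0 !add0r aK addNr.
have ST : S^T = - S.
  have : (block_mx a 0 0 S)^T = - block_mx a 0 0 S.
    rewrite -LAL !trmx_mul trmxK mulmxA tr_block_mx aT cT bT DT -opp_block_mx.
    by rewrite mulmxN mulNmx.
  by rewrite tr_block_mx opp_block_mx => /eq_block_mx[].
(* [(0, y) *m L *m J] and [(0, y *m J) *m L] differ by a vector of the first block,
   which is [J]-invariant and orthogonal to [(0, y) *m L]. *)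
have tS (y : 'rV_N) : y != 0 -> 0 < (y *m S *m (y *m Jmx m)^T) 0 0.
  move=> y0; have /tA : row_mx (y *m K) y != 0.
    apply: contra_neq y0 => /(congr1 rsubmx); rewrite row_mxKr => ->.
    by apply/rowP => i; rewrite !mxE.
  have -> : row_mx (y *m K) y = row_mx 0 y *m L.
    by rewrite mul_row_block !mul0mx mulmx1 !add0r.
  rewrite -[row_mx 0 y *m L *m block_mx a b c D]mulmxA LA -mulmxA.
  rewrite mul_row_block !mul0mx mulmx0 !add0r !mul_row_block !mul0mx !mulmx0 !mulmx1.
  by rewrite !add0r !addr0 tr_row_mx mul_row_col mul0mx add0r !mulmxA.
have [L' [d' [dL' d'0 E']]] := IH S ST tS.
exists (block_mx 1%:M 0 0 L' *m L).
exists (fun i => if unlift ord0 i is Some j then d' j else d0).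
split.
- by rewrite det_mulmx !det_lblock !det1 dL' !mul1r.
- by move=> i; case: unliftP => [j _|_].
rewrite unlift_none trmx_mul !mulmxA -[_ *m L *m _]mulmxA.
rewrite -[_ *m (L *m _) *m _]mulmxA LAL.
rewrite tr_block_mx !mulmx_block !trmx1 !trmx0 !mulmx1 !mulmx0 !mul1mx !mul0mx.
rewrite !addr0 !add0r -aE E' mul0mx; congr block_mx; apply/matrixP => x y.
by rewrite !mxE /block_form liftK.
Qed.

End SymplecticGramSchmidt.

(** * Positivity of the top power of a tamed 2-form at a point *)

Section TamedPositivity.
Context {R : realType} {n : nat}.
Implicit Types (u w : TC R n).

Definition form2 (a : mform R n 2) u w : R[i] := a (fun i => if i == 0 then u else w).

Variable a : mform R n 2.
Hypotheses (ml : multilinear a) (alt : Defs.alternating a).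

Lemma form2_linearl (c : R[i]) u u' w :
  form2 a (c *: u + u') w = c * form2 a u w + form2 a u' w.
Proof.
have := ml (fun i => if i == 0 then u else w) 0 c u u'.
rewrite /form2; congr (_ = _ * _ + _); congr a; apply/funext => i /=;
  by case: (i == 0).
Qed.

Lemma form2_linearr (c : R[i]) u u' w :
  form2 a w (c *: u + u') = c * form2 a w u + form2 a w u'.
Proof.
have := ml (fun i => if i == 0 then w else u) 1 c u u'.
rewrite /form2; congr (_ = _ * _ + _); congr a; apply/funext => i /=;
  by case: i => -[|[|//]] ?.
Qed.

Lemma form2_diag u : form2 a u u = 0.
Proof. by rewrite /form2; apply: (alt (i := 0) (j := 1)). Qed.

Lemma form2_0l w : form2 a 0 w = 0.
Proof.
by have := form2_linearl (-1) 0 0 w; rewrite scaler0 addr0 mulN1r addNr.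
Qed.

Lemma form2_0r w : form2 a w 0 = 0.
Proof.
by have := form2_linearr (-1) 0 0 w; rewrite scaler0 addr0 mulN1r addNr.
Qed.

Lemma form2_Zr (c : R[i]) u w : form2 a w (c *: u) = c * form2 a w u.
Proof. by have := form2_linearr c u 0 w; rewrite form2_0r !addr0. Qed.

Lemma form2_anti u w : form2 a w u = - form2 a u w.
Proof.
have := form2_diag (1 *: u + w).
rewrite form2_linearl !form2_linearr !form2_diag mulr0 add0r addr0 !mul1r.
by move/eqP; rewrite addrC addr_eq0 => /eqP.
Qed.

Lemma form2_suml I (r : seq I) (x : I -> R[i]) (f : I -> TC R n) w :
  form2 a (\sum_(k <- r) x k *: f k) w = \sum_(k <- r) x k * form2 a (f k) w.
Proof.
elim: r => [|k r IH]; first by rewrite !big_nil form2_0l.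
by rewrite !big_cons form2_linearl IH.
Qed.

Lemma form2_sumr I (r : seq I) (x : I -> R[i]) (f : I -> TC R n) w :
  form2 a w (\sum_(k <- r) x k *: f k) = \sum_(k <- r) x k * form2 a w (f k).
Proof.
elim: r => [|k r IH]; first by rewrite !big_nil form2_0r.
by rewrite !big_cons form2_linearr IH.
Qed.

(** The two parts of [cplx_J u] are multiples of the corresponding parts of [u], so the (2,0)- and
    (0,2)-contributions are values of an alternating form on proportional vectors. Positivity of the
    (1,1)-part thus becomes taming of the whole form. *)
Lemma form2_J u : form2 a u (cplx_J u) =
  form2 (bidegree 1 a) u (cplx_J u).
Proof.
rewrite [RHS]bidegree1E /= -!/(form2 a _ _).
have {1}-> : u = 1 *: hol_part u + antihol_part u.
  rewrite scale1r; case: u => p q.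
  by rewrite /hol_part /antihol_part /=; congr pair; rewrite ?addr0 ?add0r.
have h : hol_part (cplx_J u) = 'i *: hol_part u.
  by congr (_, _); rewrite /= scaler0.
have t : antihol_part (cplx_J u) = (- 'i) *: antihol_part u.
  by congr (_, _); rewrite /= scaler0.
rewrite h t !form2_Zr.
have -> : cplx_J u = 'i *: hol_part u + - 'i *: antihol_part u.
  rewrite -h -t /cplx_J /hol_part /antihol_part /=.
  by congr pair; rewrite ?addr0 ?add0r.
rewrite form2_linearl !form2_linearr !form2_Zr !form2_diag.
by rewrite !mulr0 addr0 add0r !mul1r.
Qed.

Hypothesis rl : real_mform a.
Hypothesis pos : positive_mform (bidegree 1 a).

Lemma real_frame_real x : conj_vec (real_frame x) = real_frame x :> TC R n.
Proof.
rewrite /real_frame; set e := \row_j _.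
have eJ : map_mx conjc e = e.
  by apply/rowP => j; rewrite !mxE conjc_nat.
have cZ (c : R[i]) : map_mx conjc (c *: e) = c^*%C *: e.
  by rewrite -[in RHS]eJ; apply/rowP => j; rewrite !mxE conjcM.
case: ifP => _; rewrite /cplx_J /real_vec /conj_vec /= !eJ// !cZ.
by congr (_ *: _, _ *: _); apply: complex_eqP; rewrite /= ?oppr0 ?opprK.
Qed.

(** Taking real parts loses nothing, since a real form has real values on the real frame ([gramE]);
    it moves the linear algebra to an ordered field. *)
Definition gram : 'M[R]_(n * 2) :=
  \matrix_(x, y) complex.Re (form2 a (real_frame x) (real_frame y)).

Lemma gramE x y : form2 a (real_frame x) (real_frame y) = (gram x y)%:C.
Proof.
rewrite mxE.
have E : (form2 a (real_frame x) (real_frame y))^* =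
    form2 a (real_frame x) (real_frame y).
  rewrite /form2 -rl; congr a; apply/funext => i.
  by case: ifP => _; exact: real_frame_real.
case: (form2 a _ _) E => p q [/eqP].
by rewrite eq_sym -addr_eq0 -mulr2n mulrn_eq0 => /eqP ->.
Qed.

Lemma gram_antisym : gram^T = - gram.
Proof.
apply/matrixP => x y; rewrite [LHS]mxE [RHS]mxE; apply: complexI.
by rewrite rmorphN /= -!gramE form2_anti.
Qed.

Definition comb (x : 'rV[R]_(n * 2)) : TC R n :=
  \sum_k (x 0 k)%:C *: real_frame k.

Lemma form2_comb x y : form2 a (comb x) (comb y) = ((x *m gram *m y^T) 0 0)%:C.
Proof.
rewrite form2_suml mxE; under eq_bigr do rewrite form2_sumr mulr_sumr.
under [in RHS]eq_bigr do rewrite !mxE mulr_suml.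
rewrite exchange_big rmorph_sum; apply: eq_bigr => l _.
rewrite rmorph_sum; apply: eq_bigr => k _ /=.
by rewrite gramE !rmorphM /= mulrA mulrAC.
Qed.

Lemma comb_blocks x : comb x = \sum_(j < n)
  ((x 0 (ev j))%:C *: real_frame (ev j) + (x 0 (od j))%:C *: real_frame (od j)).
Proof. exact: big_blocks. Qed.

Lemma frame_od j : real_frame (od j) = cplx_J (real_frame (ev j)) :> TC R n.
Proof.
rewrite /real_frame odd_od odd_ev; congr (cplx_J (real_vec _)).
by apply/rowP => i; rewrite !mxE /= muln2 uphalf_double doubleK.
Qed.

Lemma cplx_JD u w : cplx_J (u + w) = cplx_J u + cplx_J w.
Proof. by rewrite /cplx_J /= !scalerDr. Qed.

Lemma cplx_JZ (c : R[i]) u : cplx_J (c *: u) = c *: cplx_J u.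
Proof.
by apply: injective_projections; rewrite [LHS]scalerA mulrC -scalerA.
Qed.

Lemma cplx_JJ u : cplx_J (cplx_J u) = - u.
Proof.
have ii : 'i * 'i = -1 :> R[i] by rewrite -expr2 sqr_i.
by congr (_, _); rewrite /= scalerA ?mulrNN ii scaleN1r.
Qed.

Lemma comb_J x : comb (x *m Jmx R n) = cplx_J (comb x).
Proof.
have JE y : (x *m Jmx R n) 0 y = x 0 (flip y) * (-1) ^+ odd (flip y).
  rewrite mxE (bigD1 (flip y)) //= big1 ?addr0 => [|k ky].
    by rewrite mxE /block_form flipK eqxx mul1r.
  rewrite mxE /block_form ifF ?mulr0//; apply: contraNF ky => /eqP ->.
  by rewrite flipK.
have Jsum (G : 'I_n -> TC R n) :
    cplx_J (\sum_(j < n) G j) = \sum_(j < n) cplx_J (G j).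
  apply: (big_morph _ cplx_JD).
  by rewrite /cplx_J /= !scaler0.
rewrite !comb_blocks Jsum; apply: eq_bigr => j _.
rewrite !JE flip_ev flip_od odd_od odd_ev expr0 expr1 mulr1 mulrN1.
rewrite cplx_JD !cplx_JZ frame_od cplx_JJ rmorphN /= scaleNr scalerN.
by rewrite addrC.
Qed.

(** Identifies the real coordinates with the complex vector to which the positivity hypothesis
    applies, so that nonzero coordinates give a nonzero vector. *)
Lemma comb_real x : comb x = real_vec (\row_j (x 0 (ev j) +i* x 0 (od j))).
Proof.
pose u : 'rV[R[i]]_n := \row_j (x 0 (ev j) +i* x 0 (od j)).
have eE j : \row_(i < n) ((i : nat) == (ev j)./2)%:R = delta_mx 0 j :> 'rV[R[i]]_n.
  by apply/rowP => i; rewrite !mxE eqxx /= muln2 doubleK.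
have eJ j : map_mx conjc (delta_mx 0 j) = delta_mx 0 j :> 'rV[R[i]]_n.
  by apply/rowP => i; rewrite !mxE conjc_nat.
rewrite comb_blocks; apply: injective_projections.
- rewrite TC_fst_sum [RHS]row_sum_delta; apply: eq_bigr => j _.
  rewrite frame_od /real_frame odd_ev eE /= scalerA -scalerDl mxE; congr (_ *: _).
  by apply: complex_eqP; rewrite /=; ring.
- rewrite TC_snd_sum [RHS]row_sum_delta; apply: eq_bigr => j _.
  rewrite frame_od /real_frame odd_ev eE /= eJ scalerA -scalerDl 2!mxE; congr (_ *: _).
  by apply: complex_eqP; rewrite /=; ring.
Qed.

Lemma top_coef_gt0 : 0 < top_coef (wedge_pow a n).
Proof.
have [|L [d [dL d0 E]]] := symplectic_gram_schmidt gram_antisym.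
  (* The taming hypothesis on [gram] is the value of the form on [comb x] and its image under J,
     which [form2_J] reduces to the positive (1,1)-part. *)
  move=> x x0; rewrite -ltcR -form2_comb comb_J form2_J comb_real.
  apply: pos; apply: contra_neq x0 => /rowP u0; apply/rowP => k.
  have [ek ok] : x 0 (ev (blk k)) = 0 /\ x 0 (od (blk k)) = 0.
    by have := u0 (blk k); rewrite !mxE => -[].
  case ko : (odd k); first by rewrite -(od_blk ko) ok mxE.
  by rewrite -(ev_blk ko) ek mxE.
rewrite /top_coef wedge_powE mulr_gt0 ?invr_gt0 ?ltr0n ?expn_gt0//.
have -> : pf (fun x y => a (fun i => if i == 0 then real_frame x else real_frame y)) =
    (pf (fun x y => gram x y))%:C.
  rewrite /pf rmorph_sum; apply: eq_bigr => s _.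
  rewrite rmorphM rmorph_sign rmorph_prod; congr (_ * _).
  by apply: eq_bigr => i _; exact: gramE.
rewrite ltcR; have := pf_block_form_gt0 d0.
have := pf_congr L gram; rewrite dL mul1r => <-; rewrite E.
suff -> : pf (fun x y => (\matrix_(x0, y0) block_form d x0 y0) x y) =
    pf (block_form d) by [].
by congr pf; apply/funext => x; apply/funext => y; rewrite mxE.
Qed.

End TamedPositivity.

(** * Integration *)

Section IntegralBounds.
Context {R : realType}.
Local Notation mu := (@lebesgue_measure R).

(* No measurability is needed: the integral of a nonnegative function is a supremum
   over the simple functions below it. *)
Lemma ge0_le_integralT (f h : R -> \bar R) :
  (forall x, (0 <= f x)%E) -> (forall x, (f x <= h x)%E) ->
  (\int[mu]_x f x <= \int[mu]_x h x)%E.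
Proof.
move=> f0 fh; have h0 x : (0 <= h x)%E by exact: le_trans (f0 x) (fh x).
rewrite !ge0_integralTE//; apply: le_ereal_sup => _ [k kf <-].
by exists k => // x; exact: le_trans (kf x) (fh x).
Qed.

Lemma integral_step (a b c : R) : a <= b ->
  (\int[mu]_x ((cst c%:E) \_ `[a, b]) x = (c * (b - a))%:E)%E.
Proof.
move=> ab; rewrite -integral_mkcond integral_cst//= lebesgue_measure_itv /=.
rewrite lte_fin; move: ab; rewrite le_eqVlt => /predU1P[->|->].
  by rewrite ltxx mule0 subrr mulr0.
by rewrite -EFinB -EFinM.
Qed.

(** The finite upper bound protects later lower bounds: [fine] would send an infinite integral to
    0. *)
Lemma Rintegral_ge0_le (F : R -> R) (A C : R) : 0 <= A -> 0 <= C ->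
  (forall x, 0 <= F x <= C) -> (forall x, A < `|x| -> F x = 0) ->
  (0 <= \int[mu]_x (F x)%:E <= (C * (2 * A))%:E)%E.
Proof.
move=> A0 C0 FC F0; apply/andP; split.
  by apply: integral_ge0 => x _; rewrite lee_fin; have /andP[] := FC x.
have AA : - A <= A by rewrite (le_trans _ A0)// oppr_le0.
have -> : C * (2 * A) = C * (A - - A) by ring.
rewrite -(integral_step C AA); apply: ge0_le_integralT => x.
  by rewrite lee_fin; have /andP[] := FC x.
rewrite /patch; case: ifPn => [_|]; first by rewrite lee_fin; have /andP[] := FC x.
rewrite notin_setE /= in_itv /= -ler_norml => /negP; rewrite -ltNge => /F0 ->.
by [].
Qed.

Lemma Rintegral_lower (F : R -> R) (A C c s e : R) : 0 <= A -> 0 <= C ->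
  (forall x, 0 <= F x <= C) -> (forall x, A < `|x| -> F x = 0) ->
  0 <= s -> 0 <= e -> (forall x, `|x - c| <= s -> e <= F x) ->
  e * (2 * s) <= fine (\int[mu]_x (F x)%:E)%E.
Proof.
move=> A0 C0 FC F0 s0 e0 Fe.
have /andP[I0 IC] := Rintegral_ge0_le A0 C0 FC F0.
have If : (\int[mu]_x (F x)%:E)%E \is a fin_num.
  by rewrite ge0_fin_numE// (le_lt_trans IC)// ltry.
rewrite -lee_fin fineK//.
have ss : c - s <= c + s by rewrite lerD2l (le_trans _ s0)// oppr_le0.
have -> : e * (2 * s) = e * (c + s - (c - s)) by ring.
rewrite -(integral_step e ss); apply: ge0_le_integralT => x.
  by rewrite /patch; case: ifP => _; rewrite lee_fin.
rewrite /patch; case: ifPn => [|_]; last by rewrite lee_fin; have /andP[] := FC x.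
rewrite inE /= in_itv /= => /andP[x1 x2]; rewrite lee_fin; apply: Fe.
by rewrite ler_distl x1.
Qed.

Lemma row_mx_scalar m (x : R) (v : 'rV[R]_m) (i : 'I_(1 + m)) :
  (row_mx (x%:M : 'rV_1) v) 0 i =
    match fintype.split i with inl _ => x | inr j => v 0 j end.
Proof.
rewrite mxE; case: fintype.splitP => j _ //.
by rewrite ord1 mxE eqxx.
Qed.

(** Comparison with the constant [C] on the cube of side [2 * A], one variable at a time; every
    slice satisfies the same hypotheses. *)
Lemma integral_rV_bounds m (f : 'rV[R]_m -> R) (A C : R) : 0 <= A -> 0 <= C ->
  (forall v, 0 <= f v <= C) -> (forall (v : 'rV[R]_m) i, A < `|v 0 i| -> f v = 0) ->
  0 <= integral_rV f <= C * (2 * A) ^+ m.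
Proof.
move=> A0; elim: m f C => [|m IH] f C C0 fC f0.
  by rewrite /= expr0 mulr1.
pose F x := integral_rV (fun v : 'rV[R]_m => f (row_mx (x%:M : 'rV[R]_1) v)).
have tail x (v : 'rV_m) i : A < `|v 0 i| -> f (row_mx (x%:M : 'rV_1) v) = 0.
  move=> vi; apply: (f0 _ (rshift 1 i)).
  by rewrite row_mx_scalar (unsplitK (inr i)).
have Fb x : 0 <= F x <= C * (2 * A) ^+ m by apply: IH => //; exact: tail.
(* Such a slice is identically zero, so the induction hypothesis with constant 0 in place of [C]
   forces its integral to vanish. *)
have F0 x : A < `|x| -> F x = 0.
  move=> xA; apply/eqP; rewrite eq_le; suff : 0 <= F x <= 0 * (2 * A) ^+ m.
    by rewrite mul0r andbC.
  apply: IH => //; last exact: tail.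
  move=> v; rewrite (f0 _ (lshift m (0 : 'I_1))) ?lexx//.
  by rewrite row_mx_scalar (unsplitK (inl 0)).
have CA : 0 <= C * (2 * A) ^+ m by rewrite mulr_ge0// exprn_ge0// mulr_ge0.
have /andP[I0 IC] := Rintegral_ge0_le A0 CA Fb F0.
have If : (\int[mu]_x (F x)%:E)%E \is a fin_num.
  by rewrite ge0_fin_numE// (le_lt_trans IC)// ltry.
rewrite -[integral_rV f]/(fine (\int[mu]_x (F x)%:E)%E) fine_ge0//=.
by rewrite -lee_fin fineK// exprSr mulrA.
Qed.

Lemma integral_rV_lower m (f : 'rV[R]_m -> R) (A C s e : R) (c : 'rV[R]_m) :
  0 <= A -> 0 <= C ->
  (forall v, 0 <= f v <= C) -> (forall (v : 'rV[R]_m) i, A < `|v 0 i| -> f v = 0) ->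
  0 <= s -> 0 <= e ->
  (forall v : 'rV[R]_m, (forall i, `|v 0 i - c 0 i| <= s) -> e <= f v) ->
  e * (2 * s) ^+ m <= integral_rV f.
Proof.
move=> A0; elim: m f C c e => [|m IH] f C c e C0 fC f0 s0 e0 fe.
  by rewrite /= expr0 mulr1; apply: fe => -[].
pose F x := integral_rV (fun v : 'rV[R]_m => f (row_mx (x%:M : 'rV[R]_1) v)).
have tail x (v : 'rV_m) i : A < `|v 0 i| -> f (row_mx (x%:M : 'rV_1) v) = 0.
  move=> vi; apply: (f0 _ (rshift 1 i)).
  by rewrite row_mx_scalar (unsplitK (inr i)).
have Fb x : 0 <= F x <= C * (2 * A) ^+ m.
  by apply: integral_rV_bounds => //; exact: tail.
have F0 x : A < `|x| -> F x = 0.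
  move=> xA; apply/eqP; rewrite eq_le; suff : 0 <= F x <= 0 * (2 * A) ^+ m.
    by rewrite mul0r andbC.
  apply: integral_rV_bounds => //; last exact: tail.
  move=> v; rewrite (f0 _ (lshift m (0 : 'I_1))) ?lexx//.
  by rewrite row_mx_scalar (unsplitK (inl 0)).
have CA : 0 <= C * (2 * A) ^+ m by rewrite mulr_ge0// exprn_ge0// mulr_ge0.
have s20 : 0 <= 2 * s by rewrite mulr_ge0.
rewrite exprSr mulrA.
apply: (@Rintegral_lower F A (C * (2 * A) ^+ m) (c 0 ord0) s) => //.
  by rewrite mulr_ge0// exprn_ge0.
move=> x xc; apply: (IH _ C (\row_i c 0 (lift ord0 i))) => //; first exact: tail.
move=> v vc; apply: fe => i.
rewrite (row_mx_scalar x v i); case: fintype.splitP => j ij.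
  by rewrite (_ : i = ord0)//; apply: val_inj; rewrite /= ij ord1.
rewrite (_ : i = lift ord0 j); last by apply: val_inj; rewrite /= ij.
by have := vc j; rewrite mxE.
Qed.

Lemma integral_rV0 m : integral_rV (fun _ : 'rV[R]_m => 0 : R) = 0.
Proof.
have : 0 <= integral_rV (fun _ : 'rV[R]_m => 0 : R) <= 0 * (2 * 0) ^+ m.
  by apply: integral_rV_bounds => // v; rewrite lexx.
by rewrite mul0r => /andP[h1 h2]; apply/eqP; rewrite eq_le h1 h2.
Qed.

Variable n : nat.
Implicit Types (f : Cn R n -> R[i]) (h : Cn R n -> R).

Definition integral_Cn_real h : R :=
  integral_rV (fun x : 'rV[R]_n => integral_rV (fun y : 'rV[R]_n => h (x, y))).

Lemma integral_Cn_realE h : integral_Cn (fun z => (h z)%:C) = (integral_Cn_real h)%:C.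
Proof.
rewrite /integral_Cn /=; congr (_ +i* _).
by rewrite [X in integral_rV X](_ : _ = fun=> 0) ?integral_rV0//;
  apply/funext => x; rewrite integral_rV0.
Qed.

Lemma integral_Cn_bounds h (A C : R) : 0 <= A -> 0 <= C ->
  (forall z, 0 <= h z <= C) ->
  (forall (z : Cn R n) i, A < `|z.1 0 i| \/ A < `|z.2 0 i| -> h z = 0) ->
  0 <= integral_Cn_real h.
Proof.
move=> A0 C0 hC h0.
have CA : 0 <= C * (2 * A) ^+ n by rewrite mulr_ge0// exprn_ge0// mulr_ge0.
have inner x : 0 <= integral_rV (fun y : 'rV[R]_n => h (x, y)) <= C * (2 * A) ^+ n.
  by apply: integral_rV_bounds => // v i vi; apply: (h0 _ i); right.
suff /andP[] : 0 <= integral_Cn_real h <= C * (2 * A) ^+ n * (2 * A) ^+ n by [].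
apply: integral_rV_bounds => // v i vi; apply/eqP; rewrite eq_le.
suff : 0 <= integral_rV (fun y : 'rV[R]_n => h (v, y)) <= 0 * (2 * A) ^+ n.
  by rewrite mul0r andbC.
apply: integral_rV_bounds => // [y|y j yj]; rewrite (h0 _ i) ?lexx//; by left.
Qed.

(** The integrand dominates [e] on a cube of side [2 * s] in 2n real variables; the bounds [A] and
    [C] keep all iterated integrals finite. *)
Lemma integral_Cn_gt0 h (A C s e : R) (c : Cn R n) : 0 <= A -> 0 <= C ->
  (forall z, 0 <= h z <= C) ->
  (forall (z : Cn R n) i, A < `|z.1 0 i| \/ A < `|z.2 0 i| -> h z = 0) ->
  0 < s -> 0 < e ->
  (forall z : Cn R n,
     (forall i, `|z.1 0 i - c.1 0 i| <= s /\ `|z.2 0 i - c.2 0 i| <= s) ->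
     e <= h z) ->
  0 < integral_Cn_real h.
Proof.
move=> A0 C0 hC h0 s0 e0 he.
have CA : 0 <= C * (2 * A) ^+ n by rewrite mulr_ge0// exprn_ge0// mulr_ge0.
have inner x : 0 <= integral_rV (fun y : 'rV[R]_n => h (x, y)) <= C * (2 * A) ^+ n.
  by apply: integral_rV_bounds => // v i vi; apply: (h0 _ i); right.
have es : 0 < e * (2 * s) ^+ n by rewrite mulr_gt0// exprn_gt0// mulr_gt0.
apply: (@lt_le_trans _ _ (e * (2 * s) ^+ n * (2 * s) ^+ n)).
  by rewrite mulr_gt0// exprn_gt0// mulr_gt0.
apply: (@integral_rV_lower _ _ A (C * (2 * A) ^+ n) s _ c.1) => //.
- move=> v i vi; apply/eqP; rewrite eq_le.
  suff : 0 <= integral_rV (fun y : 'rV[R]_n => h (v, y)) <= 0 * (2 * A) ^+ n.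
    by rewrite mul0r andbC.
  by apply: integral_rV_bounds => // [y|y j yj]; rewrite (h0 _ i) ?lexx//; left.
- exact: ltW.
- exact: ltW.
move=> x xc; apply: (@integral_rV_lower _ _ A C s _ c.2) => //; try exact: ltW.
  by move=> v i vi; apply: (h0 _ i); right.
by move=> y yc; apply: he => i; split; [exact: xc|exact: yc].
Qed.

End IntegralBounds.

(** * Positivity of the integral over a compact manifold *)

Section Positivity.
Context {R : realType} {n : nat} (M : complexManifold R n).
Hypothesis compactM : compact [set: M].
Variable eta : local_forms M 2.
Hypotheses (formE : is_form eta) (realE : real_form eta).
Hypothesis posE : forall c z, chart_image c z -> positive_mform (bidegree 1 (eta c z)).
Implicit Types (c : cm_index M) (z : Cn R n).

Definition density c z : R := complex.Re (top_coef (form_pow eta n c z)).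

Lemma densityE c z : chart_image c z ->
  top_coef (form_pow eta n c z) = (density c z)%:C /\ 0 < density c z.
Proof.
move=> Uz.
have : 0 < top_coef (form_pow eta n c z).
  apply: top_coef_gt0; [exact: (form_multilinear formE Uz)|
    exact: (form_alternating formE Uz)|exact: realE|exact: posE].
rewrite /density ltcE; case: (top_coef _) => p q /= /andP[/eqP-> p0].
by [].
Qed.

(** By [wedge_powE] the top coefficient is a polynomial in smooth components of [eta]. *)
Lemma density_continuous c z : chart_image c z -> {for z, continuous (density c)}.
Proof.
move=> Uz; have o := @chart_image_open _ _ M c.
have [sr _] : smoothC (chart_image c) (fun z => top_coef (form_pow eta n c z)).
  have H : smoothC (chart_image c) (fun z => ((2 ^ n)%N%:R)^-1 *
      pf (fun x y => eta c z (fun i => if i == 0 then real_frame x else real_frame y))).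
    apply: smoothCM => //; first exact: smoothC_cst.
    apply: smoothC_sum => // s _; apply: smoothCM => //; first exact: smoothC_cst.
    by apply: smoothC_prod => // i _; exact: form_smooth.
  by apply: (smoothC_ext o) H => y Uy; rewrite /top_coef /form_pow wedge_powE.
exact: smooth_continuous sr Uz.
Qed.

Lemma coord_le_norm (z : Cn R n) i : `|z.1 0 i| <= `|z| /\ `|z.2 0 i| <= `|z|.
Proof.
have H (v : 'rV[R]_n) : `|v 0 i| <= `|v|.
  rewrite [leRHS]/Num.Def.normr /= mx_normrE.
  by apply: (le_bigmax _ (fun j : 'I_1 * 'I_n => `|v j.1 j.2|) (0, i)).
by rewrite prod_normE !le_max !H orbT.
Qed.

Variables (N : nat) (cs : 'I_N -> cm_index M) (rho : 'I_N -> M -> R).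
Hypothesis pou : partition_of_unity cs rho.

Lemma pou_le1 b x : rho b x <= 1.
Proof.
rewrite -(pou_sum pou x) (bigD1 b) //= lerDl; apply: sumr_ge0 => a _.
exact: (pou_ge0 pou).
Qed.

Definition local_density b z : R :=
  if z \in chart_image (cs b) then rho b (cm_inv (cs b) z) * density (cs b) z else 0.

Lemma local_density_ge0 b z : 0 <= local_density b z.
Proof.
rewrite /local_density; case: ifPn => // /[!inE] Uz.
by rewrite mulr_ge0 ?(pou_ge0 pou)//; have [_ /ltW] := densityE Uz.
Qed.

(** The support of [rho b] is closed in a compact space and lies in the chart domain, so its chart
    image [K] is compact. [A] bounds [K], [C] bounds the density on [K], and the integrand vanishes
    off [K], also outside the chart image. *)
Lemma local_density_bounded b : exists A C : R, [/\ 0 <= A, 0 <= C,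
  forall z, 0 <= local_density b z <= C &
  forall z i, A < `|z.1 0 i| \/ A < `|z.2 0 i| -> local_density b z = 0].
Proof.
pose S := closure [set x | rho b x != 0].
have SD : S `<=` cm_dom (cs b) by exact: (pou_support pou).
have cS : compact S by apply: subclosed_compact (@closed_closure _ _) compactM _.
pose K := cm_map (cs b) @` S.
have KU : K `<=` chart_image (cs b) by move=> z [x /SD xD <-]; exists x.
have cK : compact K.
  apply: continuous_compact cS; apply: continuous_in_subspaceT => x /[1!inE] /SD.
  exact: cm_map_continuous.
have out z : ~ K z -> local_density b z = 0.
  move=> nK; rewrite /local_density; case: ifPn => // /[!inE] -[x xD xz].
  case: (eqVneq (rho b (cm_inv (cs b) z)) 0) => [->|r0]; first by rewrite mul0r.
  exfalso; apply: nK; exists x => //; apply: subset_closure.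
  by move: r0; rewrite /= -xz cm_mapK.
have [A A0 KA] : exists2 A : R, 0 < A & forall z, K z -> `|z| <= A.
  exact: pinfty_ex_gt0 (compact_bounded cK).
have cdK : compact (density (cs b) @` K).
  apply: continuous_compact cK; apply: continuous_in_subspaceT => z /[1!inE] /KU.
  exact: density_continuous.
have [C C0 KC] : exists2 C : R, 0 < C & forall y, (density (cs b) @` K) y -> `|y| <= C.
  exact: pinfty_ex_gt0 (compact_bounded cdK).
exists A, C; split; [exact: ltW|exact: ltW| |].
- move=> z; rewrite local_density_ge0 /=.
  have [Kz|/out ->] := pselect (K z); last exact: ltW.
  have Uz := KU _ Kz; have [_ d0] := densityE Uz.
  rewrite /local_density mem_set//.
  have dC : density (cs b) z <= C.
    by rewrite -(ger0_norm (ltW d0)); apply: KC; exists z.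
  apply: le_trans dC; rewrite ler_piMl ?(ltW d0)//.
  exact: pou_le1.
- move=> z i zA; apply: out => /KA zK.
  have [h1 h2] := coord_le_norm z i.
  by case: zA; rewrite ltNge ?(le_trans h1 zK) ?(le_trans h2 zK).
Qed.

Lemma local_integralE b : integral_Cn
    (patch (fun=> 0) (chart_image (cs b))
       (fun z => (rho b (cm_inv (cs b) z))%:C * top_coef (form_pow eta n (cs b) z))) =
  (integral_Cn_real (local_density b))%:C.
Proof.
rewrite -integral_Cn_realE; congr integral_Cn; apply/funext => z.
rewrite /patch /local_density; case: ifPn => // /[!inE] Uz.
by have [-> _] := densityE Uz; rewrite -rmorphM.
Qed.

Lemma local_integral_ge0 b : 0 <= integral_Cn_real (local_density b).
Proof.
have [A [C [A0 C0 hC h0]]] := local_density_bounded b.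
exact: integral_Cn_bounds A0 C0 hC h0.
Qed.

(** By continuity the integrand stays above half of its positive value at the image of [x] on a
    small cube. *)
Lemma local_integral_gt0 b x : 0 < rho b x -> 0 < integral_Cn_real (local_density b).
Proof.
move=> rx; have [A [C [A0 C0 hC h0]]] := local_density_bounded b.
have xD : cm_dom (cs b) x.
  by apply: (pou_support pou); apply: subset_closure; rewrite /= gt_eqF.
pose z0 := cm_map (cs b) x; have Uz0 : chart_image (cs b) z0 by exists x.
have o := @chart_image_open _ _ M (cs b).
pose q z := rho b (cm_inv (cs b) z) * density (cs b) z.
have q0 : 0 < q z0.
  by rewrite /q /z0 cm_mapK// mulr_gt0//; have [] := densityE Uz0.
have cq : {for z0, continuous q}.
  apply: continuousM; last exact: density_continuous.
  exact: smooth_continuous (pou_smooth pou b (cs b)) Uz0.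
have e0 : 0 < q z0 / 2 by rewrite divr_gt0.
have /nbhs_ballP[r /= r0 hr] : \forall z \near z0,
    chart_image (cs b) z /\ q z0 / 2 <= q z.
  apply: filterI; first exact: open_nbhs_nbhs.
  move/cvgrPdist_le : cq => /(_ _ e0); apply: filterS => z.
  rewrite ler_norml => /andP[_]; lra.
(* Half the radius, because the cube in [integral_Cn_gt0] is closed while the ball is open. *)
have s0 : 0 < r / 2 by rewrite divr_gt0.
apply: (integral_Cn_gt0 A0 C0 hC h0 s0 e0 (c := z0)) => z zs.
have [|Uz qz] := hr z; last by rewrite /local_density mem_set.
have rr : r / 2 < r by rewrite ltr_pdivrMr// ltr_pMr// ltr1n.
suff : ball z0.1 r z.1 /\ ball z0.2 r z.2 by [].
split; split=> // i j; rewrite -ball_normE /= ord1 distrC; apply: le_lt_trans rr.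
- by have [] := zs j.
- by have [] := zs j.
Qed.

Lemma sum_local_integral_gt0 (x : M) : 0 < \sum_(b < N) integral_Cn
    (patch (fun=> 0) (chart_image (cs b))
       (fun z => (rho b (cm_inv (cs b) z))%:C * top_coef (form_pow eta n (cs b) z))).
Proof.
under eq_bigr do rewrite local_integralE.
rewrite -rmorph_sum /= ltcR.
have [b rb] : exists b, 0 < rho b x.
  apply: contrapT => /forallNP H; have := pou_sum pou x; rewrite big1 => [/eqP|b _].
    by rewrite eq_sym oner_eq0.
  by apply/eqP; rewrite eq_le (pou_ge0 pou) andbT leNgt; apply/negP/H.
rewrite (bigD1 b) //= ltr_pwDl//; first exact: local_integral_gt0 rb.
by apply: sumr_ge0 => a _; exact: local_integral_ge0.
Qed.

End Positivity.

(* [integral_form] is an [xget] with default value [0]. *)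
Lemma integral_form_neq0 (R : realType) n (M : complexManifold R n)
    (a : local_forms M (n * 2)) : integral_form a != 0 ->
  (exists x : M, True) /\
  exists N (c : 'I_N -> cm_index M) rho, partition_of_unity c rho.
Proof.
rewrite /integral_form; case: xgetP => [I -> [N [c [rho [pou ->]]]] I0|]; last first.
  by rewrite eqxx.
split; last by exists N, c, rho.
(* On an empty manifold all chart images are empty, so every local integrand is zero and the nonzero
   value is contradicted. *)
apply: contrapT => /forallNP H; move/eqP: I0; apply; rewrite big1// => b _.
have -> : (patch (fun=> 0) (chart_image (c b))
     (fun z => (rho b (cm_inv (c b) z))%:C * top_coef (a (c b) z))) = (fun=> 0%:C).
  apply/funext => z; rewrite /patch ifF//; apply/negP => /[!inE] -[x _ _].
  exact: (H x).
rewrite (integral_Cn_realE (fun=> 0)) /integral_Cn_real.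
by under eq_fun do rewrite integral_rV0; rewrite integral_rV0.
Qed.

Theorem proposition5p10 (R : realType) (n : nat) (M : complexManifold R n)
    (hM : compact [set: M]) (g : hermitian_metric M) (lambda : R)
    (hg : static g lambda) (hlambda : lambda != 0) :
  hermitian_symplectic_manifold M /\
  exists omega_t : local_forms M 2,
    [/\ hermitian_symplectic omega_t,
        forall c z, chart_image c z -> forall v,
          bidegree 1 (omega_t c z) v = kahler_form g c z v
      & 0 < integral_form (form_pow omega_t n)].
Proof.
have fE : is_form (tamed_form g lambda).
  split=> [c z Uz|c z Uz|c v|c c' z Wz v].
  - exact: tamed_form_multilinear.
  - exact: tamed_form_alternating.
  - exact: tamed_form_smooth.
  - exact: tamed_form_compat.
have bE c z : chart_image c z ->
    bidegree 1 (tamed_form g lambda c z) = kahler_form g c z.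
  by move=> Uz; apply/funext => v; exact: tamed_form_bidegree1.
have pE c z : chart_image c z ->
    positive_mform (bidegree 1 (tamed_form g lambda c z)).
  by move=> Uz; rewrite bE//; exact: kahler_form_positive.
have hs : hermitian_symplectic (tamed_form g lambda).
  by split=> //; [exact: tamed_form_real|exact: tamed_form_closed].
split; first by exists (tamed_form g lambda).
exists (tamed_form g lambda); split=> // [c z Uz v|]; first by rewrite bE.
(* Unit volume differs from the default value 0 of the integral; this supplies the point and the
   partition of unity. *)
have [[x _] [N [cs [rho pou]]]] : (exists x : M, True) /\
  exists N (c : 'I_N -> cm_index M) rho, partition_of_unity c rho.
  by apply: (@integral_form_neq0 _ _ _ (volume_form g));
    rewrite (static_volume hg) oner_eq0.
(* The selected value comes from an unknown partition of unity, for which the sum is positive as for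
   any other; the default branch is excluded by the partition just found. *)
rewrite /integral_form; case: xgetP => [I -> [N' [cs' [rho' [pou' ->]]]]|H].
  apply: sum_local_integral_gt0 => //; exact: tamed_form_real.
by exfalso; apply: (H _); exists N, cs, rho; split.
Qed.
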